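(* Let $m,n\ge1$, $N=m+n$, let $\Psi\in C^1(\mathbb{G}(N,m),(0,\infty))$ satisfy the atomic condition (AC), and let $\Omega\subset\mathbb{R}^m$ be open and bounded. Let $u_j:\Omega\to\mathbb{R}^n$, $A_j:\Omega\to\mathbb{R}^{n\times m}$, $B_j:\Omega\to\mathbb{R}^{m\times m}$ be sequences such that $u_j$ is equibounded in $W^{1,\infty}$, $A_j,B_j$ are equibounded in $L^\infty$, and $\mathrm{div}\,A_j$, $\mathrm{div}\,B_j$ are equibounded in $L^1$. Let $$W_j:=\begin{pmatrix}Du_j\\ A_j\\ B_j\end{pmatrix},$$ suppose that $\mathrm{dist}(W_j,K_{F_\Psi})\to0$ pointwise a.e. in $\Omega$ as $j\to\infty$, and suppose that $(W_j)_j$ generates a Young measure $(\mu_x)_{x\in\Omega}$. Then this Young measure is trivial: $\mu_x$ is a Dirac mass for a.e. $x\in\Omega$.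
   Context: $\mathbb{G}(N,m)=\{P\in\mathbb{R}^{N\times N}: P=P^t,\ P^2=P,\ \mathrm{tr}(P)=m\}$; $T^\perp:=\mathrm{id}-T$. For $\Psi\in C^1(\mathbb{G}(N,m))$, $D\Psi(T)$ denotes the differential (as a matrix, with respect to the Frobenius inner product) of any $C^1$ extension of $\Psi$ to a neighborhood of $\mathbb{G}(N,m)$ in $\mathbb{R}^{N\times N}$, $d\Psi(T):=D\Psi(T)+D\Psi(T)^t$, and $B_\Psi(T):=\Psi(T)T+T^\perp d\Psi(T)T$ (independent of the extension). For a Borel probability measure $\mu$ on $\mathbb{G}(N,m)$, $A(\mu):=\int B_\Psi(T)\,d\mu(T)$. (AC): $\dim\ker A(\mu)\le n$ for every Borel probability measure $\mu$ on $\mathbb{G}(N,m)$, and $\dim\ker A(\mu)=n$ implies $\mu=\delta_{T_0}$ for some $T_0\in\mathbb{G}(N,m)$. For $X\in\mathbb{R}^{n\times m}$ let $M(X)=\begin{pmatrix}\mathrm{id}_m\\ X\end{pmatrix}$, $\mathcal{A}(X)=\sqrt{\det(M(X)^tM(X))}$, $h(X)=M(X)(M(X)^tM(X))^{-1}M(X)^t\in\mathbb{G}(N,m)$, and $F_\Psi(X):=\Psi(h(X))\mathcal{A}(X)$. $DF_\Psi(X)\in\mathbb{R}^{n\times m}$ is its gradient, and $$K_{F_\Psi}:=\left\{\begin{pmatrix}X\\ DF_\Psi(X)\\ X^tDF_\Psi(X)-F_\Psi(X)\mathrm{id}_m\end{pmatrix}: X\in\mathbb{R}^{n\times m}\right\}\subset\mathbb{R}^{(2n+m)\times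 m}.$$ The divergence of matrix fields is taken row-wise in the sense of distributions. An $L^\infty$-bounded sequence $(W_j)$ generates the Young measure $(\mu_x)_{x\in\Omega}$ (a measurable family of probability measures) if $\int_\Omega f(W_j)\eta\,dx\to\int_\Omega\left(\int f\,d\mu_x\right)\eta\,dx$ for all continuous $f$ and all $\eta\in C^\infty_c(\Omega)$. *)

(* Defs.v *)
From HB Require Import structures.
From mathcomp Require Import all_boot all_order all_algebra.
From mathcomp Require Import all_classical all_reals all_analysis.
From mathcomp Require Import measurable_realfun.

Set Implicit Arguments.
Unset Strict Implicit.
Unset Printing Implicit Defensive.

Import Order.TTheory GRing.Theory Num.Theory.
Import numFieldNormedType.Exports.

Local Open Scope classical_set_scope.
Local Open Scope ring_scope.

Section borel_matrix.
Context {R : realType} {p q : nat}.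

HB.instance Definition _ := @isMeasurable.Build
  (sigma_display (@open 'M[R]_(p, q))) 'M[R]_(p, q)
  <<s @open 'M[R]_(p, q) >>
  (@sigma_algebra0 _ setT _) (@sigma_algebraC _ _)
  (@sigma_algebra_bigcup _ setT _).

Lemma open_measurable_mx (A : set 'M[R]_(p, q)) : open A -> measurable A.
Proof. exact: sub_sigma_algebra. Qed.

Lemma measurable_coord i j :
  measurable_fun setT (fun A : 'M[R]_(p, q) => A i j).
Proof.
apply: (measurability _ (RGenOpens.measurableE R)) => //.
move=> _ [_ [a [b ->]] <-]; rewrite setTI; apply: open_measurable_mx.
by apply: open_comp; [move=> A _; exact: coord_continuous|exact: interval_open].
Qed.

(* R has a countable base, hence so has the product topology on matrices *)
Lemma measurable_mx d (T : measurableType d) (f : T -> 'M[R]_(p, q)) :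
  (forall i j, measurable_fun setT (fun x => f x i j)) ->
  measurable_fun setT f.
Proof.
move=> mf; apply: (@measurability _ _ _ _ _ _ (@open 'M[R]_(p, q))) => //.
move=> _ [U oU <-]; rewrite setTI.
pose cube (cr : 'M[rat]_(p, q) * rat) :=
  [set A : 'M[R]_(p, q) | forall i j, `|A i j - ratr (cr.1 i j)| < ratr cr.2].
have -> : U = \bigcup_(cr in [set cr | cube cr `<=` U]) cube cr.
  apply/seteqP; split => [A UA|A [cr]]; last exact.
  have /nbhs_ballP[e /= e0 AeU] := open_nbhs_nbhs (conj oU UA).
  have [r] : exists r : rat, ratr r \in `]0, e / 2[.
    by apply: rat_in_itvoo; rewrite divr_gt0.
  rewrite in_itv/= => /andP[r0 re].
  have /choice[c cA] (ij : 'I_p * 'I_q) : exists c : rat,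
      `|A ij.1 ij.2 - ratr c| < ratr r.
    have [c] : exists c : rat,
        ratr c \in `](A ij.1 ij.2 - ratr r), (A ij.1 ij.2 + ratr r)[.
      by apply: rat_in_itvoo; rewrite ltrBlDr -addrA ltrDl addr_gt0.
    by rewrite in_itv/= => /andP[c1 c2]; exists c; rewrite distrC ltr_distl c1.
  exists (\matrix_(i, j) c (i, j), r) => /= [B /= cB|i j]; last first.
    by rewrite mxE; exact: (cA (i, j)).
  apply: AeU; split => // i j; rewrite -ball_normE /ball_ /=.
  rewrite (splitr e) -(subrKA (ratr (c (i, j)))).
  apply: (le_lt_trans (ler_normD _ _)); apply: ltrD.
    by apply: lt_trans (cA (i, j)) re.
  by rewrite distrC; apply: lt_trans re; have := cB i j; rewrite mxE.
rewrite preimage_bigcup bigcup_mkcond.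
apply: countable_bigcupT_measurable => // -[c r].
case: ifPn => // _.
have -> : f @^-1` cube (c, r) = \bigcap_(ij in [set: 'I_p * 'I_q])
    (fun x => f x ij.1 ij.2) @^-1` ball (ratr (c ij.1 ij.2) : R) (ratr r).
  apply/seteqP; split => x /= fx.
    by case=> i j _ /=; rewrite /ball/= distrC; exact: fx.
  by move=> i j; rewrite distrC; exact: (fx (i, j)).
apply: fin_bigcap_measurable => // -[i j] _ /=.
rewrite -[X in measurable X]setTI; apply: mf => //.
by apply: open_measurable; exact: ball_open.
Qed.
End borel_matrix.

Section lebesgue_step.
Context {R : realType} (n : nat).

Definition cv_cons (x : R * 'cV[R]_n) : 'cV[R]_n.+1 := col_mx x.1%:M x.2.

Definition cv_uncons (v : 'cV[R]_n.+1) : R * 'cV[R]_n :=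
  (v ord0 ord0, dsubmx (v : 'cV[R]_(1 + n))).

Lemma cv_consK : cancel cv_cons cv_uncons.
Proof.
case=> a v; rewrite /cv_cons /cv_uncons /= col_mxKd; congr pair.
transitivity (col_mx (a%:M : 'M[R]_1) v (lshift n ord0) ord0).
  by congr (col_mx _ _ _ _); exact/val_inj.
by rewrite col_mxEu mxE.
Qed.

Lemma measurable_cv_cons : measurable_fun setT cv_cons.
Proof.
apply: measurable_mx => i j; rewrite ord1.
have [k -> | k ->] := @split_ordP 1 n i.
  rewrite [X in measurable_fun _ X](_ : _ = fst); first exact: measurable_fst.
  apply/funext => x; rewrite /cv_cons.
  by apply: etrans (col_mxEu _ _ _ _) _; rewrite mxE ord1.
rewrite [X in measurable_fun _ X](_ : _ = fun x : R * 'cV[R]_n => x.2 k ord0).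
  exact: (measurableT_comp (measurable_coord k ord0) measurable_snd).
by apply/funext => x; exact: col_mxEd.
Qed.

Lemma measurable_cv_uncons : measurable_fun setT cv_uncons.
Proof.
apply: measurable_fun_pair; first exact: measurable_coord.
apply: measurable_mx => i j; under eq_fun do rewrite mxE.
exact: measurable_coord.
Qed.

Variable mu : {sigma_finite_measure set 'cV[R]_n -> \bar R}.

Definition lebesgue_step : set 'cV[R]_n.+1 -> \bar R :=
  pushforward (lebesgue_measure \x mu)%E cv_cons.

Let lebesgue_step0 : lebesgue_step set0 = 0%E.
Proof. by rewrite /lebesgue_step /pushforward preimage_set0 measure0. Qed.

Let lebesgue_step_ge0 A : (0 <= lebesgue_step A)%E.
Proof. by rewrite /lebesgue_step /pushforward measure_ge0. Qed.

Let lebesgue_step_sigma_additive : semi_sigma_additive lebesgue_step.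
Proof.
move=> F mF tF mUF; rewrite /lebesgue_step /pushforward preimage_bigcup.
apply: measure_semi_sigma_additive.
- by move=> k; rewrite -[X in measurable X]setTI; exact: measurable_cv_cons.
- apply/trivIsetP => /= i j _ _ ij; rewrite -preimage_setI.
  by move/trivIsetP : tF => /(_ _ _ _ _ ij) ->//; rewrite preimage_set0.
- rewrite -preimage_bigcup -[X in measurable X]setTI.
  exact: measurable_cv_cons.
Qed.

HB.instance Definition _ := isMeasure.Build _ _ _ lebesgue_step
  lebesgue_step0 lebesgue_step_ge0 lebesgue_step_sigma_additive.

Let lebesgue_step_sigma_finite : sigma_finite setT lebesgue_step.
Proof.
have /sigma_finiteP[F [FT ndF mF]] := sigma_finiteT (@lebesgue_measure R).
have /sigma_finiteP[G [GT ndG mG]] := sigma_finiteT mu.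
exists (fun k => cv_uncons @^-1` (F k `*` G k)).
  apply/seteqP; split => // v _.
  have [i _ Fi] : (\bigcup_k F k) (cv_uncons v).1 by rewrite -FT.
  have [j _ Gj] : (\bigcup_k G k) (cv_uncons v).2 by rewrite -GT.
  exists (maxn i j) => //; split.
    by move: Fi; exact/subsetPset/ndF/leq_maxl.
  by move: Gj; exact/subsetPset/ndG/leq_maxr.
move=> k; have [? ?] := mF k; have [? ?] := mG k.
split.
  rewrite -[X in measurable X]setTI; apply: measurable_cv_uncons => //.
  exact: measurableX.
rewrite /lebesgue_step /pushforward (_ : _ @^-1` _ = F k `*` G k).
  by rewrite product_measure1E// lte_mul_pinfty// ge0_fin_numE.
by apply/seteqP; split => x; rewrite /preimage /mkset cv_consK.
Qed.

HB.instance Definition _ := Measure_isSigmaFinite.Build _ _ _ lebesgue_step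
  lebesgue_step_sigma_finite.

End lebesgue_step.

(* Lebesgue measure on R^(k+1) is the image of the product of those on R and
   R^k; see [lebesgue_cV_box] for its value on boxes. *)
Fixpoint lebesgue_cV {R : realType} (n : nat) :
    {sigma_finite_measure set 'cV[R]_n -> \bar R} :=
  if n is k.+1 then lebesgue_step (lebesgue_cV k) else \d_(0 : 'cV[R]_0).

Lemma lebesgue_cV_box {R : realType} n (a b : 'cV[R]_n) :
  (forall i, a i ord0 <= b i ord0) ->
  lebesgue_cV n [set x : 'cV[R]_n | forall i, a i ord0 < x i ord0 <= b i ord0]
  = (\prod_(i < n) (b i ord0 - a i ord0))%:E.
Proof.
elim: n a b => [a b _|n IHn a b ab].
  by rewrite big_ord0 /= diracE mem_set// => -[].
rewrite big_ord_recl /= /lebesgue_step /pushforward.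
pose a' := (cv_uncons a).2; pose b' := (cv_uncons b).2.
have uE (v : 'cV[R]_n.+1) i : (cv_uncons v).2 i ord0 = v (lift ord0 i) ord0.
  by rewrite /cv_uncons mxE; congr (v _ _); exact/val_inj.
rewrite [X in (_ \x _)%E X](_ : _ = `]a ord0 ord0, b ord0 ord0]%classic `*`
    [set x : 'cV[R]_n | forall i, a' i ord0 < x i ord0 <= b' i ord0]).
  rewrite product_measure1E//=.
  - rewrite lebesgue_measure_itv/= IHn; last by move=> i; rewrite !uE.
    under [in RHS]eq_bigr do rewrite -!uE.
    rewrite lte_fin; case: ifPn => [_|]; first by rewrite -EFinB -EFinM.
    rewrite -leNgt => ba; have -> : b ord0 ord0 = a ord0 ord0.
      by apply/eqP; rewrite eq_le ba ab.
    by rewrite subrr mul0r mul0e.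
  - rewrite [X in measurable X](_ : _ = \bigcap_(i in [set: 'I_n])
        (fun x : 'cV[R]_n => x i ord0) @^-1` `]a' i ord0, b' i ord0]).
      apply: fin_bigcap_measurable => // i _.
      by rewrite -[X in measurable X]setTI; apply: measurable_coord.
    apply/seteqP; split => x /= xab i; last by have := xab i I; rewrite /= in_itv.
    by move=> _ /=; rewrite in_itv /=.
apply/seteqP; split => [[t v]|[t v] [/=]].
  move=> tv; have tv0 := tv ord0.
  have tvE : t = cv_cons (t, v) ord0 ord0.
    by rewrite -[LHS]/((t, v).1) -[in LHS](cv_consK (t, v)).
  split => /=; first by rewrite in_itv/= tvE.
  move=> i; rewrite !uE; have := tv (lift ord0 i).
  by rewrite -(uE (cv_cons (t, v))) cv_consK.
rewrite in_itv /= => tab vab i.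
have [j -> | ->] := unliftP ord0 i.
  by rewrite -!uE cv_consK; exact: vab.
by have -> : cv_cons (t, v) ord0 ord0 = t by exact: (congr1 fst (cv_consK (t, v))).
Qed.

Section measurability.
Context {R : realType} {m : nat}.
Local Notation leb := (@lebesgue_cV R m).
Implicit Types Omega : set 'cV[R]_m.

(* [lebesgue_cV] lives on the Borel sigma-algebra: a function on [Omega] is
   Lebesgue measurable when it agrees a.e. with a Borel function. *)
Definition ae_measurable d (T : measurableType d) Omega (f : 'cV[R]_m -> T) :=
  exists2 g : 'cV[R]_m -> T,
    measurable_fun Omega g & f = g %[ae leb in Omega].

(* Equiboundedness does not depend on the norm of the target; `|_| is the
   maximum of the absolute values of the entries. *)
Definition Linfty_bounded p q Omega (f : nat -> 'cV[R]_m -> 'M[R]_(p, q)) :=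
  (forall j, ae_measurable Omega (f j)) /\
  exists C : R, forall j, {ae leb, forall x, Omega x -> `|f j x| <= C}.

Definition L1_bounded p q Omega (f : nat -> 'cV[R]_m -> 'M[R]_(p, q)) :=
  (forall j, ae_measurable Omega (f j)) /\
  exists C : R, forall j, (\int[leb]_(x in Omega) `|f j x|%:E <= C%:E)%E.

End measurability.

Section distributional_derivatives.
Context {R : realType} {m : nat}.
Local Notation leb := (@lebesgue_cV R m).
Implicit Types (Omega : set 'cV[R]_m) (phi : 'cV[R]_m -> R).

Definition partial (i : 'I_m) phi : 'cV[R]_m -> R :=
  fun x => 'D_(delta_mx i ord0) phi x.

(* Requiring each iterated partial derivative to be differentiable makes all of
   them exist and be continuous. *)
Definition smooth phi :=
  forall (s : seq 'I_m) x, differentiable (foldr partial phi s) x.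

Definition test_function Omega phi :=
  [/\ smooth phi, compact (closure [set x | phi x != 0])
    & closure [set x | phi x != 0] `<=` Omega].

(* The two definitions below are meant for locally integrable functions, since
   the real-valued integral of a non-integrable function is a default value. *)
Definition weak_jacobian n Omega (u : 'cV[R]_m -> 'cV[R]_n)
    (Du : 'cV[R]_m -> 'M[R]_(n, m)) :=
  forall phi, test_function Omega phi -> forall i k,
    \int[leb]_(x in Omega) (u x i ord0 * partial k phi x) =
    - \int[leb]_(x in Omega) (Du x i k * phi x).

Definition weak_row_div p Omega (A : 'cV[R]_m -> 'M[R]_(p, m))
    (f : 'cV[R]_m -> 'cV[R]_p) :=
  forall phi, test_function Omega phi -> forall i,
    \int[leb]_(x in Omega) (\sum_(k < m) A x i k * partial k phi x) =
    - \int[leb]_(x in Omega) (f x i ord0 * phi x).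

Definition generates_young_measure p q Omega
    (W : nat -> 'cV[R]_m -> 'M[R]_(p, q))
    (mu : 'cV[R]_m -> probability 'M[R]_(p, q) R) :=
  (forall E : set 'M[R]_(p, q), measurable E ->
    ae_measurable Omega (fun x => mu x E)) /\
  forall (f : 'M[R]_(p, q) -> R) eta,
    continuous f -> test_function Omega eta ->
    (fun j => \int[leb]_(x in Omega) (f (W j x) * eta x)) @ \oo -->
    \int[leb]_(x in Omega) ((\int[mu x]_Z f Z) * eta x).

End distributional_derivatives.

Section matrix_calculus.
Context {R : realType} {p q : nat}.

Definition mx_grad (f : 'M[R]_(p, q) -> R) (X : 'M[R]_(p, q)) : 'M[R]_(p, q) :=
  \matrix_(i, j) 'D_(delta_mx i j) f X.

Definition C1_on (U : set 'M[R]_(p, q)) (f : 'M[R]_(p, q) -> R) :=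
  forall X, U X -> differentiable f X /\ {for X, continuous (mx_grad f)}.

Definition frobenius_norm (A : 'M[R]_(p, q)) : R :=
  Num.sqrt (\sum_i \sum_j A i j ^+ 2).

Definition frobenius_dist (A : 'M[R]_(p, q)) (K : set 'M[R]_(p, q)) : R :=
  inf [set frobenius_norm (A - Z) | Z in K].

End matrix_calculus.

Section grassmannian.
Context {R : realType}.

Definition grassmannian {N : nat} (m : nat) : set 'M[R]_N :=
  [set P | [/\ P^T = P, P *m P = P & \tr P = m%:R]].

Context {N : nat} (m : nat).
Implicit Types Psi : 'M[R]_N -> R.

(* A function on the Grassmannian is represented by a function on all matrices
   whose values elsewhere are irrelevant. *)
Definition C1_extension Psi (Phi : 'M[R]_N -> R) :=
  exists U : set 'M[R]_N, [/\ open U, grassmannian m `<=` U, C1_on U Phi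
    & forall T, grassmannian m T -> Phi T = Psi T].

Definition C1_grassmannian Psi := exists Phi, C1_extension Psi Phi.

(* [B_integrand] does not depend on the extension being chosen. *)
Definition chosen_extension Psi : 'M[R]_N -> R := get (C1_extension Psi).

Definition d_grassmannian Psi (T : 'M[R]_N) : 'M[R]_N :=
  mx_grad (chosen_extension Psi) T + (mx_grad (chosen_extension Psi) T)^T.

Definition B_integrand Psi (T : 'M[R]_N) : 'M[R]_N :=
  Psi T *: T + (1%:M - T) *m d_grassmannian Psi T *m T.

(* Borel probability measures on the Grassmannian are those on the ambient
   matrix space that give it full mass. *)
Definition A_average Psi (mu : probability 'M[R]_N R) : 'M[R]_N :=
  \matrix_(i, j) \int[mu]_(T in grassmannian m) B_integrand Psi T i j.

(* [kermx] is the kernel of the action on row vectors, hence the transpose. *)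
Definition dim_ker (A : 'M[R]_N) : nat := \rank (kermx A^T).

Definition atomic_condition (n : nat) Psi :=
  forall mu : probability 'M[R]_N R, mu (grassmannian m) = 1%E ->
    (dim_ker (A_average Psi mu) <= n)%N /\
    (dim_ker (A_average Psi mu) = n ->
      exists2 T0, grassmannian m T0 &
        forall E, measurable E -> mu E = \d_T0 E).

End grassmannian.

Section nonparametric.
Context {R : realType} {m n : nat}.
Implicit Types (Psi : 'M[R]_(m + n) -> R) (X : 'M[R]_(n, m)).

Definition graph_mx X : 'M[R]_(m + n, m) := col_mx 1%:M X.

Definition gram X : 'M[R]_m := (graph_mx X)^T *m graph_mx X.

Definition area X : R := Num.sqrt (\det (gram X)).

Definition graph_proj X : 'M[R]_(m + n) :=
  graph_mx X *m invmx (gram X) *m (graph_mx X)^T.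

Definition F_Psi Psi X : R := Psi (graph_proj X) * area X.

Definition K_F Psi : set 'M[R]_(n + n + m, m) :=
  [set col_mx (col_mx X (mx_grad (F_Psi Psi) X))
     (X^T *m mx_grad (F_Psi Psi) X - (F_Psi Psi X)%:M) | X in setT].

End nonparametric.

(* Main.v *)
(* On a graph with tangent map [M = graph_mx X] and [T = graph_proj X], let
     G = area X * (Psi T M + (1 - T) dPsi(T) M) (M^t M)^-1.
   Its lower block is DF_Psi(X), its upper block is F_Psi(X) id - X^t DF_Psi(X),
   and G M^t = area X * B_Psi(T).  So on K_F the rows of G are, up to sign, the
   rows of A and B, while those of M are constant or rows of Du.

   By the div-curl lemma, inner products of rows of A_j, B_j with rows of Du_j
   pass to the weak limit, so that for almost every x the measure mu_x, which is
   supported in K_F, satisfies E[G M^t] = E[G] E[M]^t, a matrix of rank at most m.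
   Let nu be the image under [graph_proj] of mu_x weighted by the normalized area.
   Then A(nu) is a multiple of E[G M^t], hence dim ker A(nu) >= n, and (AC) makes
   nu a Dirac mass.  Since X |-> graph_proj X is injective and K_F is a graph over
   X, mu_x is itself a Dirac mass.

   The divergences are bounded in L^1 only, so the div-curl lemma is obtained by
   mollifying u_j into equi-Lipschitz functions, whose limit is locally uniform. *)

Require Import Defs.
From HB Require Import structures.
From mathcomp Require Import all_boot all_order all_algebra.
From mathcomp Require Import all_classical all_reals all_analysis.
From mathcomp Require Import perm ring lra measurable_realfun.

Set Implicit Arguments.
Unset Strict Implicit.
Unset Printing Implicit Defensive.

Import Order.TTheory GRing.Theory Num.Theory.
Import numFieldNormedType.Exports.

Local Open Scope classical_set_scope.
Local Open Scope ring_scope.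

(** Both factors of the inner products converge only weakly, so the div-curl argument separates
    their indices. Let v_j be a row of A_j or B_j, and w_k a mollification of a component of u_k.
    Integration by parts against a cut-off phi turns the pairing of v_j with grad w_k into - int
    div(phi v_j) w_k, for every pair (j, k). Exchanging w_j for w_k then costs at most the L^1 norm
    of div(phi v_j) times sup |w_j - w_k|, which uniform convergence makes small. With k fixed, v_j
    may tend to its weak limit against the fixed function grad w_k; the gradients are sent to their
    limit separately. The scale of w_k is chosen after u_k and so fine that mollifying is invisible,
    up to 1/(k+1), in the pairings of stage k.

    The data are given up to null sets, whereas weak limits, Fubini and products are handled for
    Borel functions with bounds valid everywhere. The data are therefore exchanged for such
    representatives and integrated against Lebesgue measure restricted to Omega, a finite measure on
    the whole space. Convergence against a small explicit class of test functions is extended to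
    integrable ones by L^1 density. *)

Section matrix_norm.
Context {R : realType} {p q : nat}.
Implicit Types A : 'M[R]_(p, q).

Lemma coord_le_norm A i j : `|A i j| <= `|A|.
Proof.
rewrite -[`|A|]/(mx_norm A) mx_normrE.
exact: (le_bigmax _ (fun ij => `|A ij.1 ij.2|) (i, j)).
Qed.

Lemma mx_norm_le A (c : R) : 0 <= c -> (forall i j, `|A i j| <= c) -> `|A| <= c.
Proof.
move=> c0 Ac; rewrite -[`|A|]/(mx_norm A) mx_normrE.
by apply/bigmax_leP; split=> // -[i j] _; exact: Ac.
Qed.

Lemma mx_norm_lt A (c : R) : 0 < c -> (forall i j, `|A i j| < c) -> `|A| < c.
Proof.
move=> c0 Ac; rewrite -[`|A|]/(mx_norm A) mx_normrE.
by apply/bigmax_ltP; split=> // -[i j] _; exact: Ac.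
Qed.

End matrix_norm.

(** * Smooth test functions *)

Section flat_exp.
Context {R : realType}.
Implicit Types t : R.

(** The powers of 1/t are part of the family because differentiation produces them: the derivative
    of the k-th function combines those of index k+2 and k+1. *)
Definition flat_exp k t : R :=
  if 0 < t then t^-1 ^+ k * expR (- t^-1) else 0.

Lemma flat_exp_ge0 k t : 0 <= flat_exp k t.
Proof.
rewrite /flat_exp; case: ifPn => // t0.
by rewrite mulr_ge0 ?expR_ge0// exprn_ge0// invr_ge0 ltW.
Qed.

Lemma flat_exp0_gt0 t : (0 < flat_exp 0 t) = (0 < t).
Proof.
by rewrite /flat_exp; case: ifPn; rewrite ?ltxx// expr0 mul1r expR_gt0.
Qed.

Lemma flat_exp0_neq0 t : (flat_exp 0 t != 0) = (0 < t).
Proof. by rewrite -flat_exp0_gt0 lt0r flat_exp_ge0 andbT. Qed.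

Lemma flat_exp0_le1 t : flat_exp 0 t <= 1.
Proof.
rewrite /flat_exp; case: ifPn => // t0.
by rewrite expr0 mul1r expR_le1 oppr_le0 invr_ge0 ltW.
Qed.

(** A single term x^k / k! of the exponential series at x = 1/t is at most exp(1/t), which bounds
    the function by k!. *)
Lemma flat_exp_bounded k : exists C, forall t, `|flat_exp k t| <= C.
Proof.
case: k => [|k].
  by exists 1 => t; rewrite ger0_norm ?flat_exp_ge0 ?flat_exp0_le1.
exists k.+1`!%:R => t; rewrite ger0_norm ?flat_exp_ge0// /flat_exp.
case: ifPn => // t0; rewrite expRN ler_pdivrMr ?expR_gt0// mulrC.
rewrite -ler_pdivrMr ?ltr0n ?fact_gt0//.
apply: le_trans (expR_ge1Dxn k _); first by rewrite lerDr.
by rewrite invr_ge0 ltW.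
Qed.

(** Each use trades a power of 1/t for a factor t; two of them show that [flat_exp k] is O(t^2) at
    the origin. *)
Lemma flat_expS k t : flat_exp k t = t * flat_exp k.+1 t.
Proof.
rewrite /flat_exp; case: ifPn => [t0|]; last by rewrite mulr0.
by rewrite exprS !mulrA mulfV ?mul1r// gt_eqF.
Qed.

Lemma is_derive_flat_exp k t :
  is_derive t 1 (flat_exp k) (flat_exp k.+2 t - k%:R * flat_exp k.+1 t).
Proof.
have [t0|t0|<-] := ltgtP 0 t.
- have nE : \near t, t^-1 ^+ k * expR (- t^-1) = flat_exp k t.
    near=> s; rewrite /flat_exp ifT//.
    by near: s; apply: open_nbhs_nbhs; split; [exact: open_gt|exact: t0].
  have [tn0 tV] : t != 0 /\ is_derive t 1 (fun s : R => s^-1) (- t ^- 2).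
    have tn0 : t != 0 by rewrite gt_eqF.
    split=> //; apply: (is_derive_eq (is_deriveV (f := id) tn0 (is_derive_id t 1))).
    by rewrite scaler1.
  have H : is_derive t 1 (fun s => s^-1 ^+ k * expR (- s^-1))
      (t^-1 ^+ k * (expR (- t^-1) * t ^- 2) +
       expR (- t^-1) * (k%:R * t^-1 ^+ k.-1 * - t ^- 2)).
    have H1 : is_derive t 1 (fun s : R => - s^-1) (t ^- 2).
      by apply: (is_derive_eq (is_deriveN tV)); rewrite opprK.
    have H2 : is_derive t 1 (fun s : R => expR (- s^-1))
        (expR (- t^-1) * t ^- 2).
      exact: (is_derive1_comp (g := fun s : R => - s^-1)
        (is_derive_expR (- t^-1)) H1).
    have H3 : is_derive t 1 (fun s : R => s^-1 ^+ k)
        (k%:R * t^-1 ^+ k.-1 * - t ^- 2).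
      have -> : (fun s : R => s^-1 ^+ k) = (fun s : R => s^-1) ^+ k.
        by apply/funext => s; rewrite exprfctE.
      by apply: is_derive_eq (is_deriveX k tV) _; rewrite -mulr_natl.
    exact: is_deriveM H3 H2.
  apply: is_derive_eq (near_eq_is_derive nE H) _.
  rewrite /flat_exp t0 -!exprVn; case: k {nE H} => [|k] /=.
    by rewrite !mul0r mulr0 subr0 addr0; ring.
  by rewrite !exprS; ring.
- have H : is_derive t 1 (cst (0 : R)) 0 by exact: is_derive_cst.
  have nE : \near t, cst 0 t = flat_exp k t.
    near=> s; rewrite /flat_exp ifN// -leNgt ltW//.
    by near: s; apply: open_nbhs_nbhs; split; [exact: open_lt|exact: t0].
  by apply: is_derive_eq (near_eq_is_derive nE H) _; rewrite /flat_exp lt_gtF// mulr0 subrr.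
(* At the origin the difference quotient is h times [flat_exp k.+2 h], hence O(h). *)
- have [C CP] := flat_exp_bounded k.+2.
  have H : h^-1 *: (flat_exp k (h *: 1 + 0) - flat_exp k 0) @[h --> 0^'] -->
      (0 : R).
    apply/cvgrPdist_le => e e0; near=> h.
    rewrite addr0 [in flat_exp k 0]/flat_exp ltxx subr0 sub0r normrN.
    have hn0 : h != 0 by near: h; exact: nbhs_dnbhs_neq.
    rewrite [h *: 1]mulr1 flat_expS flat_expS scalerA mulVf// scale1r normrM.
    have C1 : 0 < `|C| + 1 by rewrite ltr_wpDl.
    apply: (@le_trans _ _ (`|h| * (`|C| + 1))).
      rewrite ler_pM2l ?normr_gt0//; apply: le_trans (CP _) _.
      by rewrite (le_trans (ler_norm _))// lerDl.
    rewrite -ler_pdivlMr//; near: h; apply: dnbhs0_le.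
    by rewrite divr_gt0.
  apply: DeriveDef; first by apply/cvg_ex; eexists; exact: H.
  rewrite /derive (cvg_lim _ H)//.
  by rewrite /flat_exp ltxx mulr0 subrr.
Unshelve. all: by end_near. Qed.

Lemma derivable_flat_exp k t : derivable (flat_exp k) t 1.
Proof. by case: (is_derive_flat_exp k t). Qed.

Lemma derive_flat_exp k t :
  'D_1 (flat_exp k) t = flat_exp k.+2 t - k%:R * flat_exp k.+1 t.
Proof. by case: (is_derive_flat_exp k t). Qed.

End flat_exp.

Section flat_alg.
Context {R : realType} {m : nat}.
Local Notation V := 'cV[R]_m.
Implicit Types (f g : V -> R) (x y : V).

(* The algebra generated by the functions t^-k exp(-1/t) of the coordinates is
   closed under partial derivatives and bounded, and contains enough bump
   functions to serve as the test functions. *)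
Inductive flat_alg : (V -> R) -> Prop :=
| flat_alg_cst c : flat_alg (fun=> c)
| flat_alg_coord k i c d :
    flat_alg (fun x => flat_exp k (c * x i ord0 + d))
| flat_algD f g : flat_alg f -> flat_alg g -> flat_alg (fun x => f x + g x)
| flat_algM f g : flat_alg f -> flat_alg g -> flat_alg (fun x => f x * g x).

Lemma flat_alg_prod (I : Type) (r : seq I) (F : I -> V -> R) :
  (forall i, flat_alg (F i)) -> flat_alg (fun x => \prod_(i <- r) F i x).
Proof.
move=> FP; elim: r => [|i r IH].
  by under eq_fun do rewrite big_nil; exact: flat_alg_cst.
by under eq_fun do rewrite big_cons; exact: flat_algM.
Qed.

Lemma flat_algX f k : flat_alg f -> flat_alg (fun x => f x ^+ k).
Proof.
move=> fP; elim: k => [|k IH].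
  by under eq_fun do rewrite expr0; exact: flat_alg_cst.
by under eq_fun do rewrite exprS; exact: flat_algM.
Qed.

Lemma flat_algN f : flat_alg f -> flat_alg (fun x => - f x).
Proof.
move=> fP; under eq_fun do rewrite -mulN1r.
by apply: flat_algM => //; exact: flat_alg_cst.
Qed.

Lemma flat_algB f g : flat_alg f -> flat_alg g -> flat_alg (fun x => f x - g x).
Proof. by move=> fP gP; apply: flat_algD => //; exact: flat_algN. Qed.

Lemma differentiable_affine (i : 'I_m) (c d : R) x :
  differentiable (fun x : V => c * x i ord0 + d) x.
Proof.
apply: differentiableD; last exact: differentiable_cst.
by apply: differentiableM; [exact: differentiable_cst|exact: differentiable_coord].
Qed.

Lemma flat_alg_differentiable f x : flat_alg f -> differentiable f x.
Proof.
elim=> {f} [c|k i c d|f g _ fP _ gP|f g _ fP _ gP].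
- exact: differentiable_cst.
- apply: (@differentiable_comp _ _ _ _ (fun x : V => c * x i ord0 + d)
    (flat_exp k)); first exact: differentiable_affine.
  by apply/derivable1_diffP; exact: derivable_flat_exp.
- exact: differentiableD.
- exact: differentiableM.
Qed.

Lemma partialD i f g x : differentiable f x -> differentiable g x ->
  partial i (fun x => f x + g x) x = partial i f x + partial i g x.
Proof. by move=> df dg; rewrite /partial deriveD//; exact: diff_derivable. Qed.

Lemma partialM i f g x : differentiable f x -> differentiable g x ->
  partial i (fun x => f x * g x) x = f x * partial i g x + g x * partial i f x.
Proof. by move=> df dg; rewrite /partial deriveM//; exact: diff_derivable. Qed.

(** The right-hand side uses constants, sums and products only, so that it belongs to [flat_alg] by
    the constructors. *)
Lemma partial_coord j k (i : 'I_m) (c d : R) :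
  partial j (fun x : V => flat_exp k (c * x i ord0 + d)) =
  fun x => (c * (i == j)%:R) * (flat_exp k.+2 (c * x i ord0 + d) +
    - k%:R * flat_exp k.+1 (c * x i ord0 + d)).
Proof.
apply/funext => x; rewrite /partial.
pose g x : R := c * x i ord0 + d.
have dflat : differentiable (flat_exp k) (g x).
  by apply/derivable1_diffP; exact: derivable_flat_exp.
rewrite deriveE; last exact: flat_alg_differentiable (flat_alg_coord _ _ _ _).
rewrite (@diff_comp _ _ _ _ g (flat_exp k))//; last exact: differentiable_affine.
rewrite /= deriv1E; last exact/derivable1_diffP.
rewrite derive1E derive_flat_exp.
rewrite -deriveE; last exact: differentiable_affine.
have -> : 'D_(delta_mx j ord0) g x = c * (i == j)%:R.
  have dc : differentiable (fun x : V => x i ord0 : R) x.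
    exact: differentiable_coord.
  rewrite /g deriveD ?derive_cst ?addr0//; last first.
    by apply/diff_derivable/differentiableM.
  rewrite deriveMl; last exact: diff_derivable.
  congr (_ * _); rewrite /derive.
  have H : h^-1 *: ((h *: delta_mx j ord0 + x) i ord0 - x i ord0) @[h --> 0^'] -->
      ((i == j)%:R : R).
    apply: cvg_near_cst; near=> h.
    have h0 : h != 0 by near: h; exact: nbhs_dnbhs_neq.
    by rewrite !mxE eqxx andbT addrK scalerA mulVf// scale1r.
  by rewrite (cvg_lim _ H).
by rewrite mulNr.
Unshelve. all: by end_near. Qed.

Lemma flat_alg_partial i f : flat_alg f -> flat_alg (partial i f).
Proof.
elim=> {f} [c|k j c d|f g fP ifP gP igP|f g fP ifP gP igP].
- rewrite (_ : partial i _ = fun=> 0); first exact: flat_alg_cst.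
  by apply/funext => x; rewrite /partial derive_cst.
- rewrite partial_coord; apply: flat_algM; first exact: flat_alg_cst.
  apply: flat_algD; first exact: flat_alg_coord.
  by apply: flat_algM; [exact: flat_alg_cst|exact: flat_alg_coord].
- rewrite (_ : partial i _ = fun x => partial i f x + partial i g x).
    exact: flat_algD.
  by apply/funext => x; rewrite partialD//; exact: flat_alg_differentiable.
- rewrite (_ : partial i _ =
    fun x => f x * partial i g x + g x * partial i f x).
    by apply: flat_algD; exact: flat_algM.
  by apply/funext => x; rewrite partialM//; exact: flat_alg_differentiable.
Qed.

Lemma flat_alg_smooth f : flat_alg f -> smooth f.
Proof.
move=> fP s x; apply: flat_alg_differentiable.
by elim: s => //= i s; exact: flat_alg_partial.
Qed.

Lemma flat_alg_bounded f : flat_alg f -> exists C, forall x, `|f x| <= C.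
Proof.
elim=> {f} [c|k i c d|f g _ [C fC] _ [D gD]|f g _ [C fC] _ [D gD]].
- by exists `|c|.
- by have [C CP] := @flat_exp_bounded R k; exists C => x.
- by exists (C + D) => x; rewrite (le_trans (ler_normD _ _))// lerD.
- by exists (C * D) => x; rewrite normrM ler_pM.
Qed.

Lemma measurable_flat_alg f : flat_alg f -> measurable_fun setT f.
Proof.
elim=> {f} [c|k i c d|f g _ fP _ gP|f g _ fP _ gP].
- exact: measurable_cst.
- apply: (measurableT_comp (f := flat_exp k)); last first.
    apply: measurable_funD => //; apply: measurable_funM => //.
    exact: measurable_coord.
  apply: continuous_measurable_fun => t.
  apply/differentiable_continuous/derivable1_diffP.
  exact: derivable_flat_exp.
- exact: measurable_funD.
- exact: measurable_funM.
Qed.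

End flat_alg.

(** * Real-valued integrals *)

Section real_integrals.
Context d (T : measurableType d) {R : realType}.
Variable P : {measure set T -> \bar R}.
Implicit Types f g : T -> R.

Definition rintegrable f := P.-integrable setT (EFin \o f).

Lemma rintegrable_measurable f : rintegrable f -> measurable_fun setT f.
Proof. by move=> /integrableP[/measurable_EFinP]. Qed.

Lemma rintegrableD f g : rintegrable f -> rintegrable g ->
  rintegrable (fun x => f x + g x).
Proof.
move=> intf intg; rewrite /rintegrable.
rewrite (_ : _ \o _ = (EFin \o f) \+ (EFin \o g))%E; last exact/funext.
exact: integrableD.
Qed.

Lemma rintegrableZ c f : rintegrable f -> rintegrable (fun x => c * f x).
Proof.
move=> intf; rewrite /rintegrable.
rewrite (_ : _ \o _ = fun x => (c%:E * (EFin \o f) x)%E); last exact/funext.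
exact: integrableZl.
Qed.

Lemma rintegrableB f g : rintegrable f -> rintegrable g ->
  rintegrable (fun x => f x - g x).
Proof.
move=> intf intg; rewrite (_ : (fun _ => _) = fun x => f x + -1 * g x).
  by apply: rintegrableD => //; exact: rintegrableZ.
by apply/funext => x; rewrite mulN1r.
Qed.

Lemma le_rintegrable f g : measurable_fun setT f -> rintegrable g ->
  (forall x, `|f x| <= `|g x|) -> rintegrable f.
Proof.
move=> mf intg fg; apply: le_integrable intg => //; first exact/measurable_EFinP.
by move=> x _ /=; rewrite lee_fin.
Qed.

Lemma rintegrable_norm f : rintegrable f -> rintegrable (fun x => `|f x|).
Proof.
move=> intf; apply: (le_rintegrable _ intf); last by move=> x; rewrite normr_id.
by apply: measurableT_comp => //; exact: rintegrable_measurable.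
Qed.

Lemma rintegrable_sum (I : Type) (s : seq I) (F : I -> T -> R) :
  (forall i, rintegrable (F i)) -> rintegrable (fun x => \sum_(i <- s) F i x).
Proof.
move=> Fi; elim: s => [|i s IH].
  rewrite (_ : (fun _ => _) = fun=> 0); first exact: integrable0.
  by apply/funext => x; rewrite big_nil.
rewrite (_ : (fun _ => _) = fun x => F i x + \sum_(j <- s) F j x).
  exact: rintegrableD.
by apply/funext => x; rewrite big_cons.
Qed.

Lemma Rintegral_sum (I : Type) (s : seq I) (F : I -> T -> R) :
  (forall i, rintegrable (F i)) ->
  \int[P]_x (\sum_(i <- s) F i x) = \sum_(i <- s) \int[P]_x F i x.
Proof.
move=> Fi; elim: s => [|i s IH].
  rewrite big_nil; transitivity (\int[P]_(x in setT) (0 : R)).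
    by apply: eq_Rintegral => x _; rewrite big_nil.
  by rewrite Rintegral_cst// mul0r.
rewrite big_cons -IH -RintegralD//; [|exact: Fi|exact: rintegrable_sum].
by congr Rintegral; apply/funext => x; rewrite big_cons.
Qed.

Lemma ler_norm_Rintegral f g : rintegrable f -> rintegrable g ->
  (forall x, `|f x| <= g x) -> `|\int[P]_x f x| <= \int[P]_x g x.
Proof.
move=> intf intg fg; apply: le_trans (le_normr_Rintegral _ _) _ => //.
by apply: le_Rintegral => //; exact: rintegrable_norm.
Qed.

Lemma EFin_Rintegral f : rintegrable f ->
  (\int[P]_x f x)%:E = (\int[P]_x (f x)%:E)%E.
Proof.
move=> intf; rewrite /Rintegral fineK//.
exact: (@integrable_fin_num _ _ _ _ _ measurableT _ intf).
Qed.

Lemma Rdominated_convergence (f_ : nat -> T -> R) f g :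
  (forall n, measurable_fun setT (f_ n)) -> measurable_fun setT f ->
  {ae P, forall x, f_ ^~ x @ \oo --> f x} ->
  rintegrable g -> (forall n x, `|f_ n x| <= g x) ->
  (fun n => \int[P]_x f_ n x) @ \oo --> \int[P]_x f x.
Proof.
move=> mf_ mf f_f intg f_g.
have intf_ n : rintegrable (f_ n).
  by apply: le_rintegrable intg _ => // x; rewrite (le_trans (f_g n x))// ler_norm.
have [] := @dominated_convergence _ _ _ P _ measurableT
  (fun n => EFin \o f_ n) (EFin \o f) (EFin \o g).
- by move=> n; exact/measurable_EFinP.
- exact/measurable_EFinP.
- apply: filterS f_f => x fx _; apply: cvg_EFin; [exact: nearW|exact: fx].
- exact: intg.
- by apply: aeW => x n _ /=; rewrite lee_fin.
move=> intf _; rewrite -/(rintegrable f) in intf.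
rewrite -(EFin_Rintegral intf) => /fine_cvg; exact.
Qed.

End real_integrals.

Section bounded_measurable.
Context d (T : measurableType d) {R : realType}.
Implicit Types f g : T -> R.

(** The bound holds everywhere, so that sums and products preserve it without null sets, and every
    finite measure integrates the function. *)
Definition bmf f := measurable_fun setT f /\ exists C, forall x, `|f x| <= C.

Lemma bmf_cst c : bmf (fun=> c).
Proof. by split; [exact: measurable_cst|exists `|c|]. Qed.

Lemma bmfD f g : bmf f -> bmf g -> bmf (fun x => f x + g x).
Proof.
move=> [mf [C fC]] [mg [D gD]]; split; first exact: measurable_funD.
by exists (C + D) => x; rewrite (le_trans (ler_normD _ _))// lerD.
Qed.

Lemma bmfM f g : bmf f -> bmf g -> bmf (fun x => f x * g x).
Proof.
move=> [mf [C fC]] [mg [D gD]]; split; first exact: measurable_funM.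
by exists (C * D) => x; rewrite normrM ler_pM.
Qed.

Lemma bmfB f g : bmf f -> bmf g -> bmf (fun x => f x - g x).
Proof.
move=> [mf [C fC]] [mg [D gD]]; split; first exact: measurable_funB.
by exists (C + D) => x; rewrite (le_trans (ler_normB _ _))// lerD.
Qed.

Lemma bmf_sum (I : Type) (s : seq I) (F : I -> T -> R) :
  (forall i, bmf (F i)) -> bmf (fun x => \sum_(i <- s) F i x).
Proof.
move=> FP; elim: s => [|i s IH].
  by under eq_fun do rewrite big_nil; exact: bmf_cst.
by under eq_fun do rewrite big_cons; exact: bmfD.
Qed.

Lemma bmf_indic (A : set T) : measurable A -> bmf (\1_A : T -> R).
Proof.
move=> mA; split; first exact: measurable_indic.
by exists 1 => x; rewrite indicE; case: (_ \in _); rewrite ?normr1 ?normr0.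
Qed.

Lemma bmf_rintegrable (P : {finite_measure set T -> \bar R}) f :
  bmf f -> rintegrable P f.
Proof.
move=> [mf [C fC]]; apply: measurable_bounded_integrable => //.
  by rewrite ltey_eq fin_num_measure.
exists C; split; first by rewrite num_real.
by move=> M CM x _; exact: le_trans (fC x) (ltW CM).
Qed.

Lemma bmf_rintegrableM (P : {measure set T -> \bar R}) f g :
  bmf f -> rintegrable P g -> rintegrable P (fun x => f x * g x).
Proof.
move=> [mf [C fC]] intg; apply: le_rintegrable (rintegrableZ C intg) _.
  by apply: measurable_funM => //; exact: rintegrable_measurable intg.
move=> x; rewrite !normrM ler_pM//.
exact: le_trans (fC x) (ler_norm _).
Qed.

End bounded_measurable.

Section fubini_real.
Context d1 d2 (T1 : measurableType d1) (T2 : measurableType d2) {R : realType}.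
Variables (P : {sigma_finite_measure set T1 -> \bar R}).
Variables (Q : {sigma_finite_measure set T2 -> \bar R}).

(** Domination by a product of integrable functions makes f integrable on the product space. The
    factor [a] may be unbounded: it will be a divergence, which is only in L^1. *)
Lemma RFubini (f : T1 * T2 -> R) (a : T1 -> R) (b : T2 -> R) :
  measurable_fun setT f -> rintegrable P a -> rintegrable Q b ->
  (forall x y, `|f (x, y)| <= a x * b y) ->
  \int[P]_x \int[Q]_y f (x, y) = \int[Q]_y \int[P]_x f (x, y).
Proof.
move=> mf inta intb fab.
have int1 x : rintegrable Q (fun y => f (x, y)).
  apply: le_rintegrable (rintegrableZ (a x) intb) _ => [|y].
    exact: measurableT_comp mf (measurable_pair1 x).
  by rewrite (le_trans (fab x y))// ler_norm.
have int2 y : rintegrable P (fun x => f (x, y)).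
  apply: le_rintegrable (rintegrableZ (b y) inta) _ => [|x].
    exact: measurableT_comp mf (measurable_pair2 y).
  by rewrite (le_trans (fab x y))// mulrC ler_norm.
have intf : (P \x Q)%E.-integrable setT (EFin \o f).
  apply/integrable12ltyP; first exact/measurable_EFinP.
  apply: (@le_lt_trans _ _ (\int[P]_x (`|a x| * \int[Q]_y `|b y|)%:E)%E).
    apply: ge0_le_integral => //.
    - by move=> x _; exact: integral_ge0.
    - apply: (measurable_fun_fubini_tonelli_F (fun z => `|(f z)%:E|%E)) => //.
      by apply: measurableT_comp => //; exact/measurable_EFinP.
    - apply/measurable_EFinP/measurable_funM => //.
      by apply: measurableT_comp => //; exact: rintegrable_measurable inta.
    - move=> x _; rewrite EFinM EFin_Rintegral; last exact: rintegrable_norm.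
      rewrite -ge0_integralZl//; last first.
        apply/measurable_EFinP; apply: measurableT_comp => //.
        exact: rintegrable_measurable intb.
      apply: ge0_le_integral => //.
      + by apply/measurable_EFinP/measurableT_comp => //;
          exact: rintegrable_measurable (int1 x).
      + apply: measurable_funeM; apply/measurable_EFinP; apply: measurableT_comp => //.
        exact: rintegrable_measurable intb.
      + move=> y _ /=; rewrite -EFinM lee_fin (le_trans (fab x y))//.
        by rewrite (le_trans (ler_norm _))// normrM.
  have := rintegrableZ (\int[Q]_y `|b y|) (rintegrable_norm inta).
  move=> /integrableP[_]; apply: le_lt_trans.
  rewrite le_eqVlt; apply/orP; left; apply/eqP; apply: eq_integral => x _ /=.
  by rewrite normrM normr_id mulrC [in RHS]ger0_norm ?Rintegral_ge0.
have := Fubini intf => /= F.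
rewrite /Rintegral; congr fine.
transitivity (\int[P]_x \int[Q]_y (f (x, y))%:E)%E.
  by apply: eq_integral => x _; rewrite -EFin_Rintegral.
rewrite F; apply: eq_integral => y _.
by rewrite -EFin_Rintegral.
Qed.

(** Tonelli applies to the positive and the negative part; [fine] then settles the points where an
    integral is infinite. *)
Lemma measurable_Rintegral2 (f : T1 * T2 -> R) :
  measurable_fun setT f -> measurable_fun setT (fun x => \int[Q]_y f (x, y)).
Proof.
move=> mf.
have mF (g : T1 * T2 -> \bar R) : measurable_fun setT g -> (forall z, 0 <= g z)%E ->
    measurable_fun setT (fun x => \int[Q]_y g (x, y))%E.
  by move=> mg g0; apply: (measurable_fun_fubini_tonelli_F g).
rewrite (_ : (fun _ => _) = fun x => fine (\int[Q]_y (EFin \o f)^\+ (x, y) -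
    \int[Q]_y (EFin \o f)^\- (x, y))%E).
  apply: measurableT_comp => //; apply: emeasurable_funB; apply: mF => //.
    by apply: measurable_funepos; exact/measurable_EFinP.
  by apply: measurable_funeneg; exact/measurable_EFinP.
by apply/funext => x; rewrite /Rintegral integralE; congr (fine (_ - _)); apply: eq_integral => y _; rewrite !unlock.
Qed.

End fubini_real.

(** * Lebesgue measure on column vectors: product functions, translations, bounded sets *)

Section lebesgue_cV_integrals.
Context {R : realType}.
Implicit Types (f : R -> R) (t : R).

(** Induction along the recursive construction of [lebesgue_cV]: change of variables and Tonelli
    split off the first coordinate. This computes the total mass of the mollifiers. *)
Lemma integral_cV_prod n (f : 'I_n -> R -> R) (c : 'I_n -> R) :
  (forall i, measurable_fun setT (f i)) -> (forall i t, 0 <= f i t) ->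
  (forall i, \int[lebesgue_measure]_t (f i t)%:E = (c i)%:E)%E ->
  (\int[lebesgue_cV n]_x (\prod_i f i (x i ord0))%:E = (\prod_i c i)%:E)%E.
Proof.
elim: n f c => [|n IHn] f c mf f0 fc.
  transitivity (\int[lebesgue_cV 0]_(x in setT) cst (1 : \bar R) x)%E.
    by apply: eq_integral => x _; rewrite big_ord0.
  by rewrite integral_cst//= diracT mule1 big_ord0.
have mprod k (g : 'I_k -> R -> R) : (forall i, measurable_fun setT (g i)) ->
    measurable_fun setT (fun x : 'cV[R]_k => \prod_i g i (x i ord0)).
  move=> mg; apply: measurable_prod => i _.
  by apply: measurableT_comp => //; exact: measurable_coord.
pose mu12 : {measure set (measurableTypeR R * 'cV[R]_n) -> \bar R} :=
  (lebesgue_measure \x lebesgue_cV n)%E.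
have := @ge0_integral_pushforward _ _ (measurableTypeR R * 'cV[R]_n)%type _ R
  (@cv_cons R n) (@measurable_cv_cons R n) mu12 setT
  (fun x => (\prod_i f i (x i ord0))%:E) measurableT.
rewrite preimage_setT => H.
apply: etrans (etrans _ (H _ _)) _.
- by apply: eq_measure_integral => [|mc A mA _]; first exact: measurable_cv_cons.
- by apply/measurable_EFinP; exact: mprod.
- by move=> x _; rewrite lee_fin prodr_ge0.
have consE t (v : 'cV[R]_n) : (\prod_i f i (cv_cons (t, v) i ord0) =
    f ord0 t * \prod_i f (lift ord0 i) (v i ord0))%R.
  rewrite big_ord_recl; congr (f _ _ * _).
    exact: (congr1 fst (cv_consK (t, v))).
  apply: eq_bigr => i _; congr (f _ _).
  have := congr1 snd (cv_consK (t, v)).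
  by move=> /matrixP/(_ i ord0); rewrite mxE => <-; congr (cv_cons _ _ _); exact: val_inj.
rewrite /mu12 fubini_tonelli1//=; last 2 first.
- apply/measurable_EFinP.
  apply: (measurableT_comp (f := fun x : 'cV[R]_n.+1 => \prod_i f i (x i ord0))).
    exact: mprod.
  exact: measurable_cv_cons.
- by move=> x; rewrite lee_fin prodr_ge0.
rewrite /fubini_F /=.
under eq_integral => t _.
  under eq_integral => v _ do rewrite consE EFinM.
  rewrite ge0_integralZl//; last 3 first.
  - by apply/measurable_EFinP; apply: (mprod _ (fun i => f (lift ord0 i))).
  - by move=> v _; rewrite lee_fin prodr_ge0.
  - by rewrite lee_fin.
  rewrite (IHn (fun i => f (lift ord0 i)) (fun i => c (lift ord0 i)))//.
  over.
rewrite /= ge0_integralZr//; last 3 first.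
- have /measurable_EFinP H1 := mf ord0; exact: H1.
- by move=> t _; rewrite lee_fin.
- rewrite lee_fin prodr_ge0// => i _; rewrite -lee_fin -fc.
  by apply: integral_ge0 => t _; rewrite lee_fin.
by rewrite fc -EFinM big_ord_recl.
Qed.

Lemma lebesgue_measure_shift a (A : set R) : measurable A ->
  pushforward lebesgue_measure (fun t : measurableTypeR R => t + a : measurableTypeR R) A =
  lebesgue_measure A.
Proof.
have mshift : measurable_fun setT
    (fun t : measurableTypeR R => t + a : measurableTypeR R).
  exact: measurable_funD.
pose sh : {mfun measurableTypeR R >-> measurableTypeR R} :=
  HB.pack (fun t : measurableTypeR R => t + a : measurableTypeR R)
    (isMeasurableFun.Build _ _ _ _ _ mshift).
move=> mA; rewrite -[LHS]/(pushforward lebesgue_measure sh A).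
apply/esym/lebesgue_measure_unique => //= _ [[b c]] _ <-.
rewrite /pushforward (_ : _ @^-1` _ = `](b - a), (c - a)]%classic).
  rewrite !lebesgue_measure_itv/= !lte_fin ltrD2r; case: ifP => // _.
  by rewrite -!EFinB opprB addrA subrK.
by apply/seteqP; split => t /=; rewrite !in_itv/= ltrBlDr lerBrDr.
Qed.

Lemma integral_shift a f : measurable_fun setT f -> (forall t, 0 <= f t) ->
  (\int[lebesgue_measure]_t (f (t + a))%:E = \int[lebesgue_measure]_t (f t)%:E)%E.
Proof.
move=> mf f0.
have mshift : measurable_fun setT
    (fun t : measurableTypeR R => t + a : measurableTypeR R).
  exact: measurable_funD.
have := @ge0_integral_pushforward _ _ _ _ R
  (fun t : measurableTypeR R => t + a : measurableTypeR R) mshift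
  (@lebesgue_measure R) setT (fun t => (f t)%:E) measurableT.
rewrite preimage_setT => <-.
- apply: eq_measure_integral => // A mA _; exact: lebesgue_measure_shift.
- exact/measurable_EFinP.
- by move=> t _; rewrite lee_fin.
Qed.

Lemma lebesgue_cV_bounded n (A : set 'cV[R]_n) : measurable A ->
  bounded_set A -> (lebesgue_cV n A < +oo)%E.
Proof.
move=> mA [M [_ AM]]; pose M1 := `|M| + 1.
(* The boxes are open on the left, and a coordinate may equal - M1; hence the lower corner - (M1 +
   1). *)
have AM1 : A `<=` [set x : 'cV[R]_n | forall i,
    (const_mx (- (M1 + 1)) : 'cV_n) i ord0 < x i ord0 <=
    (const_mx M1 : 'cV_n) i ord0].
  move=> x Ax i; rewrite !mxE.
  have : `|x i ord0| <= M1.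
    apply: le_trans (coord_le_norm x i ord0) (AM M1 _ x Ax).
    by rewrite /M1 (le_lt_trans (ler_norm _))// ltrDl.
  rewrite ler_norml => /andP[xM ->]; rewrite andbT (lt_le_trans _ xM)//.
  by rewrite ltrN2 ltrDl.
apply: le_lt_trans (le_measure _ _ _ AM1) _; rewrite ?inE//.
  rewrite (_ : mkset _ = \bigcap_(i in [set: 'I_n]) (fun x : 'cV[R]_n =>
      x i ord0) @^-1` `](const_mx (- (M1 + 1)) : 'cV[R]_n) i ord0, (const_mx M1 : 'cV[R]_n) i ord0]%classic).
    apply: fin_bigcap_measurable => // i _.
    by rewrite -[X in measurable X]setTI; apply: measurable_coord.
  apply/seteqP; split => [x /= xi i _|x /= xi i].
    by rewrite /= in_itv; exact: xi.
  by have := xi i I; rewrite /= in_itv.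
rewrite [X in (X < _)%E](@lebesgue_cV_box R n (const_mx (- (M1 + 1))) (const_mx M1)) ?ltry// => i; rewrite !mxE.
by rewrite (@le_trans _ _ 0)// ?oppr_le0 addr_ge0// addr_ge0.
Qed.

End lebesgue_cV_integrals.

(** * Mollification and weak convergence *)

Section mollifier.
Context {R : realType}.
Implicit Types (e t : R).

(** For |t| < e this is the usual bump exp(- 2e / (e^2 - t^2)), factored so that each factor is
    [flat_exp] of an affine function. *)
Definition bump1 e t := flat_exp 0 (t + e) * flat_exp 0 (- t + e).

Lemma bump1_ge0 e t : 0 <= bump1 e t.
Proof. by rewrite mulr_ge0 ?flat_exp_ge0. Qed.

Lemma bump1_le1 e t : bump1 e t <= 1.
Proof. by rewrite -[leRHS]mul1r ler_pM ?flat_exp_ge0 ?flat_exp0_le1. Qed.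

Lemma bump1N e t : bump1 e (- t) = bump1 e t.
Proof. by rewrite /bump1 opprK mulrC. Qed.

Lemma flat_exp0E t : t <= 0 -> flat_exp 0 t = 0.
Proof. by rewrite /flat_exp ltNge => ->. Qed.

Lemma bump1_neq0 e t : bump1 e t != 0 -> `|t| < e.
Proof.
rewrite mulf_eq0 negb_or !flat_exp0_neq0 => /andP[te te'].
by rewrite ltr_norml -subr_gt0 opprK te -subr_gt0 addrC te'.
Qed.

Lemma measurable_flat_exp k : measurable_fun setT (@flat_exp R k).
Proof.
apply: continuous_measurable_fun => t.
apply/differentiable_continuous/derivable1_diffP.
exact: derivable_flat_exp.
Qed.

Lemma measurable_bump1 e : measurable_fun setT (bump1 e).
Proof.
apply: measurable_funM; apply: measurableT_comp (measurable_flat_exp 0) _.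
  exact: measurable_funD.
by apply: measurable_funD => //; exact: measurable_oppr.
Qed.

Lemma flat_exp0_homo s t : s <= t -> flat_exp 0 s <= flat_exp 0 t.
Proof.
move=> st; have [s0|s0] := leP s 0; first by rewrite flat_exp0E ?flat_exp_ge0.
have t0 := lt_le_trans s0 st.
by rewrite /flat_exp s0 t0 !expr0 !mul1r ler_expR lerN2 lef_pV2 ?posrE.
Qed.

(** Finite, since the bump is at most 1 and vanishes off [-e, e]; positive, since both factors are
    at least [flat_exp 0 (e / 2)] on [0, e/2]. *)
Lemma integral_bump1 e : 0 < e ->
  exists2 c, 0 < c & (\int[lebesgue_measure]_t (bump1 e t)%:E = c%:E)%E.
Proof.
move=> e0; set I := (integral _ _ _).
have I0 : (0 <= I)%E by apply: integral_ge0 => t _; rewrite lee_fin bump1_ge0.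
have le1 t : (bump1 e t)%:E = ((bump1 e t)%:E * (\1_`[- e, e] t)%:E)%E :> \bar R.
  rewrite indicE; have [_|] := boolP (t \in _); first by rewrite mule1.
  rewrite mule0 => tn; congr EFin; apply/eqP; apply: contraNT tn => /bump1_neq0.
  by rewrite inE /= in_itv/= ltr_norml => /andP[/ltW -> /ltW ->].
have Ioo : (I < +oo)%E.
  apply: (@le_lt_trans _ _ (\int[lebesgue_measure]_t (\1_`[- e, e] t)%:E)%E).
    apply: ge0_le_integral => //.
    - by move=> t _; rewrite lee_fin bump1_ge0.
    - by apply/measurable_EFinP; exact: measurable_bump1.
    - by apply/measurable_EFinP; exact: measurable_indic.
    - by move=> t _; rewrite le1 -EFinM lee_fin ler_piMl ?bump1_le1.
  rewrite integral_indic//= setIT lebesgue_measure_itv/=.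
  by case: ifP => // _; rewrite -EFinB ltry.
have k0 : 0 < flat_exp 0 (e / 2) by rewrite flat_exp0_gt0 divr_gt0.
exists (fine I); last by rewrite fineK// ge0_fin_numE.
apply: fine_gt0; rewrite Ioo andbT.
apply: (@lt_le_trans _ _ (flat_exp 0 (e / 2) ^+ 2 * (e / 2))%:E).
  by rewrite lte_fin mulr_gt0// ?divr_gt0// exprn_gt0.
have -> : (flat_exp 0 (e / 2) ^+ 2 * (e / 2))%:E =
    ((flat_exp 0 (e / 2) ^+ 2)%:E * lebesgue_measure `[0%R, (e / 2)%R]%classic)%E.
  by rewrite lebesgue_measure_itv/= lte_fin divr_gt0// oppr0 addr0 -EFinM.
rewrite -integral_cst//= integral_mkcond.
apply: ge0_le_integral => //.
- by move=> t _; rewrite patchE; case: ifP => // _; rewrite lee_fin exprn_ge0// ltW.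
- by apply/(measurable_restrictT _ _).1 => //; exact: measurable_cst.
- by apply/measurable_EFinP; exact: measurable_bump1.
- move=> t _; rewrite patchE; case: ifPn => [|_]; last by rewrite lee_fin bump1_ge0.
  rewrite inE /= in_itv/= => /andP[t0 te]; rewrite lee_fin expr2 /bump1.
  rewrite ler_pM ?(ltW k0)// flat_exp0_homo//; lra.
Qed.

Context {m : nat}.
Local Notation V := 'cV[R]_m.

Definition bump_mass e : R :=
  fine (\int[lebesgue_measure]_t (bump1 e t)%:E)%E ^+ m.

(** A tensor product of bumps: its integral factors over the coordinates, and it vanishes off a ball
    of the maximum norm. *)
Definition mollifier e (z : V) : R :=
  (bump_mass e)^-1 * \prod_i bump1 e (z i ord0).

Lemma bump_mass_gt0 e : 0 < e -> 0 < bump_mass e.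
Proof. by move=> /integral_bump1[c c0 cE]; rewrite /bump_mass cE exprn_gt0. Qed.

Lemma mollifier_ge0 e z : 0 < e -> 0 <= mollifier e z.
Proof.
move=> e0; rewrite mulr_ge0 ?invr_ge0 ?(ltW (bump_mass_gt0 _))//.
by apply: prodr_ge0 => i _; exact: bump1_ge0.
Qed.

Lemma flat_alg_mollifier e : flat_alg (mollifier e).
Proof.
apply: flat_algM; first exact: flat_alg_cst.
apply: flat_alg_prod => i; apply: flat_algM.
  rewrite (_ : (fun _ => _) = fun x : V => flat_exp 0 (1 * x i ord0 + e)).
    exact: flat_alg_coord.
  by apply/funext => x; rewrite mul1r.
rewrite (_ : (fun _ => _) = fun x : V => flat_exp 0 (-1 * x i ord0 + e)).
  exact: flat_alg_coord.
by apply/funext => x; rewrite mulN1r.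
Qed.

Lemma integral_mollifier e (x : V) : 0 < e ->
  (\int[lebesgue_cV m]_y (mollifier e (x - y))%:E = 1)%E.
Proof.
move=> e0; have [c c0 cE] := integral_bump1 e0.
have mB t : measurable_fun setT (fun s : R => bump1 e (t - s)).
  apply: measurableT_comp (measurable_bump1 e) _.
  by apply: measurable_funB => //; exact: measurable_cst.
under eq_integral => y _ do rewrite EFinM.
have E : (\int[lebesgue_cV m]_y (\prod_i bump1 e ((x - y) i ord0))%:E =
    (bump_mass e)%:E)%E.
  under eq_integral => y _ do under eq_bigr => i _ do rewrite !mxE.
  rewrite (@integral_cV_prod _ _ (fun i t => bump1 e (x i ord0 - t)) (fun=> c)).
  - by rewrite prodr_const card_ord /bump_mass cE.
  - by move=> i; exact: mB.
  - by move=> i t; exact: bump1_ge0.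
  - move=> i; rewrite -cE.
    (* Evenness turns the reflection t |-> x - t into a translation. *)
    under eq_integral => t _ do rewrite -bump1N opprB.
    by rewrite (integral_shift (- x i ord0))//; [exact: measurable_bump1|exact: bump1_ge0].
rewrite ge0_integralZl//.
- by rewrite E -EFinM mulVf// gt_eqF// bump_mass_gt0.
- apply/measurable_EFinP; apply: measurable_prod => i _.
  apply: measurableT_comp (measurable_bump1 e) _.
  under eq_fun do rewrite !mxE.
  by apply: measurable_funB => //; exact: measurable_coord.
- by move=> y _; rewrite lee_fin; apply: prodr_ge0 => i _; exact: bump1_ge0.
- by rewrite lee_fin invr_ge0 ltW// bump_mass_gt0.
Qed.

Lemma mollifierN e z : mollifier e (- z) = mollifier e z.
Proof.
by congr (_ * _); apply: eq_bigr => i _; rewrite mxE bump1N.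
Qed.

Lemma mollifier_neq0 e z : 0 < e -> mollifier e z != 0 -> `|z| < e.
Proof.
move=> e0; rewrite mulf_eq0 negb_or => /andP[_ /prodf_neq0 zn].
apply: mx_norm_lt => // i j; rewrite (ord1 j).
by apply: bump1_neq0; exact: zn.
Qed.

End mollifier.

(** * Weak convergence of bounded sequences: from smooth to integrable test functions *)

Section weak_convergence.
Context {R : realType} {m : nat}.
Local Notation V := 'cV[R]_m.
Variables (P : {finite_measure set V -> \bar R}) (h_ : nat -> V -> R) (h : V -> R).
Variable C : R.
Hypotheses (mh_ : forall n, measurable_fun setT (h_ n)) (mh : measurable_fun setT h).
Hypotheses (h_C : forall n x, `|h_ n x| <= C) (hC : forall x, `|h x| <= C).

Definition tested (g : V -> R) :=
  (fun n => \int[P]_x (h_ n x * g x)) @ \oo --> \int[P]_x (h x * g x).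

(** Exchanging g for g_k changes every integral by at most C times their L^1 distance, uniformly in
    n; the admissible test functions are thus closed in L^1. *)
Lemma tested_approx (g_ : nat -> V -> R) g :
  (forall k, rintegrable P (g_ k)) -> rintegrable P g ->
  (fun k => \int[P]_x `|g_ k x - g x|) @ \oo --> (0 : R) ->
  (forall k, tested (g_ k)) -> tested g.
Proof.
move=> ig_ ig g_g tg_.
have C0 : 0 <= C by rewrite (le_trans _ (hC 0)).
have est f k : bmf f -> (forall x, `|f x| <= C) ->
    `|\int[P]_x (f x * g_ k x) - \int[P]_x (f x * g x)| <=
    C * \int[P]_x `|g_ k x - g x|.
  move=> bf fC; have igd := rintegrable_norm (rintegrableB (ig_ k) ig).
  rewrite -RintegralB//; [|exact: bmf_rintegrableM|exact: bmf_rintegrableM].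
  rewrite -RintegralZl//; apply: ler_norm_Rintegral.
  - by apply: rintegrableB; exact: bmf_rintegrableM.
  - exact: rintegrableZ.
  - by move=> x; rewrite -mulrBr normrM ler_wpM2r.
have bh_ n : bmf (h_ n) by split=> //; exists C.
have bh : bmf h by split=> //; exists C.
apply/cvgrPdist_lt => e e0.
(* C may be 0, hence the division by C + 1. *)
have e3 : 0 < e / 3 / (C + 1) by rewrite !divr_gt0// ltr_wpDl.
have [k kP] : exists k, \int[P]_x `|g_ k x - g x| < e / 3 / (C + 1).
  have /cvgrPdist_lt/(_ _ e3)[k _ kP] := g_g.
  by exists k; have := kP k (leqnn k); rewrite /= sub0r normrN; apply: le_lt_trans; exact: ler_norm.
have Ck : C * \int[P]_x `|g_ k x - g x| < e / 3.
  apply: (@le_lt_trans _ _ ((C + 1) * \int[P]_x `|g_ k x - g x|)).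
    by rewrite ler_wpM2r ?lerDl// Rintegral_ge0.
  by rewrite mulrC -ltr_pdivlMr// ltr_wpDl.
have /cvgrPdist_lt/(_ (e / 3)) := tg_ k.
rewrite divr_gt0// => /(_ isT); apply: filterS => n.
have := est _ k bh hC; have := est _ k (bh_ n) (h_C n).
move: Ck; set a := \int[P]_x (h x * g x); set b := \int[P]_x (h_ n x * g x).
set a' := \int[P]_x (h x * g_ k x); set b' := \int[P]_x (h_ n x * g_ k x).
set c := C * _.
rewrite !ler_norml !ltr_norml => c3 /andP[? ?] /andP[? ?] /andP[? ?].
by apply/andP; split; lra.
Qed.

Lemma testedD f g : rintegrable P f -> rintegrable P g -> tested f -> tested g ->
  tested (fun x => f x + g x).
Proof.
move=> intf intg tf tg; rewrite /tested.
have E k : bmf k -> \int[P]_x (k x * (f x + g x)) =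
    \int[P]_x (k x * f x) + \int[P]_x (k x * g x).
  move=> bk; rewrite -RintegralD//; [|exact: bmf_rintegrableM|exact: bmf_rintegrableM].
  by apply: eq_Rintegral => x _; rewrite mulrDr.
rewrite E; last by split=> //; exists C.
rewrite (_ : (fun _ => _) = fun n => \int[P]_x (h_ n x * f x) +
    \int[P]_x (h_ n x * g x)); first exact: (cvgD tf tg).
by apply/funext => n; rewrite E//; split=> //; exists C.
Qed.

Lemma testedZ c f : rintegrable P f -> tested f -> tested (fun x => c * f x).
Proof.
move=> intf tf; rewrite /tested.
have E k : bmf k -> \int[P]_x (k x * (c * f x)) = c * \int[P]_x (k x * f x).
  move=> bk; rewrite -RintegralZl//; last exact: bmf_rintegrableM.
  by apply: eq_Rintegral => x _; rewrite mulrCA.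
rewrite E; last by split=> //; exists C.
rewrite (_ : (fun _ => _) = fun n => c * \int[P]_x (h_ n x * f x)).
  by apply: cvgM => //; exact: cvg_cst.
by apply/funext => n; rewrite E//; split=> //; exists C.
Qed.

Lemma tested0 : tested (fun=> 0).
Proof.
rewrite /tested.
have E k : \int[P]_x (k x * 0) = 0 :> R.
  transitivity (\int[P]_(x in setT) (0 : R)); last by rewrite Rintegral_cst// mul0r.
  by apply: eq_Rintegral => x _; rewrite mulr0.
by rewrite E; under eq_fun do rewrite E; exact: cvg_cst.
Qed.

Variables (c : V) (r : R).
Hypothesis r0 : 0 < r.
Hypothesis h_test : forall phi, flat_alg phi ->
  (forall x, phi x != 0 -> `|x - c| < r) -> tested phi.

Let D := [set x : V | `|x - c| < r].

(** In each coordinate the first two factors cut out the ball [D] of the maximum norm, the third one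
    the half-line below b_i. *)
Let box_bump (b x : V) : R :=
  \prod_i (flat_exp 0 (1 * x i ord0 + (r - c i ord0)) *
    (flat_exp 0 (-1 * x i ord0 + (c i ord0 + r)) *
     flat_exp 0 (-1 * x i ord0 + b i ord0))).

Let orthant (b : V) := [set x : V | forall i, x i ord0 < b i ord0].

Let box_bumpP b x : (0 < box_bump b x) = (x \in D `&` orthant b).
Proof.
rewrite lt0r prodr_ge0 ?andbT; last by move=> i _; rewrite !mulr_ge0 ?flat_exp_ge0.
have E i : (flat_exp 0 (1 * x i ord0 + (r - c i ord0)) *
    (flat_exp 0 (-1 * x i ord0 + (c i ord0 + r)) *
     flat_exp 0 (-1 * x i ord0 + b i ord0)) != 0) =
    (`|x i ord0 - c i ord0| < r) && (x i ord0 < b i ord0).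
  rewrite !mulf_eq0 !negb_or !flat_exp0_neq0 mul1r !mulN1r ltr_norml andbA.
  by congr (_ && _ && _); apply/idP/idP; lra.
apply/idP/idP => [/prodf_neq0 H|/set_mem[Dx ox]].
  apply/mem_set; split.
    apply: mx_norm_lt => // i j; rewrite (ord1 j) !mxE.
    by have := H i isT; rewrite E => /andP[].
  by move=> i; have := H i isT; rewrite E => /andP[].
apply/prodf_neq0 => i _; rewrite E ox andbT.
by have := le_lt_trans (coord_le_norm (x - c) i ord0) Dx; rewrite !mxE.
Qed.

Let box_bump_le1 b x : box_bump b x <= 1.
Proof.
have F_01 i : 0 <= flat_exp 0 (1 * x i ord0 + (r - c i ord0)) *
    (flat_exp 0 (-1 * x i ord0 + (c i ord0 + r)) *
     flat_exp 0 (-1 * x i ord0 + b i ord0)) <= 1.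
  rewrite !mulr_ge0 ?flat_exp_ge0//= -[leRHS]mul1r.
  rewrite ler_pM ?mulr_ge0 ?flat_exp_ge0 ?flat_exp0_le1//.
  by rewrite -[leRHS]mul1r ler_pM ?flat_exp_ge0 ?flat_exp0_le1.
suff /andP[] : 0 <= box_bump b x <= 1 by [].
rewrite /box_bump; elim/big_ind: _ => [|y z /andP[y0 y1] /andP[z0 z1]|i _].
- by rewrite ler01 lexx.
- by rewrite mulr_ge0//= -[leRHS]mul1r ler_pM.
- exact: F_01.
Qed.

Let flat_alg_box_bump b : flat_alg (box_bump b).
Proof.
apply: flat_alg_prod => i.
by apply: flat_algM; [|apply: flat_algM]; exact: flat_alg_coord.
Qed.

Let mD : measurable D.
Proof.
apply: open_measurable_mx; rewrite (_ : D = ball c r); first exact: ball_open.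
by apply/seteqP; split => x; rewrite -ball_normE /ball_ /D /= distrC.
Qed.

Let morthant b : measurable (orthant b).
Proof.
rewrite (_ : orthant b = \bigcap_(i in [set: 'I_m])
    (fun x : V => x i ord0) @^-1` `]-oo, b i ord0[%classic).
  apply: fin_bigcap_measurable => // i _.
  by rewrite -[X in measurable X]setTI; exact: measurable_coord.
apply/seteqP; split => [x xb i _|x xb i]; first by rewrite /= in_itv; exact: xb.
by have := xb i I; rewrite /= in_itv.
Qed.

(* 1 - (1 - bump)^k increases to the indicator function of the support. *)
Let tested_orthant b : tested (\1_(D `&` orthant b)).
Proof.
pose g_ k x : R := 1 - (1 - box_bump b x) ^+ k.
have g_01 k x : 0 <= g_ k x <= 1.
  have b0 : 0 <= 1 - box_bump b x by rewrite subr_ge0 box_bump_le1.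
  have b1 : 1 - box_bump b x <= 1.
    rewrite lerBlDr lerDl; apply: prodr_ge0 => i _.
    by rewrite !mulr_ge0 ?flat_exp_ge0.
  by rewrite /g_ subr_ge0 exprn_ile1//= lerBlDr lerDl exprn_ge0.
have fg_ k : flat_alg (g_ k).
  apply: flat_algB; first exact: flat_alg_cst.
  by apply/flat_algX/flat_algB => //; exact: flat_alg_cst.
have mg_ k : measurable_fun setT (g_ k) by exact: measurable_flat_alg.
have mDb : measurable (D `&` orthant b) by exact: measurableI.
have i1 : rintegrable P (\1_(D `&` orthant b)).
  by apply: bmf_rintegrable; exact: bmf_indic.
have ig_ k : rintegrable P (g_ k).
  apply: bmf_rintegrable; split => //; exists 1 => x.
  by have /andP[? ?] := g_01 k x; rewrite ger0_norm.
apply: (@tested_approx g_) => //; last first.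
  move=> k; apply: h_test => // x gx.
  have : 0 < box_bump b x.
    rewrite lt0r prodr_ge0 ?andbT; last by move=> i _; rewrite !mulr_ge0 ?flat_exp_ge0.
    by apply: contraNneq gx => b0; rewrite /g_ b0 subr0 expr1n subrr.
  by rewrite box_bumpP => /set_mem[].
have -> : (0 : R) = \int[P]_(x in setT) (0 : R) by rewrite Rintegral_cst// mul0r.
apply: (@Rdominated_convergence _ _ _ _ _ _ (fun=> 1)).
- move=> k; apply: measurableT_comp => //; apply: measurable_funB => //.
- exact: measurable_cst.
- apply: aeW => x; rewrite indicE.
  have [|bn] := boolP (x \in D `&` orthant b).
    rewrite -box_bumpP => b0.
    rewrite (_ : (fun _ => _) = fun k => `|(1 - box_bump b x) ^+ k|); last first.
      by apply/funext => k; rewrite /g_ addrAC subrr add0r normrN.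
    rewrite -(@normr0 _ R); apply: cvg_norm; apply: cvg_expr.
    by rewrite ger0_norm ?subr_ge0 ?box_bump_le1// ltrBlDr ltrDl.
  apply: cvg_near_cst; apply: nearW => k; rewrite subr0 /g_.
  have -> : box_bump b x = 0; last by rewrite subr0 expr1n subrr normr0.
  apply/eqP; rewrite eq_le; apply/andP; split.
    by rewrite leNgt box_bumpP.
  by apply: prodr_ge0 => i _; rewrite !mulr_ge0 ?flat_exp_ge0.
- by apply: bmf_rintegrable; exact: bmf_cst.
- move=> k x; rewrite normr_id indicE; have /andP[? ?] := g_01 k x.
  by rewrite ler_norml; case: (x \in _) => /=; apply/andP; split; lra.
Qed.

(** A map into matrices is Borel once its entries are, and the half-space x_i < a is the union over
    k of the orthants with bound a in coordinate i and k in the others. *)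
Let borel_orthants (E : set V) : measurable E -> <<s range orthant >> E.
Proof.
pose T := g_sigma_algebraType (range orthant).
have mid : measurable_fun setT (fun x : T => x : V).
  apply: measurable_mx => i j; rewrite (ord1 j).
  apply: (measurability _ (@RGenInftyO.measurableE R)) => //.
  move=> _ [_ [a ->] <-]; rewrite setTI.
  pose b k : V := \col_l (if l == i then a else k%:R).
  rewrite (_ : _ @^-1` _ = \bigcup_k orthant (b k)).
    by apply: bigcup_measurable => k _; apply: sub_sigma_algebra; exists (b k).
  apply/seteqP; split => x /=; rewrite in_itv/=.
    move=> xa; exists (Num.truncn `|x|).+1 => // l; rewrite mxE; case: eqP => [->//|_].
    apply: le_lt_trans (ler_norm _) _; apply: le_lt_trans (coord_le_norm _ _ _) _.
    exact: truncnS_gt.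
  by move=> [k _ /(_ i)]; rewrite mxE eqxx.
by move=> mE; have := mid measurableT _ mE; rewrite setTI.
Qed.

(** A Dynkin argument: orthants are stable under intersection and generate the Borel sets, while
    linearity and dominated convergence give stability under proper differences and increasing
    unions. *)
Lemma tested_indic (E : set V) : measurable E -> tested (\1_(D `&` E)).
Proof.
move=> mE.
have bI (A : set V) : measurable A -> rintegrable P (\1_(D `&` A)).
  by move=> mA; apply: bmf_rintegrable; apply: bmf_indic; exact: measurableI.
have cvgI (F : nat -> set V) : (forall n, measurable (F n)) ->
    (forall n, tested (\1_(D `&` F n))) -> nondecreasing_seq F ->
    tested (\1_(D `&` \bigcup_n F n)).
  move=> mF tF ndF; have mUF : measurable (\bigcup_n F n) by exact: bigcupT_measurable.
  apply: (@tested_approx (fun n => \1_(D `&` F n))) => //; [|exact: bI|].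
    by move=> n; exact: bI.
  have -> : (0 : R) = \int[P]_(x in setT) (0 : R) by rewrite Rintegral_cst// mul0r.
  apply: (@Rdominated_convergence _ _ _ _ _ _ (fun=> 1)).
  - move=> k; apply: measurableT_comp => //; apply: measurable_funB;
      exact: rintegrable_measurable (bI _ _).
  - exact: measurable_cst.
  - apply: aeW => x; apply: cvg_near_cst.
    have [|xn] := boolP (x \in D `&` \bigcup_n F n).
      rewrite inE => -[Dx [n _ Fnx]]; near=> k.
      rewrite !indicE !mem_set ?subrr ?normr0//; split => //.
        by exists n.
      have : F n `<=` F k by apply/subsetPset/ndF; near: k; exists n.
      exact.
    apply: nearW => k; rewrite !indicE (memNset (A := D `&` \bigcup_n F n)); last first.
      by move=> /mem_set; exact/negP.
    rewrite memNset ?subrr ?normr0// => -[Dx Fx].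
    by move/negP : xn; apply; rewrite inE; split => //; exists k.
  - by apply: bmf_rintegrable; exact: bmf_cst.
  - move=> k x; rewrite normr_id !indicE.
    by case: (x \in _); case: (x \in _); rewrite ?subrr ?subr0 ?sub0r ?normrN ?normr1 ?normr0.
pose H := [set A : set V | measurable A /\ tested (\1_(D `&` A))].
suff : H E by case.
have HT : H setT.
  split => //.
  have -> : setT = \bigcup_k orthant (const_mx k%:R).
    apply/seteqP; split => // x _.
    exists (Num.truncn `|x|).+1 => // i; rewrite mxE.
    apply: le_lt_trans (ler_norm _) _; apply: le_lt_trans (coord_le_norm _ _ _) _.
    exact: truncnS_gt.
  apply: cvgI => [n|n|]; [exact: morthant|exact: tested_orthant|].
  move=> n k nk; apply/subsetPset => x xn i; rewrite mxE.
  by apply: lt_le_trans (xn i) _; rewrite mxE ler_nat.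
apply: (@lambda_system_subset _ (range orthant) _ setT H) => //.
- move=> _ _ [a _ <-] [b _ <-].
  exists (\col_i Num.min (a i ord0) (b i ord0)) => //.
  apply/seteqP; split => x xab.
    by split => i; have := xab i; rewrite mxE lt_min => /andP[].
  by move=> i; rewrite mxE lt_min xab.1 xab.2.
- split => //.
  + move=> A B BA [mA tA] [mB tB]; split; first exact: measurableD.
    rewrite (_ : \1_(D `&` (A `\` B)) =
        fun x => \1_(D `&` A) x + -1 * \1_(D `&` B) x).
      apply: testedD; [exact: bI|apply: rintegrableZ; exact: bI|by []|].
      by apply: testedZ => //; exact: bI.
    apply/funext => x; rewrite !indicE.
    have [Dx|Dx] := pselect (D x); last first.
      by rewrite !(memNset (_ : ~ _)) ?mulr0 ?addr0// => -[].
    have [Ax|Ax] := pselect (A x); last first.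
      have Bx : ~ B x by move=> /BA.
      by rewrite !memNset ?mulr0 ?addr0//; [case|case|case => _ []].
    have [Bx|Bx] := pselect (B x).
      rewrite memNset; last by case => _ [].
      by rewrite !mem_set// mulr1 subrr.
    by rewrite mem_set// mem_set// memNset ?mulr0 ?addr0// => -[].
  + move=> F ndF HF; split; first by apply: bigcupT_measurable => n; case: (HF n).
    by apply: cvgI => // n; case: (HF n).
- by move=> _ [b _ <-]; split; [exact: morthant|exact: tested_orthant].
- exact: borel_orthants.
Unshelve. all: by end_near. Qed.

Import HBSimple.

(** Simple functions are dense in L^1. This is the form in which the section is used: convergence
    against [flat_alg] functions living in a ball implies it against all integrable functions living
    there. *)
Lemma tested_integrable (g : V -> R) : rintegrable P g ->
  (forall x, g x != 0 -> `|x - c| < r) -> tested g.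
Proof.
move=> ig gD.
have [g_ [ig_ _ g_g]] := @approximation_sfun_integrable _ _ _ P _ measurableT _ ig.
(* Cutting the approximations off outside [D] only improves them, as g vanishes there. *)
pose k_ k x := g_ k x * \1_D x.
have ik_ k : rintegrable P (k_ k).
  rewrite /k_; under eq_fun do rewrite mulrC.
  apply: bmf_rintegrableM; [exact: bmf_indic|exact: ig_].
have k_g k x : `|k_ k x - g x| <= `|g x - g_ k x|.
  rewrite /k_ indicE distrC; have [_|] := boolP (x \in D); first by rewrite mulr1.
  rewrite mulr0 subr0 => xD; have [->|/gD] := eqVneq (g x) 0.
    by rewrite normr0.
  by move=> Dx; move/negP : xD; rewrite inE.
apply: (@tested_approx k_) => //.
- apply/cvgrPdist_le => e e0.
  have : (fun n => fine (\int[P]_z `|(EFin \o g) z - (g_ n z)%:E|)%E) @ \oo --> (0 : R).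
    exact: fine_cvg g_g.
  move=> /cvgrPdist_le/(_ _ e0); apply: filterS => n; rewrite !sub0r !normrN.
  apply: le_trans; rewrite !ger0_norm ?Rintegral_ge0//.
  apply: le_Rintegral => //.
  - by apply: rintegrable_norm; apply: rintegrableB.
  - by apply: rintegrable_norm; apply: rintegrableB => //; exact: ig_.
- move=> k.
  rewrite (_ : k_ k = fun x => \sum_(y <- finmap.enum_fset (fset_set (range (g_ k))))
      y * \1_(D `&` g_ k @^-1` [set y]) x); last first.
    apply/funext => x; rewrite /k_ fimfunE fsbig_finite//= big_distrl/=.
    by apply: eq_bigr => y _; rewrite !indicE in_setI -mulrA -natrM mulnb andbC.
  elim: (finmap.enum_fset _) => [|y s IH].
    by under eq_fun do rewrite big_nil; exact: tested0.
  under eq_fun do rewrite big_cons.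
  have mgy y0 : measurable (g_ k @^-1` [set y0]) by [].
  have bI y0 : rintegrable P (\1_(D `&` g_ k @^-1` [set y0])).
    by apply: bmf_rintegrable; apply: bmf_indic; exact: measurableI.
  apply: testedD => //.
  - exact: rintegrableZ.
  - by apply: rintegrable_sum => y0; exact: rintegrableZ.
  - by apply: testedZ => //; exact: tested_indic.
Qed.

End weak_convergence.

(** * Restriction of a measure to a set of finite measure *)

Section restricted_measure.
Context d (T : measurableType d) {R : realType}.
Variables (mu : {measure set T -> \bar R}) (D : set T) (mD : measurable D).
Hypothesis moo : (mu D < +oo)%E.
Local Notation P := (mfrestr mD moo).

Lemma integral_mfrestr (f : T -> \bar R) : measurable_fun setT f ->
  (\int[P]_x f x = \int[mu]_(x in D) f x)%E.
Proof.
move=> mf; transitivity (\int[P]_x (f \_ D) x)%E.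
  apply: ae_eq_integral => //.
    by apply/(measurable_restrictT _ mD); exact: measurable_funTS.
  exists (~` D); split; first exact: measurableC.
    by rewrite /= /mfrestr /mrestr setICl measure0.
  move=> x; apply: contra_not => Dx _; rewrite patchE.
  by rewrite mem_set//; exact: contrapT.
rewrite -integral_mkcond; apply: eq_measure_integral => A mA AD.
by rewrite /= /mfrestr /mrestr setIidl.
Qed.

Lemma Rintegral_mfrestr (f : T -> R) : measurable_fun setT f ->
  \int[P]_x f x = \int[mu]_(x in D) f x.
Proof.
by move=> mf; rewrite /Rintegral integral_mfrestr//; exact/measurable_EFinP.
Qed.

Lemma ae_mfrestr (Q : T -> Prop) :
  {ae P, forall x, Q x} -> {ae mu, forall x, D x -> Q x}.
Proof.
move=> [N [mN N0 QN]]; exists (N `&` D); split => //; first exact: measurableI.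
move=> x /= /not_implyP[Dx nQ]; split => //; exact: QN.
Qed.

Lemma mfrestr_ae (Q : T -> Prop) :
  {ae mu, forall x, D x -> Q x} -> {ae P, forall x, Q x}.
Proof.
move=> [N [mN N0 QN]]; exists (N `|` ~` D); split.
- by apply: measurableU => //; exact: measurableC.
- rewrite /= /mfrestr /mrestr setIUl setICl setU0.
  by apply: subset_measure0 N0 => //; exact: measurableI.
- move=> x /= nQ; have [Dx|nDx] := pselect (D x); [left|by right].
  by apply: QN => /= /(_ Dx).
Qed.

End restricted_measure.

(** * Translates, reflections and directional derivatives of test functions *)

Section translations.
Context {R : realType} {m : nat}.
Local Notation V := 'cV[R]_m.
Implicit Types (f : V -> R) (x y : V).

(** The generators take affine arguments precisely so that translations, and below reflections, are
    absorbed by their constants. *)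
Lemma flat_alg_shift f y : flat_alg f -> flat_alg (fun x => f (x - y)).
Proof.
elim=> {f} [c|k i c d|f g _ fP _ gP|f g _ fP _ gP].
- exact: flat_alg_cst.
- rewrite (_ : (fun _ => _) = fun x : V =>
      flat_exp k (c * x i ord0 + (d - c * y i ord0))); first exact: flat_alg_coord.
  by apply/funext => x; congr flat_exp; rewrite !mxE; ring.
- exact: flat_algD.
- exact: flat_algM.
Qed.

Lemma flat_alg_reflect f x : flat_alg f -> flat_alg (fun y => f (x - y)).
Proof.
elim=> {f} [c|k i c d|f g _ fP _ gP|f g _ fP _ gP].
- exact: flat_alg_cst.
- rewrite (_ : (fun _ => _) = fun y : V =>
      flat_exp k (- c * y i ord0 + (d + c * x i ord0))); first exact: flat_alg_coord.
  by apply/funext => y; congr flat_exp; rewrite !mxE; ring.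
- exact: flat_algD.
- exact: flat_algM.
Qed.

Lemma measurable_flat_alg_sub f : flat_alg f ->
  measurable_fun setT (fun z : V * V => f (z.1 - z.2)).
Proof.
elim=> {f} [c|k i c d|f g _ fP _ gP|f g _ fP _ gP].
- exact: measurable_cst.
- apply: (measurableT_comp (measurable_flat_exp k)).
  under eq_fun do rewrite !mxE.
  apply: measurable_funD => //; apply: measurable_funM => //.
  apply: measurable_funB; apply: (measurableT_comp (measurable_coord i ord0)).
    exact: measurable_fst.
  exact: measurable_snd.
- exact: measurable_funD.
- exact: measurable_funM.
Qed.

Lemma is_derive_line f a h t : differentiable f (a + t *: h) ->
  is_derive t 1 (fun s : R => f (a + s *: h)) ('D_h f (a + t *: h)).
Proof.
move=> /(@diff_derivable _ _ _ _ _ h) df.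
have E : (fun s : R => s^-1 *: (((fun s : R => f (a + s *: h)) \o shift t) (s *: 1) -
    f (a + t *: h))) = (fun s : R => s^-1 *: ((f \o shift (a + t *: h)) (s *: h) -
    f (a + t *: h))).
  apply/funext => s /=; congr (_ *: (f _ - _)).
  by rewrite [s *: 1]mulr1 scalerDl addrCA.
apply: DeriveDef; first by rewrite /derivable E.
by rewrite /derive E.
Qed.

Lemma derive_partial f x h : differentiable f x ->
  'D_h f x = \sum_i h i ord0 * partial i f x.
Proof.
move=> df; rewrite deriveE//.
have {1}-> : h = \sum_i h i ord0 *: delta_mx i ord0.
  rewrite {1}[h]matrix_sum_delta; apply: eq_bigr => i _.
  by rewrite big_ord1.
rewrite linear_sum; apply: eq_bigr => i _.
by rewrite linearZ /partial deriveE.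
Qed.

Lemma partial_shift f i x y :
  partial i (fun x => f (x - y)) x = partial i f (x - y).
Proof.
have E : (fun h : R => h^-1 *: (((fun x => f (x - y)) \o shift x) (h *: delta_mx i ord0)
      - f (x - y))) =
    (fun h : R => h^-1 *: ((f \o shift (x - y)) (h *: delta_mx i ord0) - f (x - y))).
  by apply/funext => h /=; rewrite addrA.
by rewrite /partial /derive E.
Qed.

Lemma partial_reflect f i x y : differentiable f (x - y) ->
  partial i (fun y => f (x - y)) y = - partial i f (x - y).
Proof.
move=> df; transitivity ('D_(- delta_mx i ord0) f (x - y)).
  have E : (fun h : R => h^-1 *: (((fun y => f (x - y)) \o shift y) (h *: delta_mx i ord0)
        - f (x - y))) =
      (fun h : R => h^-1 *: ((f \o shift (x - y)) (h *: - delta_mx i ord0) - f (x - y))).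
    by apply/funext => h /=; rewrite opprD addrCA scalerN.
  by rewrite /partial /derive E.
by rewrite !deriveE// linearN -!deriveE.
Qed.

End translations.

Section test_functions.
Context {R : realType} {m : nat}.
Local Notation V := 'cV[R]_m.

Lemma mx_norm_trmx p q (A : 'M[R]_(p, q)) : `|A^T| = `|A|.
Proof.
apply/eqP; rewrite eq_le; apply/andP; split; apply: mx_norm_le => // i j.
  by rewrite mxE coord_le_norm.
by have := coord_le_norm A^T j i; rewrite mxE.
Qed.

(** Compactness of closed bounded sets of row vectors, carried over by transposition, an isometry of
    the maximum norm. *)
Lemma closed_ball_cV_compact (c : V) (r : R) :
  compact [set x : V | `|x - c| <= r].
Proof.
have clB p q (a : 'M[R]_(p, q)) : closed [set x : 'M[R]_(p, q) | `|x - a| <= r].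
  apply: (@preimage_closed _ _ (fun x : 'M[R]_(p, q) => `|x - a|) [set y | y <= r]).
    move=> x _; apply: continuous_comp; last exact: norm_continuous.
    by apply: continuousB; [exact: cvg_id|exact: cst_continuous].
  exact: closed_le.
have -> : [set x : V | `|x - c| <= r] =
    trmx @` [set v : 'rV[R]_m | `|v - c^T| <= r].
  apply/seteqP; split => [x xr|_ [v vr <-]] /=.
    by exists x^T; rewrite ?trmxK//= -linearB /= mx_norm_trmx.
  by rewrite -[c]trmxK -linearB/= mx_norm_trmx.
apply: continuous_compact.
  apply: continuous_subspaceT => v.
  suff : (trmx x : V) @[x --> v] --> (v^T : V) by [].
  apply/(@cvgrPdist_le _ _ _ (nbhs v)) => e e0.
  apply: filterS (nbhsx_ballx v e e0) => w; rewrite -ball_normE /ball_ /=.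
  by rewrite -linearB/= mx_norm_trmx => /ltW.
apply: bounded_closed_compact; last exact: clB.
exists (r + `|c^T|); split; first by rewrite num_real.
move=> M rM v /= vr; rewrite (le_trans _ (ltW rM))//.
by rewrite -[v](subrK c^T) (le_trans (ler_normD _ _))// lerD2r.
Qed.

Lemma flat_alg_test_function (Omega : set V) phi c r : flat_alg phi ->
  (forall x, phi x != 0 -> `|x - c| <= r) ->
  (forall x, `|x - c| <= r -> Omega x) -> test_function Omega phi.
Proof.
move=> fphi phir rO; pose K := [set x : V | `|x - c| <= r].
have cK : compact K := @closed_ball_cV_compact c r.
have clK : closure [set x | phi x != 0] `<=` K.
  rewrite [X in _ `<=` X](closure_id K).1; last first.
    by apply: compact_closed => //; exact: norm_hausdorff.
  by apply: closure_subset => x; exact: phir.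
split; first exact: flat_alg_smooth.
  by apply: subclosed_compact clK => //; exact: closed_closure.
by move=> x /clK; exact: rO.
Qed.

End test_functions.

(** * Mollification on a ball whose double lies in the domain *)

Section mollification.
Context {R : realType} {m : nat}.
Local Notation V := 'cV[R]_m.
Variables (Omega : set V) (mO : measurable Omega).
Variable P : {finite_measure set V -> \bar R}.
Hypothesis PE : forall f : V -> \bar R, measurable_fun setT f ->
  (\int[P]_x f x = \int[lebesgue_cV m]_(x in Omega) f x)%E.
Implicit Types (f u phi : V -> R) (x y : V) (e : R).

(** P sees Omega only, so this is the convolution of f extended by 0. Near the boundary the
    extension creates spurious derivatives, which is why derivatives are computed in the ball of
    radius r only. *)
Definition mollify e f x : R := \int[P]_y (mollifier e (x - y) * f y).

Lemma flat_alg_bmf f : flat_alg f -> bmf f.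
Proof.
by move=> ff; split; [exact: measurable_flat_alg|exact: flat_alg_bounded].
Qed.

Lemma bmf_mollifier_reflect e x : bmf (fun y => mollifier e (x - y)).
Proof. exact: flat_alg_bmf (flat_alg_reflect x (flat_alg_mollifier e)). Qed.

Lemma measurable_mollify e f : measurable_fun setT f ->
  measurable_fun setT (mollify e f).
Proof.
move=> mf; apply: (measurable_Rintegral2 P
  (f := fun z : V * V => mollifier e (z.1 - z.2) * f z.2)).
apply: measurable_funM.
  apply: (measurable_flat_alg_sub (f := mollifier e)). exact: flat_alg_mollifier.
exact: (measurableT_comp mf measurable_snd).
Qed.

Lemma rintegrable_mollifier e f x : bmf f ->
  rintegrable P (fun y => mollifier e (x - y) * f y).
Proof.
move=> bf; apply: bmf_rintegrable; apply: bmfM => //.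
exact: bmf_mollifier_reflect.
Qed.

(** The kernel has mass 1 on the whole space, hence at most 1 on Omega. *)
Lemma mollify_bounded e f C x : 0 < e -> bmf f -> (forall y, `|f y| <= C) ->
  `|mollify e f x| <= C.
Proof.
move=> e0 bf fC; have C0 : 0 <= C by rewrite (le_trans _ (fC 0)).
apply: (@le_trans _ _ (\int[P]_y (mollifier e (x - y) * C))).
  apply: ler_norm_Rintegral; first exact: rintegrable_mollifier.
    exact/rintegrable_mollifier/bmf_cst.
  by move=> y; rewrite normrM ger0_norm ?mollifier_ge0// ler_wpM2l ?mollifier_ge0.
have im : rintegrable P (fun y => mollifier e (x - y)).
  exact: bmf_rintegrable (bmf_mollifier_reflect e x).
rewrite RintegralZr// -[leRHS]mul1r ler_wpM2r//.
rewrite -lee_fin EFin_Rintegral// -(integral_mollifier x e0).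
have mm : measurable_fun setT (fun y => (mollifier e (x - y))%:E).
  by apply/measurable_EFinP; case: (bmf_mollifier_reflect e x).
rewrite PE//.
by apply: ge0_subset_integral => // y _; rewrite lee_fin mollifier_ge0.
Qed.

Lemma bmf_mollify e f : 0 < e -> bmf f -> bmf (mollify e f).
Proof.
move=> e0 bf; have [mf [C fC]] := bf; split; first exact: measurable_mollify.
by exists C => x; exact: mollify_bounded.
Qed.

Lemma bmf_mollify_integrable e f : rintegrable P f -> bmf (mollify e f).
Proof.
move=> intf; split; first exact: measurable_mollify (rintegrable_measurable intf).
have [D DP] := flat_alg_bounded (@flat_alg_mollifier R m e).
exists (D * \int[P]_y `|f y|) => x; rewrite -RintegralZl//; last exact: rintegrable_norm.
apply: ler_norm_Rintegral.
- apply: bmf_rintegrableM => //.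
  exact: bmf_mollifier_reflect.
- exact/rintegrableZ/rintegrable_norm.
- by move=> y; rewrite normrM ler_wpM2r.
Qed.

(** Self-adjointness of mollification: the kernel is even, and Fubini applies. The function g, only
    integrable, will contain the divergence. *)
Lemma mollifyC e f g : 0 < e -> bmf f -> rintegrable P g ->
  \int[P]_x (g x * mollify e f x) = \int[P]_x (f x * mollify e g x).
Proof.
move=> e0 bf ig; have [mf [C fC]] := bf; have mg := rintegrable_measurable ig.
have [D DP] := flat_alg_bounded (@flat_alg_mollifier R m e).
pose F (z : V * V) := g z.1 * f z.2 * mollifier e (z.1 - z.2).
have mF : measurable_fun setT F.
  apply: measurable_funM; last exact: measurable_flat_alg_sub (flat_alg_mollifier e).
  apply: measurable_funM; first exact: (measurableT_comp mg measurable_fst).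
  exact: (measurableT_comp mf measurable_snd).
transitivity (\int[P]_x \int[P]_y F (x, y)).
  apply: eq_Rintegral => x _; rewrite /mollify -RintegralZl//; last first.
    exact: rintegrable_mollifier.
  by apply: eq_Rintegral => y _; rewrite /F /=; ring.
rewrite (@RFubini _ _ _ _ _ P P F (fun x => `|g x|) (fun=> C * D) mF
  (rintegrable_norm ig)).
- apply: eq_Rintegral => y _; rewrite /mollify -RintegralZl//; last first.
    apply: bmf_rintegrableM => //.
    exact: bmf_mollifier_reflect.
  by apply: eq_Rintegral => x _; rewrite /F /= -mollifierN opprB; ring.
- by apply: bmf_rintegrable; exact: bmf_cst.
- move=> x y; rewrite /F /= normrM (normrM (g x)) -mulrA.
  by apply: ler_pM => //; exact: ler_pM.
Qed.

Variables (c : V) (r : R).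
Hypotheses (r0 : 0 < r) (rO : forall x, `|x - c| <= r + r -> Omega x).
Variables (u : V -> R) (du : 'I_m -> V -> R) (C : R).
Hypotheses (bu : bmf u) (bdu : forall i, bmf (du i)).
Hypothesis u_weak : forall phi, test_function Omega phi -> forall i,
  \int[P]_x (u x * partial i phi x) = - \int[P]_x (du i x * phi x).

(** The kernel y |-> rho(x - y) lives within r + e <= 2r of c, so it is a test function on Omega.
    The sign of the weak derivative cancels the one of the reflection. *)
Lemma mollify_partial e i x : 0 < e <= r -> `|x - c| <= r ->
  mollify e (du i) x = \int[P]_y (u y * partial i (mollifier e) (x - y)).
Proof.
move=> /andP[e0 er] xc.
have ft : test_function Omega (fun y => mollifier e (x - y)).
  apply: (@flat_alg_test_function _ _ _ _ c (r + r)) => //.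
    exact: flat_alg_reflect x (flat_alg_mollifier e).
  move=> y /(mollifier_neq0 e0) xy.
  rewrite -[y - c](subrKA x) (le_trans (ler_normD _ _))// lerD//.
  by rewrite distrC (le_trans (ltW xy)).
transitivity (- \int[P]_y (u y * partial i (fun y => mollifier e (x - y)) y)).
  rewrite u_weak// opprK; apply: eq_Rintegral => y _; exact: mulrC.
rewrite -[in LHS]mulN1r -RintegralZl//; last first.
  apply: bmf_rintegrable; apply: bmfM => //.
  exact: flat_alg_bmf (flat_alg_partial i (flat_alg_reflect x (flat_alg_mollifier e))).
apply: eq_Rintegral => y _; rewrite partial_reflect; first by ring.
exact/flat_alg_differentiable/flat_alg_mollifier.
Qed.

(* Weak formulations are tested only with smooth functions: the product rule is
   applied to the mollifier, inside the double integral, rather than to [u]. *)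
Lemma mollified_div_grad (v : 'I_m -> V -> R) (g phi : V -> R) e :
  (forall i, bmf (v i)) -> rintegrable P g ->
  (forall phi, test_function Omega phi ->
    \int[P]_x (\sum_i v i x * partial i phi x) = - \int[P]_x (g x * phi x)) ->
  0 < e <= r -> flat_alg phi -> (forall x, phi x != 0 -> `|x - c| < r) ->
  \int[P]_x (\sum_i v i x * mollify e (du i) x * phi x) =
  - \int[P]_x ((g x * phi x + \sum_i v i x * partial i phi x) * mollify e u x).
Proof.
move=> bv ig v_weak er fphi phic; have /andP[e0 _] := er.
pose rho := @mollifier R m e; have frho : flat_alg rho := flat_alg_mollifier e.
have bphi := flat_alg_bmf fphi.
have brho i y : bmf (fun x => partial i rho (x - y)).
  exact: flat_alg_bmf (flat_alg_shift y (flat_alg_partial i frho)).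
have [mu_ [Cu uC]] := bu.
pose F (z : V * V) : R :=
  u z.2 * \sum_i (v i z.1 * phi z.1 * partial i rho (z.1 - z.2)).
have /choice[Cv vC] i := (bv i).2.
have [Cphi phiC] := flat_alg_bounded fphi.
have /choice[Cr rC] i := flat_alg_bounded (flat_alg_partial i frho).
have mF : measurable_fun setT F.
  apply: measurable_funM; first exact: (measurableT_comp mu_ measurable_snd).
  apply: measurable_sum => i; apply: measurable_funM.
    apply: measurable_funM.
      exact: (measurableT_comp (bv i).1 measurable_fst).
    exact: (measurableT_comp (measurable_flat_alg fphi) measurable_fst).
  exact: measurable_flat_alg_sub (flat_alg_partial i frho).
pose k x := g x * phi x + \sum_i v i x * partial i phi x.
have ik : rintegrable P k.
  apply: rintegrableD.
    by under eq_fun do rewrite mulrC; exact: bmf_rintegrableM.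
  apply: bmf_rintegrable; apply: bmf_sum => i; apply: bmfM => //.
  exact/flat_alg_bmf/flat_alg_partial.
(* For fixed y, [psi] is a legitimate test function. By the product rule phi grad rho = grad psi -
   rho grad phi, and the weak divergence handles grad psi. *)
have inner y : \int[P]_x (\sum_i (v i x * phi x * partial i rho (x - y))) =
    - mollify e k y.
  pose psi x := rho (x - y) * phi x.
  have fpsi : flat_alg psi by apply: flat_algM => //; exact: flat_alg_shift.
  have tpsi : test_function Omega psi.
    apply: (@flat_alg_test_function _ _ _ _ c (r + r)) => // x.
    rewrite mulf_eq0 negb_or => /andP[_ /phic/ltW xr].
    by rewrite (le_trans xr)// lerDl ltW.
  have E1 x : \sum_i (v i x * phi x * partial i rho (x - y)) =
      \sum_i v i x * partial i psi x -
      rho (x - y) * \sum_i v i x * partial i phi x.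
    rewrite big_distrr/= -sumrB; apply: eq_bigr => i _.
    have -> : partial i psi x =
        rho (x - y) * partial i phi x + phi x * partial i rho (x - y).
      rewrite -(partial_shift rho); apply: partialM.
        exact: flat_alg_differentiable (flat_alg_shift y frho).
      exact: flat_alg_differentiable.
    by ring.
  have isum (q : V -> R) : flat_alg q ->
      rintegrable P (fun x => \sum_i v i x * partial i q x).
    move=> fq; apply: bmf_rintegrable; apply: bmf_sum => i; apply: bmfM => //.
    exact/flat_alg_bmf/flat_alg_partial.
  have brhoy : bmf (fun x => rho (x - y)) by exact: flat_alg_bmf (flat_alg_shift y frho).
  transitivity (\int[P]_x (\sum_i v i x * partial i psi x) -
      \int[P]_x (rho (x - y) * \sum_i v i x * partial i phi x)).
    rewrite -RintegralB//; [|exact: isum|by apply: bmf_rintegrableM => //; exact: isum].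
    by apply: eq_Rintegral => x _; exact: E1.
  rewrite v_weak// -opprD -RintegralD//; last 2 first.
    under eq_fun do rewrite mulrC; apply: bmf_rintegrableM => //.
    exact: flat_alg_bmf.
    by apply: bmf_rintegrableM => //; exact: isum.
  congr (- _); apply: eq_Rintegral => x _.
  by rewrite -mollifierN opprB /k /psi /rho; ring.
transitivity (\int[P]_x \int[P]_y F (x, y)).
  apply: eq_Rintegral => x _.
  (* Where phi vanishes both sides are 0; elsewhere x lies in the ball where [mollify_partial]
     holds. *)
  have [px|/phic/ltW xc] := eqVneq (phi x) 0.
    transitivity (\int[P]_(y in setT) (0 : R)).
      by rewrite Rintegral_cst// mul0r big1// => i _; rewrite px mulr0.
    apply: eq_Rintegral => y _; rewrite /F/= big1 ?mulr0// => i _.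
    by rewrite px mulr0 mul0r.
  transitivity (\sum_i \int[P]_y ((v i x * phi x) * (u y * partial i rho (x - y)))).
    apply: eq_bigr => i _; rewrite mollify_partial// RintegralZl//.
      by ring.
    apply: bmf_rintegrable; apply: bmfM => //.
    exact: flat_alg_bmf (flat_alg_reflect x (flat_alg_partial i frho)).
  rewrite -Rintegral_sum; last first.
    move=> i; apply: rintegrableZ; apply: bmf_rintegrable; apply: bmfM => //.
    exact: flat_alg_bmf (flat_alg_reflect x (flat_alg_partial i frho)).
  apply: eq_Rintegral => y _; rewrite /F/= big_distrr/=.
  by apply: eq_bigr => i _; ring.
rewrite (@RFubini _ _ _ _ _ P P F (fun=> Cu) (fun=> \sum_i (Cv i * Cphi * Cr i)) mF).
- transitivity (\int[P]_y (-1 * (u y * mollify e k y))).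
    apply: eq_Rintegral => y _; rewrite /F /=.
    rewrite RintegralZl//; last first.
      by apply: bmf_rintegrable; apply: bmf_sum => i; apply: bmfM => //; exact: bmfM.
    by rewrite inner; ring.
  rewrite RintegralZl//; last first.
    by apply: bmf_rintegrable; apply: bmfM => //; exact: bmf_mollify_integrable.
  by rewrite mulN1r -mollifyC.
- by apply: bmf_rintegrable; exact: bmf_cst.
- by apply: bmf_rintegrable; exact: bmf_cst.
- move=> x y; rewrite /F /= normrM; apply: ler_pM => //.
  apply: le_trans (ler_norm_sum _ _ _) _; apply: ler_sum => i _.
  by rewrite !normrM; apply: ler_pM => //; rewrite ?mulr_ge0//; exact: ler_pM.
Qed.

Hypothesis du_C : forall i x, `|du i x| <= C.

(** The mean value theorem on the segment from y to x, where the derivative is a sum of m mollified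
    partials, each bounded by C, times coordinates of x - y. The constant m C does not involve e. *)
Lemma mollify_lipschitz e x y : 0 < e <= r -> `|x - c| <= r -> `|y - c| <= r ->
  `|mollify e u x - mollify e u y| <= m%:R * C * `|x - y|.
Proof.
move=> er xc yc; have /andP[e0 _] := er.
pose h : V := x - y; pose F (t : R) := mollify e u (y + t *: h).
have frho := @flat_alg_mollifier R m e.
have [mu_ [Cu uC]] := bu.
have /choice[Cr rC] i := flat_alg_bounded (flat_alg_partial i frho).
pose f (t : R) (z : V) : R := mollifier e (y + t *: h - z) * u z.
have bf t : bmf (f t) by apply: bmfM => //; exact: bmf_mollifier_reflect.
have df (t : R) (z : V) : is_derive t 1 (fun s : R => f s z)
    ((\sum_i h i ord0 * partial i (mollifier e) (y + t *: h - z)) * u z).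
  have E s : f s z = mollifier e ((y - z) + s *: h) * u z by rewrite /f addrAC.
  have -> : (fun s : R => f s z) = fun s => u z * mollifier e ((y - z) + s *: h).
    by apply/funext => s; rewrite E mulrC.
  have dr := flat_alg_differentiable (y - z + t *: h) frho.
  have H : is_derive t 1 (fun s : R => u z * mollifier e ((y - z) + s *: h))
      (u z *: 'D_h (mollifier e) ((y - z) + t *: h)) :=
    is_deriveZ (u z) (is_derive_line dr).
  apply: is_derive_eq H _.
  rewrite derive_partial//.
  set S := (X in _ = X * _); set S' := (X in _ *: X); have -> : S' = S.
    by apply: eq_bigr => i _; rewrite [y + _ - z]addrAC.
  exact: mulrC.
have dF t : `|y + t *: h - c| <= r ->
    is_derive t 1 F (\sum_i h i ord0 * mollify e (du i) (y + t *: h)).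
  move=> tr.
  have d1E s z : partial1of2 f s z =
      (\sum_i h i ord0 * partial i (mollifier e) (y + s *: h - z)) * u z.
    by rewrite partial1of2E; case: (df s z).
  have tI : `](t - 1), (t + 1)[%classic t.
    by rewrite /= in_itv/=; apply/andP; split; lra.
  (* The dominating constant uses bounds on the derivatives of the kernel and so depends on e; it
     only justifies the formula for F' and does not enter the Lipschitz constant. *)
  have := @cvg_differentiation_under_integral R _ V P f setT measurableT t
    (t - 1) (t + 1) tI (fun s _ => bmf_rintegrable P (bf s))
    (fun s z _ _ => let: DeriveDef d _ := df s z in d)
    (fun=> \sum_i `|h i ord0| * Cr i * Cu).
  move=> H.
  have : h0^-1 *: (F (h0 + t) - F t) @[h0 --> 0^'] -->
      \int[P]_z (partial1of2 f t z).
    apply: H.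
    - move=> z; apply: sumr_ge0 => i _; rewrite !mulr_ge0//.
        by rewrite (le_trans _ (rC i 0)).
      by rewrite (le_trans _ (uC 0)).
    - exact/bmf_rintegrable/bmf_cst.
    - move=> s z _ _; rewrite d1E normrM -big_distrl/= ler_pM//.
      apply: le_trans (ler_norm_sum _ _ _) _; apply: ler_sum => i _.
      by rewrite normrM ler_wpM2l.
  have -> : \int[P]_z (partial1of2 f t z) =
      \sum_i h i ord0 * mollify e (du i) (y + t *: h).
    transitivity (\int[P]_z (\sum_i h i ord0 *
        (u z * partial i (mollifier e) (y + t *: h - z)))).
      apply: eq_Rintegral => z _; rewrite d1E big_distrl/=.
      by apply: eq_bigr => i _; ring.
    have iu i : rintegrable P (fun z => u z * partial i (mollifier e) (y + t *: h - z)).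
      apply: bmf_rintegrable; apply: bmfM => //.
      exact: flat_alg_bmf (flat_alg_reflect _ (flat_alg_partial i frho)).
    rewrite Rintegral_sum; last by move=> i; exact: rintegrableZ.
    by apply: eq_bigr => i _; rewrite mollify_partial// RintegralZl//; exact: iu.
  move=> H1.
  have E : (fun s : R => s^-1 *: ((F \o shift t) (s *: 1) - F t)) =
      (fun s : R => s^-1 *: (F (s + t) - F t)).
    by apply/funext => s /=; rewrite [s *: 1]mulr1.
  apply: DeriveDef.
    by rewrite /derivable E; apply/cvg_ex; eexists; exact: H1.
  by rewrite /derive E; exact: cvg_lim H1.
have segP t : 0 <= t <= 1 -> `|y + t *: h - c| <= r.
  move=> /andP[t0 t1].
  have -> : y + t *: h - c = (1 - t) *: (y - c) + t *: (x - c).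
    by rewrite /h; apply/matrixP => i j; rewrite !mxE; ring.
  rewrite (le_trans (ler_normD _ _))// !normrZ.
  rewrite (ger0_norm t0) ger0_norm ?subr_ge0//.
  have -> : r = (1 - t) * r + t * r by ring.
  by rewrite lerD// ler_wpM2l// subr_ge0.
have [] := @MVT_segment R F (fun t => \sum_i h i ord0 * mollify e (du i) (y + t *: h)) 0 1 ler01.
- by move=> t; rewrite in_itv/= => /andP[/ltW t0 /ltW t1]; apply: dF; rewrite segP// t0.
- apply: derivable_within_continuous => t; rewrite in_itv/= => t01.
  by case: (dF t (segP t t01)).
move=> t; rewrite in_itv/= => /segP tc; rewrite subr0 mulr1 /F.
have yh : y + h = x by rewrite /h addrC subrK.
rewrite scale1r yh scale0r addr0 => ->.
apply: le_trans (ler_norm_sum _ _ _) _.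
apply: (@le_trans _ _ (\sum_(i < m) C * `|x - y|)).
  apply: ler_sum => i _; rewrite normrM mulrC ler_pM//.
    exact: mollify_bounded.
  exact: coord_le_norm.
rewrite sumr_const card_ord -[leLHS]mulr_natl.
by rewrite mulrA.
Qed.

(** Against a smooth phi the mollification moves onto phi, where it converges pointwise by
    continuity and boundedly; [tested_integrable] then extends the convergence to g. *)
Lemma mollify_cvg_weak f (D : R) g : bmf f -> (forall x, `|f x| <= D) ->
  rintegrable P g -> (forall x, g x != 0 -> `|x - c| < r) ->
  (fun n => \int[P]_x (mollify (r / n.+1%:R) f x * g x)) @ \oo -->
    \int[P]_x (f x * g x).
Proof.
move=> bf fD ig gD; have e0 n : 0 < r / n.+1%:R by rewrite divr_gt0.
apply: (@tested_integrable _ _ P (fun n => mollify (r / n.+1%:R) f) f D _ _ _ fD c r) => //.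
- by move=> n; case: (bmf_mollify (e0 n) bf).
- by case: bf.
- by move=> n x; exact: mollify_bounded.
move=> phi fphi phic; rewrite /tested.
have bphi := flat_alg_bmf fphi; have [mphi [Cphi phiC]] := bphi.
have -> : (fun n => \int[P]_x (mollify (r / n.+1%:R) f x * phi x)) =
    fun n => \int[P]_x (f x * mollify (r / n.+1%:R) phi x).
  apply/funext => n; rewrite -mollifyC//; last exact: bmf_rintegrable.
  by apply: eq_Rintegral => x _; rewrite mulrC.
have [mf _] := bf.
apply: (@Rdominated_convergence _ _ _ _ _ _ (fun=> D * Cphi)).
- move=> n; apply: measurable_funM => //; exact: measurable_mollify.
- exact: measurable_funM.
- apply: aeW => x; apply: cvgM; first exact: cvg_cst.
  apply/cvgrPdist_le => d d0.
  have /cvgrPdist_le/(_ _ d0) := differentiable_continuous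
    (flat_alg_differentiable x fphi).
  move=> /nbhs_ballP[rho /= rho0 xrho].
  have : (fun n : nat => r / n.+1%:R) @ \oo --> (0 : R).
    rewrite -(mulr0 r); apply: cvgM; first exact: cvg_cst.
    exact: cvg_harmonic.
  move=> /cvgrPdist_lt/(_ _ rho0); apply: filterS => n.
  rewrite sub0r normrN gtr0_norm//; set e := r / _; move=> erho.
  have mm : measurable_fun setT (fun y => mollifier e (x - y)).
    by case: (bmf_mollifier_reflect e x).
  have im : rintegrable (lebesgue_cV m) (fun y => mollifier e (x - y)).
    apply/integrableP; split; first exact/measurable_EFinP.
    under eq_integral => y _ do rewrite /= ger0_norm ?mollifier_ge0 ?e0//.
    by rewrite integral_mollifier ?e0// ltry.
  have i1 : \int[lebesgue_cV m]_y mollifier e (x - y) = 1.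
    by rewrite /Rintegral integral_mollifier ?e0.
  (* As phi vanishes off Omega, the integral may be taken over the whole space, where the kernel has
     mass exactly 1. *)
  have -> : mollify e phi x = \int[lebesgue_cV m]_y (mollifier e (x - y) * phi y).
    rewrite /mollify /Rintegral PE; last by apply/measurable_EFinP; exact: measurable_funM.
    congr fine; rewrite [LHS]integral_mkcond; apply: eq_integral => y _.
    rewrite patchE; case: ifPn => // yO; rewrite [phi y](_ : _ = 0) ?mulr0//.
    apply/eqP; apply: contraNT yO => /phic/ltW yr; rewrite inE; apply: rO.
    by rewrite (le_trans yr)// lerDl ltW.
  rewrite -[X in X - _]mulr1 -{1}i1 -RintegralZl// -RintegralB//; last 2 first.
    exact: rintegrableZ.
    by under eq_fun do rewrite mulrC; exact: bmf_rintegrableM.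
  rewrite -[leRHS]mulr1 -i1 -RintegralZl//; apply: ler_norm_Rintegral.
  + apply: rintegrableB; first exact: rintegrableZ.
    by under eq_fun do rewrite mulrC; exact: bmf_rintegrableM.
  + exact: rintegrableZ.
  + move=> y; have [->|xy] := eqVneq (mollifier e (x - y)) 0.
      by rewrite mulr0 mul0r subr0 normr0 mulr0.
    rewrite [X in X - _]mulrC -mulrBr normrM (ger0_norm (mollifier_ge0 _ (e0 n))).
    rewrite [leRHS]mulrC; apply: ler_wpM2l; first exact: mollifier_ge0.
    apply: xrho.
    by rewrite -ball_normE /ball_ /=; exact: lt_trans (mollifier_neq0 (e0 n) xy) erho.
- by apply: bmf_rintegrable; exact: bmf_cst.
- by move=> n x; rewrite normrM ler_pM//; exact: mollify_bounded.
Qed.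

End mollification.

(** * The div-curl lemma *)

Section ultrafilter_limits.
Context {R : realType}.

Lemma cvg_sumr (I T : Type) (F : set_system T) (s : seq I) (f : I -> T -> R)
    (a : I -> R) : Filter F -> (forall i, f i @ F --> a i) ->
  (fun x => \sum_(i <- s) f i x) @ F --> \sum_(i <- s) a i.
Proof.
move=> FF fa; elim: s => [|i s IH].
  by rewrite big_nil; under eq_fun do rewrite big_nil; exact: cvg_cst.
by rewrite big_cons; under eq_fun do rewrite big_cons; exact: cvgD.
Qed.

(* Limits along an ultrafilter replace the extraction of subsequences. *)
Lemma ultra_bounded_cvg (U : set_system nat) (w : nat -> R) (C : R) :
  UltraFilter U -> (forall j, `|w j| <= C) -> exists l : R, w @ U --> l.
Proof.
move=> UU wC.
have [l [_ lcl]] : `[- C, C]%classic `&` cluster (w @ U) !=set0.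
  apply: (@segment_compact R (- C) C (w @ U) _).
  have H : \forall j \near U, `[- C, C]%classic (w j).
    by apply: filterE => j; rewrite /= in_itv/= -ler_norml; exact: wC.
  exact: H.
exists l; apply/cvgrPdist_lt => e e0.
have [//|Ue] := in_ultra_setVsetC [set j | `|l - w j| < e] UU.
have [t [wt lt]] := lcl _ (ball l e) (Ue : (w @ U) [set t | ~ `|l - t| < e])
  (nbhsx_ballx l e e0).
by exfalso; apply: wt.
Qed.

(** Arzela-Ascoli along an ultrafilter: the pointwise limit inherits the Lipschitz bound, so
    convergence at one point controls a neighbourhood, and compactness makes it uniform. *)
Lemma equi_lipschitz_ultra_cvg {m : nat} (U : set_system nat)
    (w : nat -> 'cV[R]_m -> R) (K : set 'cV[R]_m) (C L : R) :
  UltraFilter U -> compact K -> (forall j x, `|w j x| <= C) ->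
  (forall j x y, K x -> K y -> `|w j x - w j y| <= L * `|x - y|) ->
  exists W : 'cV[R]_m -> R, forall e, 0 < e ->
    \forall j \near U, forall x, K x -> `|w j x - W x| <= e.
Proof.
move=> UU cK wC wL.
have /choice[W WP] x := ultra_bounded_cvg UU (fun j => wC j x).
exists W => e e0.
have WL x y : K x -> K y -> `|W x - W y| <= L * `|x - y|.
  move=> Kx Ky; have H : (fun j => `|w j x - w j y|) @ U --> `|W x - W y|.
    by apply: cvg_norm; apply: cvgB; exact: WP.
  apply: (@closed_cvg _ _ U _ _ [set t | t <= L * `|x - y|]) H.
    exact: closed_le.
  by apply: nearW => j; exact: wL.
have L1 : 0 < `|L| + 1 by rewrite ltr_wpDl.
have d0 : 0 < e / 3 / (`|L| + 1) by rewrite !divr_gt0.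
have /compact_near_coveringP/near_covering_withinP := cK.
move=> /(_ nat U (fun j x => `|w j x - W x| <= e) _).
apply.
move=> x Kx; have e3 : 0 < e / 3 by rewrite divr_gt0.
have /cvgrPdist_le/(_ _ e3) wx := WP x.
near=> x' j => Kx' /=.
have xx' : `|x - x'| <= e / 3 / (`|L| + 1).
  suff : ball x (e / 3 / (`|L| + 1)) x' by rewrite -ball_normE /ball_ /= => /ltW.
  by near: x'; exact: nbhsx_ballx.
have Lxx' : L * `|x - x'| <= e / 3.
  apply: (@le_trans _ _ ((`|L| + 1) * `|x - x'|)).
    by rewrite ler_wpM2r// (le_trans (ler_norm L))// lerDl.
  by rewrite mulrC -ler_pdivlMr.
have wj : `|W x - w j x| <= e / 3 by near: j.
have := wL j x x' Kx Kx'; have := WL x x' Kx Kx'.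
move: Lxx' wj; set l := L * _; rewrite !ler_norml.
by move=> ? /andP[? ?] /andP[? ?] /andP[? ?]; apply/andP; split; lra.
Unshelve. all: by end_near. Qed.

End ultrafilter_limits.

Section fundamental_lemma.
Context {R : realType} {m : nat}.
Local Notation V := 'cV[R]_m.

(** The hypothesis says that the constant sequence f converges weakly to 0 in the ball. Testing it
    with f itself, cut off to the ball, gives that f^2 has integral 0 there. *)
Lemma flat_fundamental (P : {finite_measure set V -> \bar R}) (c : V) (r : R)
    (f : V -> R) : 0 < r -> bmf f ->
  (forall phi, flat_alg phi -> (forall x, phi x != 0 -> `|x - c| < r) ->
    \int[P]_x (f x * phi x) = 0) ->
  {ae P, forall x, `|x - c| < r -> f x = 0}.
Proof.
move=> r0 bf f_test; have [mf [D fD]] := bf.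
pose B := [set x : V | `|x - c| < r].
have mB : measurable B.
  apply: open_measurable_mx; rewrite (_ : B = ball c r); first exact: ball_open.
  by apply/seteqP; split => x; rewrite -ball_normE /ball_ /B /= distrC.
have b1 : bmf (\1_B : V -> R) by exact: bmf_indic.
have D0 : 0 <= D by rewrite (le_trans _ (fD 0)).
have z : \int[P]_(x in setT) (0 : R) = 0 by rewrite Rintegral_cst// mul0r.
have z0 (q : V -> R) : \int[P]_x (0 * q x) = 0.
  by rewrite -[RHS]z; apply: eq_Rintegral => x _; rewrite mul0r.
have t0 : \int[P]_x (f x * (\1_B x * f x)) = 0.
  have : tested P (fun=> f) (fun=> 0) (fun x => \1_B x * f x).
    apply: (@tested_integrable _ _ P (fun=> f) (fun=> 0) D _ _ _ _ c r) => //.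
    - by move=> x; rewrite normr0.
    - by move=> phi fphi phic; rewrite /tested z0 f_test//; exact: cvg_cst.
    - by apply: bmf_rintegrable; exact: bmfM.
    - move=> x; rewrite mulf_eq0 negb_or => /andP[+ _]; rewrite indicE.
      by have [/set_mem|] := boolP (x \in B); rewrite ?eqxx.
  by rewrite /tested z0 => /cvg_lim; rewrite lim_cst// => ->.
have ge0 x : 0 <= f x * (\1_B x * f x).
  by rewrite mulrCA mulr_ge0// -expr2 sqr_ge0.
have iF : rintegrable P (fun x => f x * (\1_B x * f x)).
  by apply: bmf_rintegrable; apply: bmfM => //; exact: bmfM.
have : ae_eq P setT (EFin \o (fun x => f x * (\1_B x * f x))) (cst 0%E).
  apply/ae_eq_integral_abs => //; first by case/integrableP : iF.
  transitivity (\int[P]_x (f x * (\1_B x * f x))%:E)%E.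
    by apply: eq_integral => x _ /=; rewrite ger0_norm.
  by rewrite -EFin_Rintegral// t0.
apply: filterS => x /(_ I) /= [] /eqP; rewrite indicE => + xB.
by rewrite mem_set//= mul1r mulf_eq0 orbb => /eqP.
Qed.

End fundamental_lemma.

Section div_curl.
Context {R : realType} {m : nat}.
Local Notation V := 'cV[R]_m.
Variables (Omega : set V) (mO : measurable Omega).
Variable P : {finite_measure set V -> \bar R}.
Hypothesis PE : forall f : V -> \bar R, measurable_fun setT f ->
  (\int[P]_x f x = \int[lebesgue_cV m]_(x in Omega) f x)%E.
Variables (c : V) (r : R).
Hypotheses (r0 : 0 < r) (rO : forall x, `|x - c| <= r + r -> Omega x).
Variables (u : nat -> V -> R) (du v : nat -> 'I_m -> V -> R) (g : nat -> V -> R).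
Variable C : R.
Hypotheses (mu : forall j, measurable_fun setT (u j))
  (mdu : forall j i, measurable_fun setT (du j i))
  (mv : forall j i, measurable_fun setT (v j i)).
Hypotheses (u_C : forall j x, `|u j x| <= C)
  (du_C : forall j i x, `|du j i x| <= C) (v_C : forall j i x, `|v j i x| <= C).
Hypotheses (ig : forall j, rintegrable P (g j))
  (g_C : forall j, \int[P]_x `|g j x| <= C).
Hypothesis u_weak : forall j phi, test_function Omega phi -> forall i,
  \int[P]_x (u j x * partial i phi x) = - \int[P]_x (du j i x * phi x).
Hypothesis v_weak : forall j phi, test_function Omega phi ->
  \int[P]_x (\sum_i v j i x * partial i phi x) = - \int[P]_x (g j x * phi x).
Variables (vbar dubar : 'I_m -> V -> R) (p : V -> R).
Hypotheses (bvbar : forall i, bmf (vbar i)) (bdubar : forall i, bmf (dubar i))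
  (bp : bmf p).
Hypothesis v_cvg : forall i phi, flat_alg phi -> test_function Omega phi ->
  (fun j => \int[P]_x (v j i x * phi x)) @ \oo --> \int[P]_x (vbar i x * phi x).
Hypothesis du_cvg : forall i phi, flat_alg phi -> test_function Omega phi ->
  (fun j => \int[P]_x (du j i x * phi x)) @ \oo --> \int[P]_x (dubar i x * phi x).
Hypothesis p_cvg : forall phi, flat_alg phi -> test_function Omega phi ->
  (fun j => \int[P]_x ((\sum_i v j i x * du j i x) * phi x)) @ \oo -->
  \int[P]_x (p x * phi x).

Let bu j : bmf (u j). Proof. by split => //; exists C. Qed.
Let bdu j i : bmf (du j i). Proof. by split => //; exists C. Qed.
Let bv j i : bmf (v j i). Proof. by split => //; exists C. Qed.

Let local_test phi : flat_alg phi -> (forall x, phi x != 0 -> `|x - c| < r) ->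
  test_function Omega phi.
Proof.
move=> fphi phic; apply: (@flat_alg_test_function _ _ _ _ c r) => //.
  by move=> x /phic/ltW.
by move=> x xr; apply: rO; rewrite (le_trans xr)// lerDl ltW.
Qed.

(** The weights met below are phi times a weak limit or a mollified gradient: bounded and Borel, but
    not test functions. *)
Let weak_bmf (h_ : nat -> V -> R) (h : V -> R) :
  (forall j, measurable_fun setT (h_ j)) -> bmf h ->
  (forall j x, `|h_ j x| <= C) ->
  (forall phi, flat_alg phi -> test_function Omega phi ->
    (fun j => \int[P]_x (h_ j x * phi x)) @ \oo --> \int[P]_x (h x * phi x)) ->
  forall f : V -> R, bmf f -> (forall x, f x != 0 -> `|x - c| < r) ->
    (fun j => \int[P]_x (h_ j x * f x)) @ \oo --> \int[P]_x (h x * f x).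
Proof.
move=> mh_ [mh [D hD]] h_C h_cvg f bf fc.
apply: (@tested_integrable _ _ P h_ h (Num.max C D) _ _ _ _ c r) => //.
- by move=> n x; rewrite le_max h_C.
- by move=> x; rewrite le_max hD orbT.
- by move=> phi fphi phic; apply: h_cvg => //; exact: local_test.
- exact: bmf_rintegrable.
Qed.

Let sum_cvg (a_ : nat -> 'I_m -> V -> R) (a b : 'I_m -> V -> R) phi :
  (forall j i, bmf (a_ j i)) -> (forall i, bmf (a i)) -> (forall i, bmf (b i)) ->
  bmf phi ->
  (forall i, (fun j => \int[P]_x (a_ j i x * (b i x * phi x))) @ \oo -->
    \int[P]_x (a i x * (b i x * phi x))) ->
  (fun j => \int[P]_x (\sum_i b i x * a_ j i x * phi x)) @ \oo -->
    \int[P]_x (\sum_i b i x * a i x * phi x).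
Proof.
move=> ba_ ba bb bphi a_a.
have E (q : 'I_m -> V -> R) : (forall i, bmf (q i)) ->
    \int[P]_x (\sum_i b i x * q i x * phi x) =
    \sum_i \int[P]_x (q i x * (b i x * phi x)).
  move=> bq; rewrite -Rintegral_sum.
    by apply: eq_Rintegral => x _; apply: eq_bigr => i _; ring.
  by move=> i; apply: bmf_rintegrable; apply: bmfM => //; exact: bmfM.
rewrite E// (_ : (fun _ => _) = fun j =>
    \sum_i \int[P]_x (a_ j i x * (b i x * phi x))); last first.
  by apply/funext => j; rewrite E.
by apply: cvg_sumr => i; exact: a_a.
Qed.

(** With all terms integrated against phi and D_k the mollified gradient of u_k, the chain is p ~
    v_j.du_j ~ v_j.D_j ~ v_j.D_k ~ vbar.D_k ~ vbar.du_k ~ vbar.dubar. Only the third link uses the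
    divergence, through [identity]. *)
Lemma div_curl_tested phi : flat_alg phi ->
  (forall x, phi x != 0 -> `|x - c| < r) ->
  \int[P]_x (p x * phi x) = \int[P]_x (\sum_i vbar i x * dubar i x * phi x).
Proof.
move=> fphi phic; have bphi := flat_alg_bmf fphi.
have tphi : test_function Omega phi by exact: local_test.
have phic' (f : V -> R) x : f x * phi x != 0 -> `|x - c| < r.
  by rewrite mulf_eq0 negb_or => /andP[_ /phic].
have e0 n : 0 < r / n.+1%:R :> R by rewrite divr_gt0.
have e0r n : 0 < r / n.+1%:R <= r.
  by rewrite e0 ler_pdivrMr// ler_peMr ?ler1n ?ltW.
have moll_cvg k (b : 'I_m -> V -> R) : (forall i, bmf (b i)) ->
    (fun n => \int[P]_x (\sum_i b i x * mollify P (r / n.+1%:R) (du k i) x * phi x))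
      @ \oo --> \int[P]_x (\sum_i b i x * du k i x * phi x).
  move=> bb; apply: sum_cvg => //.
    by move=> j i; exact: (bmf_mollify mO PE).
  move=> i; apply: (mollify_cvg_weak mO PE r0 rO (D := C)) => //.
    by apply: bmf_rintegrable; exact: bmfM.
  by move=> x; exact: phic'.
(* The scale at stage k serves the second and the fifth link at once: it is fine enough both against
   v_k and against vbar. *)
have pick k : exists n,
    `|\int[P]_x (\sum_i v k i x * du k i x * phi x) -
      \int[P]_x (\sum_i v k i x * mollify P (r / n.+1%:R) (du k i) x * phi x)| <=
    k.+1%:R^-1 /\
    `|\int[P]_x (\sum_i vbar i x * du k i x * phi x) -
      \int[P]_x (\sum_i vbar i x * mollify P (r / n.+1%:R) (du k i) x * phi x)| <=
    k.+1%:R^-1.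
  have k0 : 0 < k.+1%:R^-1 :> R by rewrite invr_gt0.
  have /cvgrPdist_le/(_ _ k0) H1 := moll_cvg k (v k) (bv k).
  have /cvgrPdist_le/(_ _ k0) H2 := moll_cvg k vbar bvbar.
  have [n _ H] := filterI H1 H2.
  by exists n; exact: (H n (leqnn n)).
have {pick} [n_ nP] := choice pick.
pose e k := r / (n_ k).+1%:R; pose w k := mollify P (e k) (u k).
pose D k i := mollify P (e k) (du k i).
have bD k i : bmf (D k i) := bmf_mollify mO PE (e0 _) (bdu k i).
(* This is div(phi v_j), bounded in L^1 by [KK] uniformly in j. *)
pose kk j x := g j x * phi x + \sum_i v j i x * partial i phi x.
have ikk j : rintegrable P (kk j).
  apply: rintegrableD.
    by under eq_fun do rewrite mulrC; exact: bmf_rintegrableM.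
  apply: bmf_rintegrable; apply: bmf_sum => i; apply: bmfM => //.
  exact: flat_alg_bmf (flat_alg_partial i fphi).
have [_ [Cphi phiC]] := bphi.
have /choice[Cd dC] i := flat_alg_bounded (flat_alg_partial i fphi).
have C0 : 0 <= C by rewrite (le_trans _ (u_C 0 0)).
have Cphi0 : 0 <= Cphi by rewrite (le_trans _ (phiC 0)).
pose KK := \int[P]_x (\sum_i C * Cd i) + Cphi * C.
have kkK j : \int[P]_x `|kk j x| <= KK.
  apply: (@le_trans _ _ (\int[P]_x (\sum_i C * Cd i + Cphi * `|g j x|))).
    apply: le_Rintegral => //; first exact: rintegrable_norm.
      apply: rintegrableD; first exact/bmf_rintegrable/bmf_cst.
      exact/rintegrableZ/rintegrable_norm.
    move=> x _; rewrite /kk addrC (le_trans (ler_normD _ _))// lerD//.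
      apply: le_trans (ler_norm_sum _ _ _) _; apply: ler_sum => i _.
      by rewrite normrM; apply: ler_pM => //; exact: dC.
    by rewrite normrM mulrC; apply: ler_wpM2r => //; exact: phiC.
  rewrite RintegralD//; last 2 first.
    exact/bmf_rintegrable/bmf_cst.
    exact/rintegrableZ/rintegrable_norm.
  rewrite lerD2l RintegralZl//; last exact: rintegrable_norm.
  by rewrite ler_wpM2l.
have KK0 : 0 <= KK by apply: le_trans (kkK 0); exact: Rintegral_ge0.
(* Off the closed ball phi vanishes in a neighbourhood, so its partial derivatives vanish too.
   Uniform convergence of the w_j is thus required on that ball only. *)
have kk0 j x : kk j x != 0 -> `|x - c| <= r.
  apply: contraNT; rewrite -ltNge => xr; rewrite /kk.
  have nz : {near x, (fun=> 0) =1 phi}.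
    have xr0 : 0 < `|x - c| - r by rewrite subr_gt0.
    apply: filterS (nbhsx_ballx x _ xr0) => y; rewrite -ball_normE /ball_ /= => yr.
    have {}yr : r < `|y - c|.
      rewrite -(ltrD2l `|x - y|) (lt_le_trans (y := `|x - c|))// -?ltrBrDr//.
      by rewrite -(subrKA y) ler_normD.
    apply/esym/eqP; apply: contraTT yr => /phic/ltW.
    by rewrite leNgt.
  rewrite -(nbhs_singleton nz) mulr0 add0r big1// => i _.
  by rewrite /partial -(near_eq_derive _ nz) derive_cst mulr0.
have identity j k : \int[P]_x (\sum_i v j i x * D k i x * phi x) =
    - \int[P]_x (kk j x * w k x).
  exact: (mollified_div_grad r0 rO (bu k) (u_weak k) (bv j) (ig j) (v_weak j) (e0r (n_ k)) fphi phic).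
have [U [UU ooU]] := @ultraFilterLemma _ (\oo : set_system nat) _.
have [W WP] : exists W : V -> R, forall e, 0 < e ->
    \forall j \near U, forall x, `|x - c| <= r -> `|w j x - W x| <= e.
  apply: (@equi_lipschitz_ultra_cvg R m U w [set x : V | `|x - c| <= r] C (m%:R * C)) => //.
  - exact: closed_ball_cV_compact.
  - by move=> j x; exact: (mollify_bounded mO PE x (e0 _) (bu j)).
  - by move=> j x y xr yr; exact: (mollify_lipschitz mO PE rO (bu j) (bdu j) (u_weak j) (du_C j) (e0r (n_ j))).
have toU (a : nat -> R) l : a @ \oo --> l -> a @ U --> l.
  by move=> al; apply: cvg_trans al => Q /= ?; exact: ooU.
have inv_cvg : (fun k : nat => k.+1%:R^-1 : R) @ U --> (0 : R).
  by apply: toU; exact: cvg_harmonic.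
apply/eqP; rewrite -subr_eq0 -normr_le0; apply/ler_addgt0Pr => eps eps0; rewrite add0r.
(* Five links of the chain cost d each, and the exchange of w_j for w_k costs KK * 2d. *)
pose d := eps / (5 + 2 * KK).
have d0 : 0 < d by rewrite divr_gt0// ltr_pwDl// mulr_ge0.
have [k [Wk [kd Ek]]] : exists k, (forall x, `|x - c| <= r -> `|w k x - W x| <= d) /\
    `|0 - (k.+1%:R^-1 : R)| <= d /\
    `|\int[P]_x (\sum_i vbar i x * dubar i x * phi x) -
      \int[P]_x (\sum_i vbar i x * du k i x * phi x)| <= d.
  have H1 := WP d d0; have /cvgrPdist_le/(_ _ d0) H2 := inv_cvg.
  have H3 : (fun k => \int[P]_x (\sum_i vbar i x * du k i x * phi x)) @ U -->
      \int[P]_x (\sum_i vbar i x * dubar i x * phi x).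
    apply: toU; apply: sum_cvg => // i.
    exact: (weak_bmf (mdu^~ i) (bdubar i) (fun j => du_C j i) (@du_cvg i)
      (bmfM (bvbar i) bphi) (phic' _)).
  move/cvgrPdist_le : H3 => /(_ _ d0) H3.
  have [k Hk] := filter_ex (filterI H1 (filterI H2 H3)).
  by exists k.
(* The index j is chosen after k, because D_k is the fixed weight against which v_j converges. Both
   are taken along U, so that w_j and w_k are close to the same W. *)
have [j [Wj [jd [Aj Bj]]]] : exists j, (forall x, `|x - c| <= r -> `|w j x - W x| <= d) /\
    `|0 - (j.+1%:R^-1 : R)| <= d /\
    `|\int[P]_x (p x * phi x) - \int[P]_x (\sum_i v j i x * du j i x * phi x)| <= d /\
    `|\int[P]_x (\sum_i vbar i x * D k i x * phi x) -
      \int[P]_x (\sum_i v j i x * D k i x * phi x)| <= d.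
  have H1 := WP d d0; have /cvgrPdist_le/(_ _ d0) H2 := inv_cvg.
  have H3 : (fun j => \int[P]_x (\sum_i v j i x * du j i x * phi x)) @ U -->
      \int[P]_x (p x * phi x).
    apply: toU; have := p_cvg fphi tphi.
    by under eq_fun do under eq_Rintegral do rewrite big_distrl.
  have H4 : (fun j => \int[P]_x (\sum_i v j i x * D k i x * phi x)) @ U -->
      \int[P]_x (\sum_i vbar i x * D k i x * phi x).
    apply: toU.
    have sw (q : 'I_m -> V -> R) : \int[P]_x (\sum_i q i x * D k i x * phi x) =
        \int[P]_x (\sum_i D k i x * q i x * phi x).
      by apply: eq_Rintegral => x _; apply: eq_bigr => i _; ring.
    rewrite sw; under eq_fun do rewrite sw.
    apply: sum_cvg => // i.
    exact: (weak_bmf (mv^~ i) (bvbar i) (fun j => v_C j i) (@v_cvg i)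
      (bmfM (bD k i) bphi) (phic' _)).
  move/cvgrPdist_le : H3 => /(_ _ d0) H3; move/cvgrPdist_le : H4 => /(_ _ d0) H4.
  have [j Hj] := filter_ex (filterI H1 (filterI H2 (filterI H3 H4))).
  by exists j.
have [nj _] := nP j; have [_ nk] := nP k.
have main : `|\int[P]_x (\sum_i v j i x * D j i x * phi x) -
    \int[P]_x (\sum_i v j i x * D k i x * phi x)| <= KK * (d + d).
  have bw l : bmf (w l) := bmf_mollify mO PE (e0 _) (bu l).
  have ikw l : rintegrable P (fun x => kk j x * w l x).
    by under eq_fun do rewrite mulrC; exact: bmf_rintegrableM.
  rewrite !identity -opprD normrN -RintegralB//; [|exact: ikw|exact: ikw].
  apply: (@le_trans _ _ (\int[P]_x (`|kk j x| * (d + d)))).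
    apply: ler_norm_Rintegral; first exact: rintegrableB.
      by under eq_fun do rewrite mulrC; apply: rintegrableZ; exact: rintegrable_norm.
    move=> x; rewrite -mulrBr normrM.
    have [->|/kk0 xr] := eqVneq (kk j x) 0; first by rewrite normr0 !mul0r.
    rewrite ler_wpM2l// -(subrKA (W x)) (le_trans (ler_normD _ _))//.
    by rewrite lerD ?Wj// distrC Wk.
  rewrite RintegralZr//; last exact: rintegrable_norm.
  by rewrite ler_wpM2r// addr_ge0 ?ltW.
have chain (a b A1 A2 A3 A4 A5 ij ik kd2 : R) :
    `|a - A1| <= d -> `|A1 - A2| <= ij -> `|0 - ij| <= d ->
    `|A2 - A3| <= kd2 -> `|A4 - A3| <= d -> `|A5 - A4| <= ik ->
    `|0 - ik| <= d -> `|b - A5| <= d -> `|a - b| <= d * 5 + kd2.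
  move=> h1 h2; rewrite !sub0r !normrN => /(le_trans (ler_norm _)) h3 h4 h5 h6.
  move=> /(le_trans (ler_norm _)) h7 h8.
  have -> : d * 5 + kd2 = d + (d + (kd2 + (d + (d + d)))) by ring.
  apply: le_trans (ler_distD A1 a b) (lerD h1 _).
  apply: le_trans (ler_distD A2 A1 b) (lerD (le_trans h2 h3) _).
  apply: le_trans (ler_distD A3 A2 b) (lerD h4 _).
  apply: le_trans (ler_distD A4 A3 b) (lerD _ _); first by rewrite distrC.
  apply: le_trans (ler_distD A5 A4 b) (lerD _ _); rewrite distrC//.
  exact: le_trans h6 h7.
have dE : d * 5 + KK * (d + d) = eps.
  rewrite /d; have : 5 + 2 * KK != 0 by rewrite gt_eqF// ltr_pwDl// mulr_ge0.
  by move=> ?; field.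
rewrite -dE; exact: (chain _ _ _ _ _ _ _ _ _ _ Aj nj jd main Bj nk kd Ek).
Qed.

Lemma div_curl :
  {ae P, forall x, `|x - c| < r -> p x = \sum_i vbar i x * dubar i x}.
Proof.
have bs : bmf (fun x => \sum_i vbar i x * dubar i x).
  by apply: bmf_sum => i; exact: bmfM.
have : {ae P, forall x, `|x - c| < r -> p x - \sum_i vbar i x * dubar i x = 0}.
  apply: flat_fundamental => //; first exact: bmfB.
  move=> phi fphi phic; have bphi := flat_alg_bmf fphi.
  transitivity (\int[P]_x (p x * phi x) -
      \int[P]_x (\sum_i vbar i x * dubar i x * phi x)).
    rewrite -RintegralB//; last 2 first.
      by apply: bmf_rintegrable; exact: bmfM.
      apply: bmf_rintegrable; apply: bmf_sum => i; apply: bmfM => //; exact: bmfM.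
    by apply: eq_Rintegral => x _; rewrite mulrBl big_distrl.
  by rewrite div_curl_tested// subrr.
by apply: filterS => x + xr => /(_ xr)/eqP; rewrite subr_eq0 => /eqP.
Qed.

End div_curl.

(** * Young measures *)

Section almost_everywhere.
Context d (T : measurableType d) {R : realType}.
Variable P : {measure set T -> \bar R}.

Lemma ae_forall_countable (I : countType) (Q : I -> T -> Prop) :
  (forall i, {ae P, forall x, Q i x}) -> {ae P, forall x, forall i, Q i x}.
Proof.
move=> aeQ.
have : {ae P, forall x k, if unpickle k is Some i then Q i x else True}.
  apply/ae_foralln => k; case: unpickle => [i|]; first exact: aeQ.
  exact: aeW.
by apply: filterS => x Qx i; have := Qx (pickle i); rewrite pickleK.
Qed.

Import HBNNSimple.

(** The data agree with Borel functions only almost everywhere, and may themselves fail to be Borel.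
    The integral of a nonnegative function is a supremum over simple functions below it; setting
    such a simple function to 0 on the null set keeps its integral and puts it below the other
    function. *)
Lemma ae_eq_integral_nonmeasurable (D : set T) (f g : T -> \bar R) :
  {ae P, forall x, D x -> f x = g x} ->
  (\int[P]_(x in D) f x = \int[P]_(x in D) g x)%E.
Proof.
have ge0_le (f1 f2 : T -> \bar R) : (forall x, 0 <= f1 x)%E ->
    (forall x, 0 <= f2 x)%E -> {ae P, forall x, D x -> f1 x = f2 x} ->
    (\int[P]_(x in D) f1 x <= \int[P]_(x in D) f2 x)%E.
  move=> f10 f20 [N [mN N0 fN]]; rewrite !ge0_integralE//.
  apply: ge_ereal_sup => _ [h /= hf <-].
  have kE x : proj_nnsfun h (measurableC mN) x = h x * \1_(~` N) x by [].
  apply: ereal_sup_ubound => /=; exists (proj_nnsfun h (measurableC mN)).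
    move=> x; rewrite kE indicE; have [xN|xN] := boolP (x \in ~` N).
      rewrite mulr1 (le_trans (hf x))// !patchE; case: ifPn => // xD.
      have -> // : f1 x = f2 x.
      apply: contrapT => nf; move/set_mem: xN; apply; apply: fN => /= /(_ _).
      by move/(_ (set_mem xD)).
    by rewrite mulr0 patchE; case: ifPn.
  have := integral_nnsfun P measurableT (proj_nnsfun h (measurableC mN)).
  have := integral_nnsfun P measurableT h.
  rewrite !patch_setT => <- <-.
  apply: ae_eq_integral => //; do ?exact/measurable_EFinP.
  exists N; split => // x /= /not_implyP[_ nE]; apply: contrapT => xN; apply: nE.
  by have := kE x; rewrite indicE mem_set// mulr1 /= => ->.
move=> fg; rewrite integralE [RHS]integralE; congr (_ - _)%E; apply/eqP.
  by rewrite eq_le !ge0_le//; apply: filterS fg => x fgx Dx;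
    rewrite !unlock fgx.
by rewrite eq_le !ge0_le//; apply: filterS fg => x fgx Dx;
  rewrite !unlock fgx.
Qed.

End almost_everywhere.

(** * Functions measurable up to a null set *)

Section ae_representatives.
Context d (T : measurableType d) {R : realType}.
Variable P : {measure set T -> \bar R}.

Definition ae_rep d' (T' : measurableType d') (f : T -> T') :=
  exists2 g : T -> T', measurable_fun setT g & {ae P, forall x, g x = f x}.

Lemma ae_repD (f g : T -> \bar R) : ae_rep f -> ae_rep g ->
  ae_rep (fun x => f x + g x)%E.
Proof.
move=> [f' mf ff'] [g' mg gg']; exists (fun x => f' x + g' x)%E.
  exact: emeasurable_funD.
by apply: filterS2 ff' gg' => x -> ->.
Qed.

Lemma ae_repB (f g : T -> \bar R) : ae_rep f -> ae_rep g ->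
  ae_rep (fun x => f x - g x)%E.
Proof.
move=> [f' mf ff'] [g' mg gg']; exists (fun x => f' x - g' x)%E.
  exact: emeasurable_funB.
by apply: filterS2 ff' gg' => x -> ->.
Qed.

Lemma ae_repZ k (f : T -> \bar R) : ae_rep f -> ae_rep (fun x => k * f x)%E.
Proof.
move=> [f' mf ff']; exists (fun x => k * f' x)%E; first exact: measurable_funeM.
by apply: filterS ff' => x ->.
Qed.

Lemma ae_rep_sum (I : Type) (s : seq I) (F : I -> T -> \bar R) :
  (forall i, ae_rep (F i)) -> ae_rep (fun x => \sum_(i <- s) F i x)%E.
Proof.
move=> FP; elim: s => [|i s IH].
  exists (fun=> 0%E); first exact: measurable_cst.
  by apply: aeW => x; rewrite big_nil.
by under eq_fun do rewrite big_cons; exact: ae_repD.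
Qed.

(** The representatives may diverge on a null set; their upper limit is measurable all the same and
    equals f off a countable union of null sets. *)
Lemma ae_rep_cvg (F : nat -> T -> \bar R) (f : T -> \bar R) : (forall n, ae_rep (F n)) ->
  (forall x, F ^~ x @ \oo --> f x) -> ae_rep f.
Proof.
move=> FP Ff; have /choice[G GP] n : exists g : T -> \bar R,
    measurable_fun setT g /\ {ae P, forall x, g x = F n x}.
  by have [g mg gF] := FP n; exists g.
exists (fun x => limn_esup (G ^~ x)).
  by apply: measurable_fun_limn_esup => n; case: (GP n).
have : {ae P, forall x, forall n, G n x = F n x}.
  by apply: ae_forall_countable => n; case: (GP n).
apply: filterS => x GF; have -> : G ^~ x = F ^~ x by apply/funext.
by rewrite (cvg_limn_einf_sup (Ff x)).2.
Qed.

Import HBNNSimple.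

(** Each set E comes with its own null set. Simple approximations of f involve only countably many
    sets, and monotone convergence concludes. *)
Lemma ae_rep_integral d' (Z : measurableType d') (mu : T -> probability Z R)
    (f : Z -> \bar R) :
  (forall E, measurable E -> ae_rep (fun x => mu x E)) ->
  measurable_fun setT f -> (forall z, 0 <= f z)%E ->
  ae_rep (fun x => \int[mu x]_z f z)%E.
Proof.
move=> mmu mf f0; pose g := nnsfun_approx measurableT mf.
apply: (@ae_rep_cvg (fun n x => \int[mu x]_z (g n z)%:E)%E); last first.
  move=> x; rewrite [X in _ --> X](_ : _ = \int[mu x]_z limn (EFin \o g ^~ z))%E.
    apply: cvg_monotone_convergence => //.
    - by move=> n; exact/measurable_EFinP.
    - by move=> n z _; rewrite lee_fin.
    - by move=> z _ a b ab; rewrite lee_fin; exact/lefP/nd_nnsfun_approx.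
  apply: eq_integral => z _; apply/esym/cvg_lim => //.
  exact: cvg_nnsfun_approx.
move=> n.
rewrite (_ : (fun _ => _) = fun x =>
    (\sum_(y <- finmap.enum_fset (fset_set (range (g n)))) y%:E * mu x (g n @^-1` [set y]))%E).
  by apply: ae_rep_sum => y; apply: ae_repZ; exact: mmu.
apply/funext => x; rewrite integral_nnsfun// patch_setT sintegralE.
by rewrite fsbig_finite.
Qed.

Lemma ae_rep_Rintegral d' (Z : measurableType d') (mu : T -> probability Z R)
    (f : Z -> R) :
  (forall E, measurable E -> ae_rep (fun x => mu x E)) ->
  measurable_fun setT f -> ae_rep (fun x => \int[mu x]_z f z).
Proof.
move=> mmu mf.
have [g mg gE] : ae_rep (fun x => \int[mu x]_z (f z)%:E)%E.
  under eq_fun do rewrite integralE.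
  apply: ae_repB; apply: ae_rep_integral => //.
    by apply: measurable_funepos; exact/measurable_EFinP.
  by apply: measurable_funeneg; exact/measurable_EFinP.
exists (fine \o g); first exact: measurableT_comp.
by apply: filterS gE => x /= ->.
Qed.

Lemma ae_rep_bounded (f : T -> R) C : 0 <= C -> ae_rep f ->
  {ae P, forall x, `|f x| <= C} ->
  exists g : T -> R, [/\ measurable_fun setT g, forall x, `|g x| <= C
    & {ae P, forall x, g x = f x}].
Proof.
move=> C0 [g mg gf] fC; exists (fun x => Num.max (- C) (Num.min (g x) C)).
split.
- by apply: measurable_maxr => //; apply: measurable_minr.
- by move=> x; rewrite ler_norml le_max lexx/= ge_max ge_min lexx orbT andbT; lra.
- apply: filterS2 gf fC => x -> /[!ler_norml] /andP[? ?].
  by rewrite min_l// max_r.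
Qed.

End ae_representatives.

(** * Continuous functions and distances on matrix spaces *)

Section matrix_functions.
Context {R : realType} {p q : nat}.
Local Notation M := 'M[R]_(p, q).

Lemma continuous_measurable_mx (f : M -> R) : continuous f ->
  measurable_fun setT f.
Proof.
move=> cf; apply: (measurability _ (RGenOpens.measurableE R)) => //.
move=> _ [_ [a [b ->]] <-]; rewrite setTI; apply: open_measurable_mx.
by apply: open_comp; [move=> A _; exact: cf|exact: interval_open].
Qed.

(** Measured in the maximum norm, for which balls and bounds are entrywise; it is dominated by
    [frobenius_dist]. *)
Definition mx_dist (K : set M) (Z : M) : R := inf [set `|Z - Y| | Y in K].

Variable K : set M.
Hypothesis K0 : K !=set0.

Let has_inf_dist Z : has_inf [set `|Z - Y| | Y in K].
Proof.
split; first by have [Y KY] := K0; exists `|Z - Y|; exists Y.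
by exists 0 => _ [Y _ <-].
Qed.

Lemma mx_dist_ge0 Z : 0 <= mx_dist K Z.
Proof. by apply: lb_le_inf; [case: (has_inf_dist Z)|move=> _ [Y _ <-]]. Qed.

Lemma mx_dist_le Z Y : K Y -> mx_dist K Z <= `|Z - Y|.
Proof.
by move=> KY; apply: ge_inf; [case: (has_inf_dist Z)|exists Y].
Qed.

Lemma mx_dist_lt Z e : mx_dist K Z < e -> exists2 Y, K Y & `|Z - Y| < e.
Proof.
rewrite -subr_gt0 => /inf_adherent/(_ (has_inf_dist Z))[_ [Y KY <-]].
by rewrite -/(mx_dist K Z) [ltRHS]addrC subrK => Ze; exists Y.
Qed.

Lemma continuous_mx_dist : continuous (mx_dist K).
Proof.
have lip Z Z' : mx_dist K Z - mx_dist K Z' <= `|Z - Z'|.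
  rewrite lerBlDl -lerBlDr; apply: lb_le_inf; first by case: (has_inf_dist Z').
  move=> _ [Y KY <-]; rewrite lerBlDr (le_trans (mx_dist_le Z KY))//.
  by rewrite -(subrKA Z') addrC ler_normD.
move=> Z; apply/(@cvgrPdist_le _ _ _ (nbhs Z)) => e e0.
apply: filterS (nbhsx_ballx Z e e0) => Z'; rewrite -ball_normE /ball_ /= => ZZ'.
by rewrite ler_norml (le_trans (lip Z Z') (ltW ZZ')) andbT lerNl opprB
  (le_trans (lip Z' Z))// distrC ltW.
Qed.

End matrix_functions.

Section local_to_global.
Context {R : realType} {m : nat}.
Local Notation V := 'cV[R]_m.

(** Countably many balls with rational centre and radius cover Omega, so a statement proved almost
    everywhere on small balls holds almost everywhere. *)
Lemma ae_open (P : {measure set V -> \bar R}) (Omega : set V) (Q : V -> Prop) :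
  open Omega ->
  (forall (c : V) (r : R), 0 < r -> (forall x, `|x - c| <= r + r -> Omega x) ->
    {ae P, forall x, `|x - c| < r -> Q x}) ->
  {ae P, forall x, Omega x -> Q x}.
Proof.
move=> oO locQ.
pose cv (c : 'M[rat]_(m, 1)) : V := \matrix_(i, j) ratr (c i j).
pose ok (cr : 'M[rat]_(m, 1) * rat) := 0 < (ratr cr.2 : R) /\
  forall x : V, `|x - cv cr.1| <= ratr cr.2 + ratr cr.2 -> Omega x.
have : {ae P, forall x, forall cr : 'M[rat]_(m, 1) * rat,
    ok cr -> `|x - cv cr.1| < ratr cr.2 -> Q x}.
  apply: ae_forall_countable => cr.
  have [okcr|nok] := pselect (ok cr); last by apply: aeW => x /nok.
  by have := locQ _ _ okcr.1 okcr.2; apply: filterS => x Qx _.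
apply: filterS => x Qx Ox.
have /nbhs_ballP[e /= e0 xeO] := open_nbhs_nbhs (conj oO Ox).
(* A point within 2r of a centre that is within r of x is within 3r < e of x. *)
have [r] : exists r : rat, ratr r \in `]0, e / 3[ by apply: rat_in_itvoo; rewrite divr_gt0.
rewrite in_itv/= => /andP[r0 re].
have /choice[c cP] (i : 'I_m) : exists c : rat, `|x i ord0 - ratr c| < ratr r.
  have [c] : exists c : rat, ratr c \in `](x i ord0 - ratr r), (x i ord0 + ratr r)[.
    by apply: rat_in_itvoo; rewrite ltrBlDr -addrA ltrDl addr_gt0.
  by rewrite in_itv/= => /andP[c1 c2]; exists c; rewrite distrC ltr_distl c1.
have xc : `|x - cv (\col_i c i)| < ratr r.
  by apply: mx_norm_lt => // i j; rewrite !mxE (ord1 j).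
apply: (Qx (\col_i c i, r)) => //; split => // y yc; apply: xeO.
rewrite -ball_normE /ball_ /= -(subrKA (cv (\col_i c i))).
rewrite (le_lt_trans (ler_normD _ _))//.
rewrite distrC in yc; apply: lt_le_trans (ltr_leD xc yc) _.
by move: re; lra.
Qed.

End local_to_global.

(** * Support and integrals of the Young measure *)

Section young_measures.
Context {R : realType} {m p q : nat}.
Local Notation V := 'cV[R]_m.
Local Notation M := 'M[R]_(p, q).
Variables (Omega : set V) (oO : open Omega).
Variable P : {finite_measure set V -> \bar R}.
Hypothesis PE : forall f : V -> \bar R, measurable_fun setT f ->
  (\int[P]_x f x = \int[lebesgue_cV m]_(x in Omega) f x)%E.
Hypothesis Pae : forall Q : V -> Prop, {ae P, forall x, Q x} ->
  {ae lebesgue_cV m, forall x, Omega x -> Q x}.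
Variables (W : nat -> V -> M) (C : R) (mu : V -> probability M R).
Hypotheses (mW : forall j, measurable_fun setT (W j))
  (W_C : forall j x, `|W j x| <= C).
Hypothesis mmu : forall E, measurable E -> ae_rep P (fun x => mu x E).
Hypothesis W_mu : forall (f : M -> R) eta, continuous f ->
  test_function Omega eta ->
  (fun j => \int[P]_x (f (W j x) * eta x)) @ \oo -->
  \int[lebesgue_cV m]_(x in Omega) ((\int[mu x]_Z f Z) * eta x).

(** Puts the weak limit of f(W_j) into the form required by the div-curl lemma: Borel and bounded
    everywhere. *)
Lemma young_rep (f : M -> R) (Cf : R) : continuous f -> 0 <= Cf ->
  {ae P, forall x, `|\int[mu x]_Z f Z| <= Cf} ->
  exists g : V -> R, [/\ measurable_fun setT g, forall x, `|g x| <= Cf,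
    {ae P, forall x, g x = \int[mu x]_Z f Z} &
    forall eta, flat_alg eta -> test_function Omega eta ->
      (fun j => \int[P]_x (f (W j x) * eta x)) @ \oo --> \int[P]_x (g x * eta x)].
Proof.
move=> cf Cf0 fC; have mf := continuous_measurable_mx cf.
have [g [mg gC gf]] := ae_rep_bounded Cf0 (ae_rep_Rintegral mmu mf) fC.
exists g; split => // eta feta teta.
rewrite (_ : \int[P]_x (g x * eta x) =
    \int[lebesgue_cV m]_(x in Omega) ((\int[mu x]_Z f Z) * eta x)).
  exact: W_mu.
have meta := measurable_flat_alg feta.
rewrite /Rintegral PE; last by apply/measurable_EFinP; exact: measurable_funM.
congr fine; apply: ae_eq_integral_nonmeasurable.
by apply: filterS (Pae gf) => x gx Ox; rewrite gx.
Qed.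

(** By dominated convergence f(W_j) tends weakly to 0, so the integral of f under mu_x is 0 for
    almost every x; as f >= 0, it vanishes mu_x-almost everywhere. *)
Lemma young_null (f : M -> R) : continuous f -> (forall Z, 0 <= f Z <= 1) ->
  {ae P, forall x, (fun j => f (W j x)) @ \oo --> (0 : R)} ->
  {ae P, forall x, Omega x -> {ae mu x, forall Z, f Z = 0}}.
Proof.
move=> cf f01 fW; have mf := continuous_measurable_mx cf.
have fb x : rintegrable (mu x) f.
  apply: (@bmf_rintegrable _ _ _ (mu x)); split => //; exists 1 => Z.
  by have /andP[? ?] := f01 Z; rewrite ger0_norm.
have f1 x : `|\int[mu x]_Z f Z| <= 1.
  apply: (@le_trans _ _ (\int[mu x]_(Z in setT) 1)).
    apply: ler_norm_Rintegral => //.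
      by apply: (@bmf_rintegrable _ _ _ (mu x)); exact: bmf_cst.
    by move=> Z; have /andP[? ?] := f01 Z; rewrite ger0_norm.
  by rewrite Rintegral_cst// mul1r [X in fine X](@probability_setT _ _ _ (mu x)).
have [g [mg gC gf gcvg]] := young_rep cf ler01 (aeW _ f1).
have : {ae P, forall x, Omega x -> g x = 0}.
  apply: ae_open => // c r r0 rO; apply: flat_fundamental => //.
    by split => //; exists 1.
  move=> phi fphi phic.
  have tphi : test_function Omega phi.
    apply: (@flat_alg_test_function _ _ _ _ c r) => //; first by move=> x /phic/ltW.
    by move=> x xr; apply: rO; rewrite (le_trans xr)// lerDl ltW.
  have [mphi [Cphi phiC]] := flat_alg_bmf fphi.
  have : (fun j => \int[P]_x (f (W j x) * phi x)) @ \oo --> \int[P]_(x in setT) (0 : R).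
    apply: (@Rdominated_convergence _ _ _ _ _ _ (fun=> Cphi)).
    - by move=> j; apply: measurable_funM => //; exact: measurableT_comp.
    - exact: measurable_cst.
    - apply: filterS fW => x fWx; rewrite -(mul0r (phi x)).
      by apply: cvgM => //; exact: cvg_cst.
    - by apply: bmf_rintegrable; exact: bmf_cst.
    - move=> j x; rewrite normrM -[leRHS]mul1r ler_pM//.
      by have /andP[? ?] := f01 (W j x); rewrite ger0_norm.
  rewrite Rintegral_cst// mul0r => z0.
  exact: (cvg_unique _ (gcvg phi fphi tphi) z0).
apply: filterS2 gf => x gx /[apply] g0.
have : ae_eq (mu x) setT (EFin \o f) (cst 0%E).
  apply/ae_eq_integral_abs => //; first exact/measurable_EFinP.
  transitivity (\int[mu x]_Z (f Z)%:E)%E.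
    by apply: eq_integral => Z _ /=; have /andP[? _] := f01 Z; rewrite ger0_norm.
  by rewrite -EFin_Rintegral// -gx g0.
by apply: filterS => Z /(_ I) [].
Qed.

Lemma young_dist (K : set M) : K !=set0 ->
  {ae P, forall x, (fun j => mx_dist K (W j x)) @ \oo --> (0 : R)} ->
  {ae P, forall x, Omega x -> {ae mu x, forall Z, mx_dist K Z = 0}}.
Proof.
(* A continuous function with values in [0, 1] and the same zeros as the distance. *)
move=> K0 dW; pose f Z : R := 1 - expR (- mx_dist K Z).
have cf : continuous f.
  move=> Z; apply: (@cvgB _ _ _ (nbhs Z)); first exact: cvg_cst.
  apply: (@cvg_comp _ _ _ (fun Z => - mx_dist K Z) expR (nbhs Z)
    (nbhs (- mx_dist K Z))); last exact: continuous_expR.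
  by apply: (@cvgN _ _ _ (nbhs Z)); exact: continuous_mx_dist.
have f01 Z : 0 <= f Z <= 1.
  apply/andP; split; last by rewrite /f lerBlDr lerDl expR_ge0.
  by rewrite /f subr_ge0 expR_le1 oppr_le0 mx_dist_ge0.
have fW : {ae P, forall x, (fun j => f (W j x)) @ \oo --> (0 : R)}.
  apply: filterS dW => x dWx.
  have -> : (0 : R) = 1 - expR (- 0) by rewrite oppr0 expR0 subrr.
  apply: cvgB; first exact: cvg_cst.
  apply: (@cvg_comp _ _ _ (fun j => - mx_dist K (W j x)) expR _ (nbhs (- 0 : R))).
    exact: cvgN.
  exact: continuous_expR.
apply: filterS (young_null cf f01 fW) => x + Ox => /(_ Ox).
apply: filterS => Z /eqP; rewrite /f subr_eq0 eq_sym => /eqP e1.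
by apply/eqP; rewrite -oppr_eq0; apply/eqP/expR_inj; rewrite e1 expR0.
Qed.

Hypothesis C0 : 0 <= C.

(** The sequence lies in the closed ball of radius C, so [young_dist] applies to that ball with
    distances identically 0. *)
Lemma young_bounded :
  {ae P, forall x, Omega x -> {ae mu x, forall Z, `|Z| <= C}}.
Proof.
pose K := [set Z : M | `|Z| <= C].
have K0 : K !=set0 by exists 0; rewrite /K /= normr0.
have : {ae P, forall x, (fun j => mx_dist K (W j x)) @ \oo --> (0 : R)}.
  apply: aeW => x; apply: cvg_near_cst; apply: nearW => j.
  apply/eqP; rewrite eq_le mx_dist_ge0// andbT.
  have := mx_dist_le K0 (W j x) (W_C j x : K (W j x)).
  by rewrite subrr normr0.
move=> /(young_dist K0); apply: filterS => x + Ox => /(_ Ox).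
apply: filterS => Z dZ; apply/ler_addgt0Pr => e e0.
have /(mx_dist_lt K0)[Y KY ZY] : mx_dist K Z < e by rewrite dZ.
rewrite -[Z](subrK Y) addrC (le_trans (ler_normD _ _))// lerD// ltW//.
Qed.

(** Coordinates and their products are unbounded on the matrix space. On the support of mu_x they
    agree with their truncation at D, which is integrable. *)
Lemma young_integral_bounded (f : M -> R) (D : R) : continuous f ->
  (forall Z, `|Z| <= C -> `|f Z| <= D) ->
  {ae P, forall x, Omega x ->
    rintegrable (mu x) f /\ `|\int[mu x]_Z f Z| <= D}.
Proof.
move=> cf fD; have mf := continuous_measurable_mx cf.
have D0 : 0 <= D by rewrite (le_trans _ (fD 0 _)) ?normr0.
apply: filterS young_bounded => x + Ox => /(_ Ox) ZC.
pose f' Z := Num.max (- D) (Num.min (f Z) D).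
have mf' : measurable_fun setT f' by apply: measurable_maxr => //; apply: measurable_minr.
have f'D Z : `|f' Z| <= D.
  by rewrite ler_norml le_max lexx/= ge_max ge_min lexx orbT andbT; lra.
have ff' : {ae mu x, forall Z, f Z = f' Z}.
  apply: filterS ZC => Z /fD; rewrite ler_norml => /andP[? ?].
  by rewrite /f' min_l// max_r.
have if' : rintegrable (mu x) f'.
  by apply: (@bmf_rintegrable _ _ _ (mu x)); split => //; exists D.
have iD : rintegrable (mu x) (fun=> D).
  by apply: (@bmf_rintegrable _ _ _ (mu x)); exact: bmf_cst.
have E : \int[mu x]_Z f Z = \int[mu x]_Z f' Z.
  rewrite /Rintegral; congr fine; apply: ae_eq_integral => //; do ?exact/measurable_EFinP.
  by apply: filterS ff' => Z /= -> _.
split; last first.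
  rewrite E; apply: (@le_trans _ _ (\int[mu x]_(Z in setT) D)).
    exact: ler_norm_Rintegral.
  by rewrite Rintegral_cst// [X in fine X](@probability_setT _ _ _ (mu x)) mulr1.
apply/integrableP; split; first exact/measurable_EFinP.
case/integrableP : if' => _; rewrite (_ : \int[mu x]_Z _ = \int[mu x]_Z `|(EFin \o f) Z|)%E//.
apply: ae_eq_integral => //; do 2?[by apply: measurableT_comp => //; exact/measurable_EFinP].
by apply: filterS ff' => Z /= -> _.
Qed.

End young_measures.

Section young_div_curl.
Context {R : realType} {m p : nat}.
Local Notation V := 'cV[R]_m.
Local Notation M := 'M[R]_(p, m).
Variables (Omega : set V) (oO : open Omega).
Variable P : {finite_measure set V -> \bar R}.
Hypothesis PE : forall f : V -> \bar R, measurable_fun setT f ->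
  (\int[P]_x f x = \int[lebesgue_cV m]_(x in Omega) f x)%E.
Hypothesis Pae : forall Q : V -> Prop, {ae P, forall x, Q x} ->
  {ae lebesgue_cV m, forall x, Omega x -> Q x}.
Hypothesis PO : {ae P, forall x, Omega x}.
Variables (W : nat -> V -> M) (C : R) (mu : V -> probability M R).
Hypotheses (mW : forall j, measurable_fun setT (W j))
  (W_C : forall j x, `|W j x| <= C) (C0 : 0 <= C).
Hypothesis mmu : forall E, measurable E -> ae_rep P (fun x => mu x E).
Hypothesis W_mu : forall (f : M -> R) eta, continuous f ->
  test_function Omega eta ->
  (fun j => \int[P]_x (f (W j x) * eta x)) @ \oo -->
  \int[lebesgue_cV m]_(x in Omega) ((\int[mu x]_Z f Z) * eta x).
Variables (a b : 'I_p) (u g : nat -> V -> R) (C' : R).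
Hypotheses (m_u : forall j, measurable_fun setT (u j))
  (u_C' : forall j x, `|u j x| <= C').
Hypotheses (ig : forall j, rintegrable P (g j))
  (g_C' : forall j, \int[P]_x `|g j x| <= C').
Hypothesis u_weak : forall j phi, test_function Omega phi -> forall i,
  \int[P]_x (u j x * partial i phi x) = - \int[P]_x (W j x b i * phi x).
Hypothesis v_weak : forall j phi, test_function Omega phi ->
  \int[P]_x (\sum_i W j x a i * partial i phi x) = - \int[P]_x (g j x * phi x).

Let continuous_coord k i : continuous (fun Z : M => Z k i).
Proof. by move=> Z; exact: coord_continuous. Qed.

Let continuous_dot : continuous (fun Z : M => \sum_i Z a i * Z b i).
Proof.
by move=> Z; apply: (@cvg_sumr _ _ _ (nbhs Z)) => i; apply: (@cvgM _ _ (nbhs Z));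
  exact: continuous_coord.
Qed.

(** The three weak limits in [div_curl] are those of the entries of row a, of the entries of row b,
    and of the inner product of the rows. The Young measure supplies them as integrals of continuous
    functions of Z. *)
Lemma young_div_curl : {ae P, forall x,
  \int[mu x]_Z (\sum_i Z a i * Z b i) =
  \sum_i \int[mu x]_Z Z a i * \int[mu x]_Z Z b i}.
Proof.
pose D := Num.max C C'.
have CD : C <= D by rewrite le_max lexx.
have C'D : C' <= D by rewrite le_max lexx orbT.
have rep (f : M -> R) Cf : continuous f -> (forall Z, `|Z| <= C -> `|f Z| <= Cf) ->
    exists g : V -> R, [/\ measurable_fun setT g, forall x, `|g x| <= Cf,
    {ae P, forall x, g x = \int[mu x]_Z f Z} &
    forall eta, flat_alg eta -> test_function Omega eta ->
      (fun j => \int[P]_x (f (W j x) * eta x)) @ \oo --> \int[P]_x (g x * eta x)].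
  move=> cf fC; apply: (young_rep PE Pae mmu W_mu cf).
    by rewrite (le_trans _ (fC 0 _)) ?normr0.
  have := young_integral_bounded oO PE Pae mW W_C mmu W_mu C0 cf fC.
  by apply: filterS2 PO => x Ox /(_ Ox)[].
have coordC k i (Z : M) : `|Z| <= C -> `|Z k i| <= C.
  by apply: le_trans; exact: coord_le_norm.
have /choice[vb vbP] i := rep _ C (@continuous_coord a i) (coordC a i).
have /choice[db dbP] i := rep _ C (@continuous_coord b i) (coordC b i).
have [|pb [mpb pbC pbE pb_cvg]] := rep _ (\sum_(i < m) C * C) continuous_dot.
  move=> Z ZC; apply: le_trans (ler_norm_sum _ _ _) _; apply: ler_sum => i _.
  by rewrite normrM ler_pM// coordC.
have H : {ae P, forall x, Omega x -> pb x = \sum_i vb i x * db i x}.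
  apply: ae_open => // c r r0 rO.
  apply: (div_curl (open_measurable_mx oO) PE r0 rO
    (u := u) (du := fun j i x => W j x b i) (v := fun j i x => W j x a i)
    (g := g) (C := D)) => //.
  - by move=> j i; exact: (measurableT_comp (measurable_coord b i) (mW j)).
  - by move=> j i; exact: (measurableT_comp (measurable_coord a i) (mW j)).
  - by move=> j x; exact: le_trans (u_C' j x) C'D.
  - by move=> j i x; rewrite (le_trans (coordC _ _ _ (W_C j x))).
  - by move=> j i x; rewrite (le_trans (coordC _ _ _ (W_C j x))).
  - by move=> j; exact: le_trans (g_C' j) C'D.
  - by move=> i; have [mv vC _ _] := vbP i; split => //; exists C.
  - by move=> i; have [mv vC _ _] := dbP i; split => //; exists C.
  - by split => //; exists (\sum_(i < m) C * C).
  - by move=> i; have [_ _ _] := vbP i.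
  - by move=> i; have [_ _ _] := dbP i.
have vE : {ae P, forall x, forall i, vb i x = \int[mu x]_Z Z a i}.
  by apply: ae_forall_countable => i; case: (vbP i).
have dE : {ae P, forall x, forall i, db i x = \int[mu x]_Z Z b i}.
  by apply: ae_forall_countable => i; case: (dbP i).
apply: filterS2 (filterI PO H) (filterI pbE (filterI vE dE)).
move=> x [Ox Hx] [<- [vx dx]]; rewrite (Hx Ox); apply: eq_bigr => i _.
by rewrite vx dx.
Qed.

End young_div_curl.

(** * Borel representatives on the domain *)

Section representatives.
Context {R : realType} {m : nat}.
Local Notation V := 'cV[R]_m.
Variables (Omega : set V) (mO : measurable Omega).
Hypothesis Ooo : (lebesgue_cV m Omega < +oo)%E.
Local Notation P := (mfrestr mO Ooo).

Lemma ae_measurable_ereal (f : V -> \bar R) : ae_measurable Omega f -> ae_rep P f.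
Proof.
move=> [g mg fg]; exists (g \_ Omega).
  by apply/(measurable_restrictT _ mO).
apply: (mfrestr_ae mO Ooo); apply: filterS fg => x + Ox => /(_ Ox) ->.
by rewrite patchE mem_set.
Qed.

Lemma ae_measurable_mx p q (f : V -> 'M[R]_(p, q)) i j :
  ae_measurable Omega f -> ae_rep P (fun x => f x i j).
Proof.
move=> [g mg fg]; exists ((fun x => g x i j) \_ Omega).
  apply/(measurable_restrictT _ mO).
  exact: (measurableT_comp (measurable_coord i j) mg).
apply: (mfrestr_ae mO Ooo); apply: filterS fg => x + Ox => /(_ Ox) ->.
by rewrite patchE mem_set.
Qed.

(** The entries are truncated separately, which respects the bound because the norm is the maximum
    over the entries. *)
Lemma Linfty_representative p q (f : V -> 'M[R]_(p, q)) C : 0 <= C ->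
  ae_measurable Omega f ->
  {ae lebesgue_cV m, forall x, Omega x -> `|f x| <= C} ->
  exists f' : V -> 'M[R]_(p, q), [/\ measurable_fun setT f',
    forall x, `|f' x| <= C & {ae P, forall x, f' x = f x}].
Proof.
move=> C0 mf /(mfrestr_ae mO Ooo) fC.
have /choice[g gP] (ij : 'I_p * 'I_q) : exists g : V -> R,
    [/\ measurable_fun setT g, forall x, `|g x| <= C
    & {ae P, forall x, g x = f x ij.1 ij.2}].
  apply: ae_rep_bounded => //; first exact: ae_measurable_mx.
  by apply: filterS fC => x; apply: le_trans; exact: coord_le_norm.
exists (fun x => \matrix_(i, j) g (i, j) x); split.
- apply: measurable_mx => i j; under eq_fun do rewrite mxE.
  by case: (gP (i, j)).
- by move=> x; apply: mx_norm_le => // i j; rewrite mxE; case: (gP (i, j)).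
- have : {ae P, forall x, forall ij, g ij x = f x ij.1 ij.2}.
    by apply: ae_forall_countable => ij; case: (gP ij).
  by apply: filterS => x gx; apply/matrixP => i j; rewrite mxE gx.
Qed.

Lemma L1_representative p (f : V -> 'cV[R]_p) C i :
  ae_measurable Omega f ->
  (\int[lebesgue_cV m]_(x in Omega) `|f x|%:E <= C%:E)%E ->
  exists g : V -> R, [/\ rintegrable P g, \int[P]_x `|g x| <= C
    & {ae P, forall x, g x = f x i ord0}].
Proof.
move=> [h mh fh] fC; pose g := (fun x => h x i ord0) \_ Omega.
have mg : measurable_fun setT g.
  apply/(measurable_restrictT _ mO).
  exact: (measurableT_comp (measurable_coord i ord0) mh).
have gC : (\int[P]_x `|g x|%:E <= C%:E)%E.
  rewrite integral_mfrestr; last first.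
    by apply/measurable_EFinP; exact: measurableT_comp.
  apply: le_trans fC.
  have -> : (\int[lebesgue_cV m]_(x in Omega) `|f x|%:E =
      \int[lebesgue_cV m]_(x in Omega) `|h x|%:E)%E.
    apply: ae_eq_integral_nonmeasurable.
    by apply: filterS fh => x + Ox => /(_ Ox) ->.
  apply: ge0_le_integral => //.
  - by apply/measurable_EFinP; apply: measurableT_comp => //; exact: measurable_funTS.
  - apply/measurable_EFinP.
    apply: (measurableT_comp (f := fun Z : 'cV[R]_p => `|Z|)) mh.
    by apply: continuous_measurable_mx => Z; exact: norm_continuous.
  - by move=> x Ox; rewrite lee_fin /g patchE mem_set// coord_le_norm.
have ig : rintegrable P g.
  apply/integrableP; split; first exact/measurable_EFinP.
  exact: le_lt_trans gC (ltry _).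
exists g; split => //.
  by rewrite -lee_fin EFin_Rintegral//; exact: rintegrable_norm.
apply: (mfrestr_ae mO Ooo); apply: filterS fh => x + Ox => /(_ Ox) ->.
by rewrite /g patchE mem_set.
Qed.

Lemma Rintegral_representative (F F' : V -> R) : measurable_fun setT F' ->
  {ae P, forall x, F' x = F x} ->
  \int[lebesgue_cV m]_(x in Omega) F x = \int[P]_x F' x.
Proof.
move=> mF' FF'; rewrite Rintegral_mfrestr//; congr fine.
apply: ae_eq_integral_nonmeasurable.
by apply: filterS (ae_mfrestr FF') => x + Ox => /(_ Ox) ->.
Qed.

Lemma measurable_smooth (phi : V -> R) (s : seq 'I_m) : smooth phi ->
  measurable_fun setT (foldr partial phi s).
Proof.
move=> sphi; apply: continuous_measurable_mx => x.
exact/differentiable_continuous.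
Qed.

End representatives.

(** * The graph parametrization of the Grassmannian *)

Section matrix_limits.
Context {R : realType} {T : Type} (F : set_system T) {FF : Filter F}.

Lemma cvg_mx p q (f : T -> 'M[R]_(p, q)) (A : 'M[R]_(p, q)) :
  (forall i j, (fun x => f x i j) @ F --> A i j) -> f @ F --> A.
Proof.
move=> fA; apply/cvgrPdist_lt => e e0.
have : \forall x \near F, forall ij : 'I_p * 'I_q, `|A ij.1 ij.2 - f x ij.1 ij.2| < e.
  apply: filter_forall => -[i j] /=.
  by have /cvgrPdist_lt/(_ _ e0) := fA i j.
apply: filterS => x fx; apply: mx_norm_lt => // i j.
by rewrite !mxE; exact: (fx (i, j)).
Qed.

Lemma cvg_coord p q (f : T -> 'M[R]_(p, q)) (A : 'M[R]_(p, q)) i j : f @ F --> A ->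
  (fun x => f x i j) @ F --> A i j.
Proof.
move=> fA; apply: (@cvg_comp _ _ _ f (fun A : 'M[R]_(p, q) => A i j) F (nbhs A)) => //.
exact: coord_continuous.
Qed.

Lemma cvg_mulmx p q r (f : T -> 'M[R]_(p, q)) (g : T -> 'M[R]_(q, r))
    (A : 'M[R]_(p, q)) (B : 'M[R]_(q, r)) :
  f @ F --> A -> g @ F --> B -> (fun x => f x *m g x) @ F --> A *m B.
Proof.
move=> fA gB; apply: cvg_mx => i j; rewrite mxE; under eq_fun do rewrite mxE.
by apply: cvg_sumr => k; apply: cvgM; exact: cvg_coord.
Qed.

Lemma cvg_trmx p q (f : T -> 'M[R]_(p, q)) (A : 'M[R]_(p, q)) :
  f @ F --> A -> (fun x => (f x)^T) @ F --> A^T.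
Proof.
move=> fA; apply: cvg_mx => i j; rewrite mxE; under eq_fun do rewrite mxE.
exact: cvg_coord.
Qed.

Lemma cvg_prodr (I : Type) (s : seq I) (f : I -> T -> R) (a : I -> R) :
  (forall i, f i @ F --> a i) ->
  (fun x => \prod_(i <- s) f i x) @ F --> \prod_(i <- s) a i.
Proof.
move=> fa; elim: s => [|i s IH].
  by rewrite big_nil; under eq_fun do rewrite big_nil; exact: cvg_cst.
by rewrite big_cons; under eq_fun do rewrite big_cons; exact: cvgM.
Qed.

Lemma cvg_det p (f : T -> 'M[R]_p) (A : 'M[R]_p) :
  f @ F --> A -> (fun x => \det (f x)) @ F --> \det A.
Proof.
move=> fA; apply: cvg_sumr => s; apply: cvgM; first exact: cvg_cst.
by apply: cvg_prodr => i; exact: cvg_coord.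
Qed.

(** By Cramer's rule the entries of the inverse are quotients of determinants. *)
Lemma cvg_invmx p (f : T -> 'M[R]_p) (A : 'M[R]_p) : (forall x, f x \in unitmx) ->
  A \in unitmx -> f @ F --> A -> (fun x => invmx (f x)) @ F --> invmx A.
Proof.
move=> fu Au fA; apply: cvg_mx => i j; rewrite /invmx Au !mxE.
under eq_fun do rewrite fu !mxE.
apply: cvgM.
  apply: cvgV; last exact: cvg_det.
  by rewrite -unitfE -unitmxE.
apply: cvgM; first exact: cvg_cst.
apply: cvg_det; apply: cvg_mx => k l; rewrite !mxE.
by under eq_fun do rewrite !mxE; exact: cvg_coord.
Qed.

End matrix_limits.

Section jacobi.
Context {R : realType}.

Lemma is_derive_prodr (I : eqType) (s : seq I) (f : I -> R -> R) (df : I -> R) (t : R) :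
  uniq s -> (forall i, is_derive t 1 (f i) (df i)) ->
  is_derive t 1 (fun x => \prod_(i <- s) f i x)
    (\sum_(i <- s) \prod_(k <- s) (if k == i then df k else f k t)).
Proof.
move=> + dfP; elim: s => [|i s IH] /= us.
  have -> : (fun x => \prod_(i <- [::]) f i x) = cst (1 : R).
    by apply/funext => x; rewrite big_nil.
  by rewrite big_nil; exact: is_derive_cst.
have /andP[is_ us'] := us.
have -> : (fun x => \prod_(j <- i :: s) f j x) = f i * (fun x => \prod_(j <- s) f j x).
  by apply/funext => x; rewrite big_cons.
apply: is_derive_eq (is_deriveM (dfP i) (IH us')) _.
rewrite !big_cons eqxx addrC; congr (_ + _).
  rewrite mulrC; congr (_ * _); rewrite !big_seq; apply: eq_bigr => k ks.
  by case: eqP => // ki; rewrite -ki ks in is_.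
rewrite -[LHS]/(f i t * _) big_distrr/= !big_seq; apply: eq_bigr => j js.
by rewrite big_cons ifN//; apply: contraNneq is_ => ->.
Qed.

(** Jacobi's formula. In the Leibniz expansion the terms where the factor of row i is differentiated
    add up to the determinant with row i replaced by its derivative, which is then expanded along
    that row. *)
Lemma is_derive_det p (f : R -> 'M[R]_p) (df : 'M[R]_p) (t : R) :
  (forall i j, is_derive t 1 (fun s => f s i j) (df i j)) ->
  is_derive t 1 (fun s => \det (f s)) (\tr (df *m \adj (f t))).
Proof.
move=> dfP.
have d1 (s : {perm 'I_p}) : is_derive t 1 (fun x => \prod_i f x i (s i))
    (\sum_i \prod_k (if k == i then df k (s k) else f t k (s k))).
  exact: (is_derive_prodr (f := fun i x => f x i (s i)) (df := fun i => df i (s i))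
    (index_enum_uniq _)).
have -> : (fun s => \det (f s)) =
    (fun x => \sum_(s : {perm 'I_p}) (-1) ^+ s * \prod_i f x i (s i)).
  by [].
have dsum (r : seq {perm 'I_p}) : is_derive t 1
    (fun x => \sum_(s <- r) (-1) ^+ s * \prod_i f x i (s i))
    (\sum_(s <- r) (-1) ^+ s *
      \sum_i \prod_k (if k == i then df k (s k) else f t k (s k))).
  elim: r => [|s r IH].
    have -> : (fun x => \sum_(s <- [::] : seq {perm 'I_p}) (-1) ^+ s * \prod_i f x i (s i)) = cst (0 : R).
      by apply/funext => x; rewrite big_nil.
    by rewrite big_nil; exact: is_derive_cst.
  have -> : (fun x => \sum_(s0 <- s :: r) (-1) ^+ s0 * \prod_i f x i (s0 i)) =
      (fun x => (-1) ^+ s * \prod_i f x i (s i)) +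
      (fun x => \sum_(s <- r) (-1) ^+ s * \prod_i f x i (s i)).
    by apply/funext => x; rewrite big_cons.
  rewrite big_cons; exact: (is_deriveD (is_deriveZ ((-1) ^+ s) (d1 s)) IH).
apply: is_derive_eq (dsum _) _.
under eq_bigr do rewrite big_distrr/=.
rewrite exchange_big/= /mxtrace; apply: eq_bigr => i _.
pose B : 'M[R]_p := \matrix_(k, l) if k == i then df k l else f t k l.
transitivity (\det B).
  apply: eq_bigr => s _; congr (_ * _); apply: eq_bigr => k _.
  by rewrite mxE.
rewrite (expand_det_row _ i) mxE; apply: eq_bigr => j _.
rewrite !mxE eqxx; congr (_ * (_ * \det _)).
apply/matrixP => k l; rewrite !mxE ifN//.
by rewrite eq_sym neq_lift.
Qed.

End jacobi.

Section graph_projection.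
Context {R : realType} {m n : nat}.
Implicit Types X Y : 'M[R]_(n, m).
Local Notation J Y := (col_mx 0 Y : 'M[R]_(m + n, m)).
Local Notation S X := (invmx (gram X)).

Lemma gramE X : gram X = 1%:M + X^T *m X.
Proof. by rewrite /gram /graph_mx tr_col_mx mul_row_col trmx1 mulmx1. Qed.

Lemma gram_sym X : (gram X)^T = gram X.
Proof. by rewrite /gram trmx_mul trmxK. Qed.

(** If v G = 0 then 0 = v G v^t = |v|^2 + |v X^t|^2. *)
Lemma gram_unit X : gram X \in unitmx.
Proof.
rewrite -row_free_unit -kermx_eq0; apply/rowV0P => v /sub_kermxP vG.
have : (v *m v^T + (v *m X^T) *m (v *m X^T)^T) 0 0 = 0.
  have -> : v *m v^T + (v *m X^T) *m (v *m X^T)^T = v *m gram X *m v^T.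
    by rewrite gramE mulmxDr mulmx1 mulmxDl trmx_mul trmxK !mulmxA.
  by rewrite vG mul0mx mxE.
have sq k (w : 'rV[R]_k) : (w *m w^T) 0 0 = \sum_i w 0 i ^+ 2.
  by rewrite mxE; apply: eq_bigr => i _; rewrite mxE expr2.
rewrite mxE !sq => /eqP; rewrite paddr_eq0 ?sumr_ge0//; do ?by move=> i _; exact: sqr_ge0.
case/andP => /eqP v0 _; apply/rowP => i; rewrite mxE; apply/eqP.
have /(_ i isT)/eqP := psumr_eq0P (fun i _ => sqr_ge0 (v 0 i)) v0.
by rewrite sqrf_eq0.
Qed.

Lemma invgram_sym X : (S X)^T = S X.
Proof. by rewrite trmx_inv gram_sym. Qed.

Lemma cvg_gram (T : Type) (F : set_system T) (f : T -> 'M[R]_(n, m)) X :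
  Filter F -> f @ F --> X -> (fun t => gram (f t)) @ F --> gram X.
Proof.
move=> FF fX; rewrite gramE; under eq_fun do rewrite gramE.
apply: cvgD; first exact: cvg_cst.
by apply: cvg_mulmx => //; exact: cvg_trmx.
Qed.

Lemma cvg_graph_mx (T : Type) (F : set_system T) (f : T -> 'M[R]_(n, m)) X :
  Filter F -> f @ F --> X -> (fun t => graph_mx (f t)) @ F --> graph_mx X.
Proof.
move=> FF fX; apply: cvg_mx => i j; rewrite /graph_mx.
have [k ->|k ->] := split_ordP i.
  by rewrite col_mxEu; under eq_fun do rewrite col_mxEu; exact: cvg_cst.
by rewrite col_mxEd; under eq_fun do rewrite col_mxEd; exact: cvg_coord.
Qed.

Lemma cvg_invgram (T : Type) (F : set_system T) (f : T -> 'M[R]_(n, m)) X :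
  Filter F -> f @ F --> X -> (fun t => S (f t)) @ F --> S X.
Proof.
move=> FF fX; apply: cvg_invmx; [by move=> t; exact: gram_unit|exact: gram_unit|].
exact: cvg_gram.
Qed.

Lemma cvg_graph_proj (T : Type) (F : set_system T) (f : T -> 'M[R]_(n, m)) X :
  Filter F -> f @ F --> X -> (fun t => graph_proj (f t)) @ F --> graph_proj X.
Proof.
move=> FF fX; apply: cvg_mulmx; last by apply: cvg_trmx; exact: cvg_graph_mx.
by apply: cvg_mulmx; [exact: cvg_graph_mx|exact: cvg_invgram].
Qed.

(** The determinant never vanishes along the segment t X and equals 1 at t = 0, so the intermediate
    value theorem fixes its sign. *)
Lemma det_gram_gt0 X : 0 < \det (gram X).
Proof.
have dn0 Y : \det (gram Y) != 0 by rewrite -unitfE -unitmxE gram_unit.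
pose f (t : R) := \det (gram (t *: X)).
have cf : {within `[0, 1], continuous f}.
  apply: continuous_subspaceT => t; apply: cvg_det; apply: cvg_gram.
  by apply: (@cvgZl _ _ _ (nbhs t)); exact: cvg_id.
have f0 : f 0 = 1 by rewrite /f scale0r gramE trmx0 mul0mx addr0 det1.
rewrite ltNge; apply/negP => f1.
have [|t _ ft] := @IVT R f 0 1 0 ler01 cf; last by have := dn0 (t *: X); rewrite -/(f t) ft eqxx.
by rewrite f0 ge_min le_max ler01 /f scale1r f1 orbT.
Qed.

Lemma area_gt0 X : 0 < area X.
Proof. by rewrite sqrtr_gt0 det_gram_gt0. Qed.

Lemma cvg_area (T : Type) (F : set_system T) (f : T -> 'M[R]_(n, m)) X :
  Filter F -> f @ F --> X -> (fun t => area (f t)) @ F --> area X.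
Proof.
move=> FF fX; apply: (@cvg_comp _ _ _ (fun t => \det (gram (f t))) Num.sqrt F
  (nbhs (\det (gram X)))); first by apply: cvg_det; exact: cvg_gram.
exact: sqrt_continuous.
Qed.

Lemma graph_proj_mul X : graph_proj X *m graph_mx X = graph_mx X.
Proof.
by rewrite /graph_proj -mulmxA -/(gram X) -mulmxA mulVmx ?mulmx1// gram_unit.
Qed.

Lemma graph_proj_sym X : (graph_proj X)^T = graph_proj X.
Proof. by rewrite /graph_proj !trmx_mul trmxK invgram_sym mulmxA. Qed.

Lemma mul_graph_proj X : (graph_mx X)^T *m graph_proj X = (graph_mx X)^T.
Proof. by rewrite -[graph_proj X]graph_proj_sym -trmx_mul graph_proj_mul. Qed.

Lemma graph_proj_grassmannian X : grassmannian m (graph_proj X).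
Proof.
split; first exact: graph_proj_sym.
  by rewrite {2}/graph_proj !mulmxA graph_proj_mul.
by rewrite /graph_proj mxtrace_mulC mulmxA -/(gram X) mulmxV ?gram_unit// mxtrace1.
Qed.

(** The left blocks of the projection are S and X S with S invertible, and they determine X. *)
Lemma graph_proj_inj X Y : graph_proj X = graph_proj Y -> X = Y.
Proof.
have E Z : graph_proj Z = block_mx (S Z) (S Z *m Z^T) (Z *m S Z) (Z *m S Z *m Z^T).
  by rewrite /graph_proj /graph_mx tr_col_mx trmx1 mul_col_mx mul1mx mul_col_row !mulmx1.
rewrite !E => /eq_block_mx[SS _ XS _].
have u : S X \in unitmx by rewrite unitmx_inv gram_unit.
by rewrite -[X](mulmxK u) XS -SS mulmxK.
Qed.

(** An exact formula, so that differentiating the projection takes only its continuity. It comes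
    from T' - T = T' (1 - T) - (1 - T') T with T' the projection at X + tY: since 1 - T' kills the
    new tangent matrix, it sends the old one to - t (1 - T') J Y, and symmetrically for 1 - T. *)
Lemma graph_proj_increment X Y (t : R) :
  graph_proj (X + t *: Y) - graph_proj X =
  t *: ((1%:M - graph_proj (X + t *: Y)) *m J Y *m S X *m (graph_mx X)^T +
    graph_mx (X + t *: Y) *m S (X + t *: Y) *m (J Y)^T *m (1%:M - graph_proj X)).
Proof.
set Z := X + _.
have MZ : graph_mx Z = graph_mx X + t *: J Y.
  by rewrite /graph_mx scale_col_mx scaler0 add_col_mx addr0.
have -> : graph_proj Z - graph_proj X =
    graph_proj Z *m (1%:M - graph_proj X) - (1%:M - graph_proj Z) *m graph_proj X.
  by rewrite mulmxBr mulmxBl mulmx1 mul1mx opprB addrA subrK.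
have E1 : (1%:M - graph_proj Z) *m graph_proj X =
    - t *: ((1%:M - graph_proj Z) *m J Y *m S X *m (graph_mx X)^T).
  have E0 : (1%:M - graph_proj Z) *m graph_mx X =
      - t *: ((1%:M - graph_proj Z) *m J Y).
    have -> : graph_mx X = graph_mx Z - t *: J Y by rewrite MZ addrK.
    rewrite mulmxBr [in X in X - _]mulmxBl mul1mx graph_proj_mul subrr sub0r.
    by rewrite -scalemxAr scaleNr.
  by rewrite {2}/graph_proj !mulmxA E0 -!scalemxAl.
have E2 : graph_proj Z *m (1%:M - graph_proj X) =
    t *: (graph_mx Z *m S Z *m (J Y)^T *m (1%:M - graph_proj X)).
  have E0 : (graph_mx Z)^T *m (1%:M - graph_proj X) =
      t *: ((J Y)^T *m (1%:M - graph_proj X)).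
    have -> : (graph_mx Z)^T = (graph_mx X)^T + t *: (J Y)^T.
      by rewrite MZ linearD/= linearZ.
    rewrite mulmxDl [X in X + _]mulmxBr mulmx1 mul_graph_proj.
    by rewrite subrr add0r -scalemxAl.
  by rewrite {1}/graph_proj -[LHS]mulmxA E0 -scalemxAr !mulmxA.
by rewrite E1 E2 scaleNr opprK scalerDr addrC.
Qed.

End graph_projection.

(** * First variation of the integrand in graph coordinates *)

Section graph_gradient.
Context {R : realType} {m n : nat}.
Implicit Types X Y : 'M[R]_(n, m).
Local Notation J Y := (col_mx 0 Y : 'M[R]_(m + n, m)).
Local Notation S X := (invmx (gram X)).

Lemma derive_path (f : 'M[R]_(n, m) -> R) X Y v :
  is_derive (0 : R) 1 (fun t : R => f (X + t *: Y)) v -> 'D_Y f X = v.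
Proof.
move=> [_ <-].
have E : (fun h : R => h^-1 *: ((f \o shift X) (h *: Y) - f X)) =
    (fun h : R => h^-1 *: (((fun t : R => f (X + t *: Y)) \o shift 0) (h *: 1) -
      f (X + 0 *: Y))).
  apply/funext => h /=; rewrite scale0r !addr0; congr (_ *: (f _ - _)).
  by rewrite addrC [h *: 1]mulr1.
by rewrite /derive E.
Qed.

Lemma derive_mx_grad p q (psi : 'M[R]_(p, q) -> R) (Z W : 'M[R]_(p, q)) :
  differentiable psi Z -> 'D_W psi Z = \tr ((mx_grad psi Z)^T *m W).
Proof.
move=> df; rewrite deriveE// {1}[W]matrix_sum_delta linear_sum.
transitivity (\sum_i \sum_j W i j * mx_grad psi Z i j).
  apply: eq_bigr => i _; rewrite linear_sum; apply: eq_bigr => j _.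
  by rewrite linearZ /= mxE deriveE.
rewrite exchange_big; apply: eq_bigr => j _; rewrite mxE; apply: eq_bigr => i _.
by rewrite [(_^T) _ _]mxE mulrC.
Qed.

Let cvg_id0 : (fun t : R => t) @ 0^' --> (0 : R).
Proof. by move=> A A0; apply: filterS A0 => t At _. Qed.

Let path_cvg X Y : (fun t : R => X + t *: Y) @ 0^' --> X.
Proof.
apply: cvg_mx => i j; under eq_fun do rewrite !mxE.
suff : (fun t : R => X i j + t * Y i j) @ 0^' --> X i j + 0 * Y i j.
  by rewrite mul0r addr0.
apply: cvgD; first exact: cvg_cst.
apply: cvgM; last exact: cvg_cst.
exact: cvg_id0.
Qed.

Lemma is_derive_graph_proj X Y :
  is_derive (0 : R) 1 (fun t : R => graph_proj (X + t *: Y))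
    ((1%:M - graph_proj X) *m J Y *m S X *m (graph_mx X)^T +
     graph_mx X *m S X *m (J Y)^T *m (1%:M - graph_proj X)).
Proof.
set dT := _ + _.
have lim_ : (fun h : R => h^-1 *: (graph_proj (X + h *: Y) - graph_proj X)) @ 0^' --> dT.
  apply: (@cvg_trans _ ((fun t : R => (1%:M - graph_proj (X + t *: Y)) *m J Y *m S X *m (graph_mx X)^T +
     graph_mx (X + t *: Y) *m S (X + t *: Y) *m (J Y)^T *m (1%:M - graph_proj X)) @ 0^')).
    apply: near_eq_cvg; near=> t; rewrite graph_proj_increment scalerA mulVf ?scale1r//.
    by near: t; exact: nbhs_dnbhs_neq.
  have pc := @path_cvg X Y.
  apply: cvgD.
    do 3 (apply: cvg_mulmx; last exact: cvg_cst).
    by apply: cvgB; [exact: cvg_cst|exact: cvg_graph_proj].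
  do 2 (apply: cvg_mulmx; last exact: cvg_cst).
  by apply: cvg_mulmx; [exact: cvg_graph_mx|exact: cvg_invgram].
have E : (fun h : R => h^-1 *: (((fun t : R => graph_proj (X + t *: Y)) \o shift 0) (h *: 1) -
      graph_proj (X + 0 *: Y))) =
    (fun h : R => h^-1 *: (graph_proj (X + h *: Y) - graph_proj X)).
  by apply/funext => h /=; rewrite scale0r !addr0 [h *: 1]mulr1.
apply: DeriveDef; first by rewrite /derivable E; apply/cvg_ex; eexists; exact: lim_.
by rewrite /derive E; exact: cvg_lim lim_.
Unshelve. all: by end_near. Qed.

(** Along the line the Gram matrix is a quadratic polynomial in t with linear coefficient [B];
    Jacobi's formula and the chain rule for the square root do the rest. *)
Lemma is_derive_area X Y :
  is_derive (0 : R) 1 (fun t : R => area (X + t *: Y))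
    (area X * \tr (S X *m (graph_mx X)^T *m J Y)).
Proof.
have MZ (t : R) : graph_mx (X + t *: Y) = graph_mx X + t *: J Y.
  by rewrite /graph_mx scale_col_mx scaler0 add_col_mx addr0.
have MZT (t : R) : (graph_mx (X + t *: Y))^T = (graph_mx X)^T + t *: (J Y)^T.
  by rewrite MZ linearD/= linearZ.
pose B := (J Y)^T *m graph_mx X + (graph_mx X)^T *m J Y.
have dgram i j : is_derive (0 : R) 1 (fun t : R => gram (X + t *: Y) i j) (B i j).
  pose b := B i j; pose c := ((J Y)^T *m J Y) i j.
  have -> : (fun t : R => gram (X + t *: Y) i j) =
      (fun t : R => gram X i j + t * (b + t * c)).
    apply/funext => t; rewrite /gram MZT MZ mulmxDl !mulmxDr.
    rewrite -!scalemxAl -!scalemxAr /b /B /c !mxE.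
    by set u1 := \sum_(k < _) _; set u2 := \sum_(k < _) _; set u3 := \sum_(k < _) _;
      set u4 := \sum_(k < _) _; ring.
  have lim_ : (fun h : R => h^-1 *: (gram X i j + h * (b + h * c) -
      (gram X i j + 0 * (b + 0 * c)))) @ 0^' --> b.
    apply: (@cvg_trans _ ((fun h : R => b + h * c) @ 0^')).
      apply: near_eq_cvg; near=> h.
      rewrite mul0r addr0 [X in _ *: X](_ : _ = h *: (b + h * c)); last by rewrite addrAC subrr add0r.
      by rewrite scalerA mulVf ?scale1r//; near: h; exact: nbhs_dnbhs_neq.
    suff : (fun h : R => b + h * c) @ 0^' --> b + 0 * c by rewrite mul0r addr0.
    apply: cvgD; first exact: cvg_cst.
    by apply: cvgM; [exact: cvg_id0|exact: cvg_cst].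
  have E : (fun h : R => h^-1 *: (((fun t : R => gram X i j + t * (b + t * c)) \o shift 0) (h *: 1) -
      (gram X i j + 0 * (b + 0 * c)))) = (fun h : R => h^-1 *: (gram X i j + h * (b + h * c) -
      (gram X i j + 0 * (b + 0 * c)))).
    by apply/funext => h /=; rewrite addr0 [h *: 1]mulr1.
  apply: DeriveDef; first by rewrite /derivable E; apply/cvg_ex; eexists; exact: lim_.
  by rewrite /derive E; exact: cvg_lim lim_.
have ddet := is_derive_det dgram.
have X0 : X + 0 *: Y = X by rewrite scale0r addr0.
have d0 : 0 < \det (gram (X + 0 *: Y)) by exact: det_gram_gt0.
have := is_derive1_comp (g := fun t : R => \det (gram (X + t *: Y)))
  (is_derive1_sqrt d0) ddet.
rewrite X0 in d0 *; move=> H; apply: is_derive_eq H _.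
have adjE : \adj (gram X) = \det (gram X) *: S X.
  by rewrite /invmx gram_unit scalerA mulfV ?scale1r// gt_eqF.
(* The two terms of [B] are transposes of each other; the resulting 2 cancels the one from the
   square root. *)
have trE : \tr (B *m S X) = 2 * \tr (S X *m (graph_mx X)^T *m J Y).
  rewrite mulmxDl linearD/= [X in X + _ = _](_ : _ = \tr (S X *m (graph_mx X)^T *m J Y)).
    by rewrite [X in _ + X]mxtrace_mulC mulmxA; ring.
  by rewrite -mxtrace_tr !trmx_mul trmxK invgram_sym mulmxA.
rewrite adjE -scalemxAr linearZ/= trE -/(area X).
have a0 := area_gt0 X.
have dE : \det (gram X) = area X ^+ 2 by rewrite sqr_sqrtr// ltW.
rewrite dE; set t := \tr _; field.
by rewrite gt_eqF.
Unshelve. all: by end_near. Qed.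

(** The gradient at M = [graph_mx X] of M |-> psi(M (M^t M)^-1 M^t) sqrt(det(M^t M)), a function of
    all matrices M of full rank. *)
Definition graph_grad (psi : 'M[R]_(m + n) -> R) X : 'M[R]_(m + n, m) :=
  area X *: ((psi (graph_proj X) *: graph_mx X +
    (1%:M - graph_proj X) *m
      (mx_grad psi (graph_proj X) + (mx_grad psi (graph_proj X))^T) *m
      graph_mx X) *m S X).

(** The projection varies by the symmetric matrix K + K^t, and pairing the gradient of psi with it
    equals pairing its symmetrization [d] with K: hence the sum of gradient and transpose in
    [d_grassmannian]. *)
Lemma derive_graph (psi : 'M[R]_(m + n) -> R) X Y :
  differentiable psi (graph_proj X) ->
  'D_Y (fun X => psi (graph_proj X) * area X) X =
  \tr ((graph_grad psi X)^T *m J Y).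
Proof.
move=> dpsi; apply: derive_path.
set T := graph_proj X.
pose K := (1%:M - T) *m J Y *m S X *m (graph_mx X)^T.
have KT : K^T = graph_mx X *m S X *m (J Y)^T *m (1%:M - T).
  by rewrite /K !trmx_mul trmxK invgram_sym linearB/= trmx1 graph_proj_sym !mulmxA.
have X0 : X + 0 *: Y = X by rewrite scale0r addr0.
have dT : is_derive (0 : R) 1 (fun t : R => graph_proj (X + t *: Y)) (K + K^T).
  by rewrite KT; exact: is_derive_graph_proj.
set G := mx_grad psi T; pose d := G + G^T.
have dpsiT : is_derive (0 : R) 1 (fun t : R => psi (graph_proj (X + t *: Y)))
    (\tr (d *m K)).
  pose gam (t : R) := graph_proj (X + t *: Y).
  have dgam : differentiable gam 0.
    by apply/derivable1_diffP; case: dT.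
  have dpg : differentiable psi (gam 0) by rewrite /gam X0.
  have dc : differentiable (psi \o gam) (0 : R) by exact: differentiable_comp.
  apply: DeriveDef; first exact: diff_derivable.
  rewrite -[LHS]/('D_1 (psi \o gam) 0) deriveE// diff_comp//=.
  have -> : 'd gam 0 1 = K + K^T by rewrite -deriveE//; case: dT.
  rewrite -deriveE// derive_mx_grad// /gam X0 -/T -/G.
  rewrite mulmxDr mxtraceD /d mulmxDl mxtraceD addrC; congr (_ + _).
  by rewrite -trmx_mul mxtrace_tr mxtrace_mulC.
apply: is_derive_eq (is_deriveM dpsiT (is_derive_area X Y)) _.
rewrite X0 -/T /graph_grad -/T -/G -/d.
have dsym : d^T = d by rewrite /d linearD/= trmxK addrC.
have -> : (area X *: ((psi T *: graph_mx X + (1%:M - T) *m d *m graph_mx X) *m S X))^T =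
    area X *: (psi T *: (S X *m (graph_mx X)^T) + S X *m (graph_mx X)^T *m d *m (1%:M - T)).
  rewrite linearZ/= trmx_mul invgram_sym linearD/= linearZ/= !trmx_mul dsym.
  by rewrite linearB/= trmx1 graph_proj_sym -/T mulmxDr -scalemxAr !mulmxA.
rewrite -scalemxAl mxtraceZ [in RHS]mulmxDl [in RHS]mxtraceD -scalemxAl mxtraceZ.
have -> : \tr (d *m K) = \tr (S X *m (graph_mx X)^T *m d *m (1%:M - T) *m J Y).
  rewrite /K !mulmxA -[X in \tr X = _]mulmxA mxtrace_mulC -!mulmxA.
  by rewrite !mulmxA.
rewrite mulrDr; rewrite -[X in X + _]/(_ * _) -[X in _ + X = _]/(_ * _); ring.
Qed.

Lemma mx_grad_graph (psi : 'M[R]_(m + n) -> R) X :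
  differentiable psi (graph_proj X) ->
  mx_grad (fun X => psi (graph_proj X) * area X) X = dsubmx (graph_grad psi X).
Proof.
move=> dpsi; apply/matrixP => i j; rewrite [LHS]mxE derive_graph//.
rewrite -{1}[graph_grad psi X]vsubmxK tr_col_mx mul_row_col mulmx0 add0r.
set D := dsubmx _; rewrite /mxtrace (bigD1 j)//= big1 ?addr0; last first.
  by move=> k kj; rewrite mxE big1// => l _; rewrite !mxE (negbTE kj) andbF mulr0.
rewrite mxE (bigD1 i)//= big1 ?addr0 => [|k ki].
  by rewrite [(_^T) _ _]mxE [(delta_mx _ _) _ _]mxE !eqxx mulr1.
by rewrite [(delta_mx _ _) _ _]mxE (negbTE ki) mulr0.
Qed.

(** M^t annihilates 1 - T, so M^t G reduces to psi(T) area(X) id, while blockwise M^t G is the upper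
    block plus X^t times the lower one. *)
Lemma usubmx_graph_grad (psi : 'M[R]_(m + n) -> R) X :
  usubmx (graph_grad psi X) =
  (psi (graph_proj X) * area X)%:M - X^T *m dsubmx (graph_grad psi X).
Proof.
have -> : (psi (graph_proj X) * area X)%:M = (graph_mx X)^T *m graph_grad psi X.
  rewrite /graph_grad -scalemxAr mulmxA mulmxDr -scalemxAr -/(gram X) !mulmxA.
  rewrite mulmxBr mulmx1 mul_graph_proj subrr !mul0mx addr0 -scalemxAl mulmxV ?gram_unit//.
  by rewrite scalerA -scalemx1 mulrC.
rewrite -{2}[graph_grad psi X]vsubmxK /graph_mx tr_col_mx trmx1 mul_row_col mul1mx.
by rewrite addrK.
Qed.

Lemma graph_grad_mul (psi : 'M[R]_(m + n) -> R) X :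
  graph_grad psi X *m (graph_mx X)^T =
  area X *: (psi (graph_proj X) *: graph_proj X + (1%:M - graph_proj X) *m
    (mx_grad psi (graph_proj X) + (mx_grad psi (graph_proj X))^T) *m graph_proj X).
Proof.
rewrite /graph_grad -scalemxAl !mulmxDl -!scalemxAl; congr (_ *: (_ + _)).
by rewrite /graph_proj !mulmxA.
Qed.

Lemma cvg_graph_grad (psi : 'M[R]_(m + n) -> R) (T : Type) (F : set_system T)
    (f : T -> 'M[R]_(n, m)) X : Filter F ->
  {for graph_proj X, continuous psi} ->
  {for graph_proj X, continuous (mx_grad psi)} ->
  f @ F --> X -> (fun t => graph_grad psi (f t)) @ F --> graph_grad psi X.
Proof.
move=> FF cpsi cgrad fX.
have cT := cvg_graph_proj FF fX.
have cM := cvg_graph_mx FF fX.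
have cG : (fun t => mx_grad psi (graph_proj (f t))) @ F --> mx_grad psi (graph_proj X).
  exact: (@cvg_comp _ _ _ (fun t => graph_proj (f t)) (mx_grad psi) F _ _ cT cgrad).
have cP : (fun t => psi (graph_proj (f t))) @ F --> psi (graph_proj X).
  exact: (@cvg_comp _ _ _ (fun t => graph_proj (f t)) psi F _ _ cT cpsi).
apply: cvgZ; first exact: cvg_area.
apply: cvg_mulmx; last exact: cvg_invgram.
apply: cvgD; first exact: cvgZ.
have cI : (fun t => 1%:M - graph_proj (f t)) @ F --> 1%:M - graph_proj X.
  by apply: cvgB cT; exact: cvg_cst.
have cS : (fun t => mx_grad psi (graph_proj (f t)) + (mx_grad psi (graph_proj (f t)))^T)
    @ F --> mx_grad psi (graph_proj X) + (mx_grad psi (graph_proj X))^T.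
  by apply: cvgD (cvg_trmx cG).
exact: (cvg_mulmx (cvg_mulmx cI cS) cM).
Qed.

End graph_gradient.

(** * The atomic condition *)

Section weighted_image.
Context d d' (T : measurableType d) (T' : measurableType d') {R : realType}.
Variables (mu : {measure set T -> \bar R}) (H : T -> T') (w : T -> R).
Hypotheses (mH : measurable_fun setT H) (mw : measurable_fun setT w).
Hypotheses (w0 : forall x, 0 <= w x) (w1 : (\int[mu]_x (w x)%:E = 1)%E).

(* The hypotheses are arguments in order that the measure and probability
   structures can be attached to the definition. *)
Definition weighted_image (_ : measurable_fun setT H) (_ : measurable_fun setT w)
    (_ : forall x, 0 <= w x) (_ : (\int[mu]_x (w x)%:E = 1)%E) (E : set T') : \bar R :=
  (\int[mu]_(x in H @^-1` E) (w x)%:E)%E.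

Local Notation nu := (weighted_image mH mw w0 w1).

Let mHE (E : set T') : measurable E -> measurable (H @^-1` E).
Proof. by move=> mE; rewrite -[X in measurable X]setTI; exact: mH. Qed.

Let nu0 : nu set0 = 0%E.
Proof. by rewrite /weighted_image preimage_set0 integral_set0. Qed.

Let nu_ge0 E : (0 <= nu E)%E.
Proof. by apply: integral_ge0 => x _; rewrite lee_fin. Qed.

Let nu_sigma_additive : semi_sigma_additive nu.
Proof.
move=> /= F mF tF mUF; rewrite /weighted_image; apply: cvg_toP.
  apply: ereal_nondecreasing_is_cvgn => a b ab.
  apply: lee_sum_nneg_natr => // k _ _.
  by apply: integral_ge0 => x _; rewrite lee_fin.
rewrite preimage_bigcup ge0_integral_bigcup//=.
- by move=> k; exact: mHE.
- by apply/measurable_EFinP; exact: measurable_funTS.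
- by move=> x _; rewrite lee_fin.
- apply/trivIsetP => i j _ _ ij; rewrite -preimage_setI.
  by move/trivIsetP : tF => /(_ _ _ _ _ ij) ->//; rewrite preimage_set0.
Qed.

HB.instance Definition _ := isMeasure.Build _ _ _ nu nu0 nu_ge0 nu_sigma_additive.

Let nuT : nu setT = 1%E.
Proof. by rewrite /weighted_image preimage_setT. Qed.

HB.instance Definition _ := Measure_isProbability.Build _ _ _ nu nuT.

Import HBNNSimple.

Lemma ge0_integral_weighted_image (f : T' -> \bar R) : measurable_fun setT f ->
  (forall y, 0 <= f y)%E ->
  (\int[nu]_y f y = \int[mu]_x (f (H x) * (w x)%:E))%E.
Proof.
move=> mf f0; pose g := nnsfun_approx measurableT mf.
have mgw n : measurable_fun setT (fun x => (g n (H x) * w x)%:E).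
  by apply/measurable_EFinP; apply: measurable_funM => //; exact: measurableT_comp.
have L : (fun n => \int[nu]_y (g n y)%:E)%E @ \oo --> (\int[nu]_y f y)%E.
  rewrite [X in _ --> X](_ : _ = \int[nu]_y limn (EFin \o g ^~ y))%E.
    apply: cvg_monotone_convergence => //.
    - by move=> n; exact/measurable_EFinP.
    - by move=> n z _; rewrite lee_fin.
    - by move=> z _ a b ab; rewrite lee_fin; exact/lefP/nd_nnsfun_approx.
  apply: eq_integral => z _; apply/esym/cvg_lim => //.
  exact: cvg_nnsfun_approx.
have L' : (fun n => \int[mu]_x (g n (H x) * w x)%:E)%E @ \oo -->
    (\int[mu]_x (f (H x) * (w x)%:E))%E.
  rewrite [X in _ --> X](_ : _ =
      \int[mu]_x limn (fun n => (g n (H x) * w x)%:E))%E.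
    apply: cvg_monotone_convergence => //.
    - by move=> n z _; rewrite lee_fin mulr_ge0.
    - move=> z _ a b ab; rewrite lee_fin ler_wpM2r//.
      exact/lefP/nd_nnsfun_approx.
  apply: eq_integral => z _; apply/esym/cvg_lim => //.
  under eq_fun do rewrite EFinM.
  by apply: cvgeZr => //; exact: cvg_nnsfun_approx.
have E n : (\int[nu]_y (g n y)%:E = \int[mu]_x (g n (H x) * w x)%:E)%E.
  rewrite integral_nnsfun// patch_setT sintegralE.
  transitivity (\sum_(y \in range (g n))
      \int[mu]_x (y * (\1_(g n @^-1` [set y]) (H x) * w x))%:E)%E.
    apply: eq_fsbigr => y /set_mem[z _ gz].
    have mp : measurable (g n @^-1` [set y]) by [].
    have y0 : 0 <= y by rewrite -gz.
    under [RHS]eq_integral do rewrite EFinM.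
    rewrite ge0_integralZl//; last 2 first.
    - apply/measurable_EFinP; apply: measurable_funM => //.
      exact: (measurableT_comp (measurable_indic mp) mH).
    - by move=> x _; rewrite lee_fin mulr_ge0.
    congr (_ * _)%E; rewrite /= /weighted_image integral_mkcond.
    apply: eq_integral => x _; rewrite patchE indicE.
    have [/set_mem xi|xi] := boolP (x \in _).
      by rewrite mem_set// mul1r.
    by rewrite memNset ?mul0r// => xi'; move/negP: xi; apply; rewrite inE.
  rewrite -ge0_integral_fsum//; last 2 first.
  - move=> y; have mp : measurable (g n @^-1` [set y]) by [].
    apply/measurable_EFinP; apply: measurable_funM => //.
    apply: measurable_funM => //.
    exact: (measurableT_comp (measurable_indic mp) mH).
  - move=> y x _; rewrite lee_fin indicE.
    have [/set_mem <-|_] := boolP (H x \in _).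
      by rewrite mulr_ge0// mulr_ge0.
    by rewrite mul0r mulr0.
  apply: eq_integral => x _; rewrite [in RHS]fimfunE.
  rewrite fsumEFin//; congr EFin.
  rewrite !fsbig_finite//= big_distrl/=; apply: eq_bigr => y _; ring.
move: L; under eq_fun do rewrite E; move=> L.
by apply: (cvg_unique _ L L'); exact: ereal_hausdorff.
Qed.

(** As w >= 0, the positive and negative parts of f(H) w are those of f(H) times w. *)
Lemma Rintegral_weighted_image (f : T' -> R) : measurable_fun setT f ->
  rintegrable mu (fun x => f (H x) * w x) ->
  \int[nu]_y f y = \int[mu]_x (f (H x) * w x).
Proof.
move=> mf ifw; rewrite /Rintegral; congr fine; rewrite integralE [RHS]integralE.
rewrite !ge0_integral_weighted_image//; last 2 first.
  by apply: measurable_funeneg; exact/measurable_EFinP.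
  by apply: measurable_funepos; exact/measurable_EFinP.
congr (_ - _)%E; apply: eq_integral => x _; rewrite !unlock /= -EFin_max -EFinM.
  by rewrite -EFin_max maxr_pMl// mul0r.
by rewrite -EFin_max maxr_pMl// mul0r mulNr.
Qed.

End weighted_image.

Lemma open_setI_preimage (T T' : topologicalType) (U : set T) (V : set T')
    (f : T -> T') : open U -> open V -> (forall x, U x -> {for x, continuous f}) ->
  open (U `&` f @^-1` V).
Proof.
move=> oU oV cf; rewrite openE => x [Ux fx]; apply: filterI.
  exact: open_nbhs_nbhs.
by apply: cf => //; exact: open_nbhs_nbhs.
Qed.

Section grassmannian_measurability.
Context {R : realType} {N : nat}.

Lemma open_continuous_measurable_mx (U : set 'M[R]_N) (f : 'M[R]_N -> R) : open U ->
  (forall A, U A -> {for A, continuous f}) -> measurable_fun U f.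
Proof.
move=> oU cf; apply: (measurability _ (RGenOpens.measurableE R)) => //.
move=> _ [_ [a [b ->]] <-]; apply: open_measurable_mx.
exact: open_setI_preimage.
Qed.

Lemma measurable_grassmannian m : measurable (grassmannian m : set 'M[R]_N).
Proof.
pose f (A : 'M[R]_N) := `|A^T - A| + `|A *m A - A| + `|\tr A - m%:R|.
have cf : continuous f.
  move=> A; pose F := nbhs A; have FF : Filter F by exact: nbhs_filter.
  have cA : (fun B : 'M[R]_N => B) @ F --> A by exact: cvg_id.
  apply: cvgD; last first.
    apply: cvg_norm; apply: cvgB; last exact: cvg_cst.
    by apply: cvg_sumr => i; exact: cvg_coord.
  apply: cvgD; apply: cvg_norm; apply: cvgB => //; first exact: cvg_trmx.
  exact: cvg_mulmx.
rewrite (_ : grassmannian m = f @^-1` [set 0]).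
  rewrite -[X in measurable X]setTI.
  exact: (continuous_measurable_mx cf).
apply/seteqP; split => A.
  by move=> [A1 A2 A3]; rewrite /= /f A1 A2 A3 !subrr !normr0 !addr0.
rewrite /= /f => /eqP; rewrite paddr_eq0 ?addr_ge0// paddr_eq0// !normr_eq0 !subr_eq0.
by move=> /andP[/andP[/eqP A1 /eqP A2] /eqP A3].
Qed.

End grassmannian_measurability.

(** * K_F as the graph of a continuous map *)

Section graph_support.
Context {R : realType} {m n : nat}.
Variable Psi : 'M[R]_(m + n) -> R.
Hypothesis Psi_C1 : C1_grassmannian m Psi.
Local Notation Phi := (chosen_extension m Psi).
Implicit Types X : 'M[R]_(n, m).

Lemma chosen_extensionP : C1_extension m Psi Phi.
Proof. exact: (getPex Psi_C1). Qed.

Lemma chosen_extension_C1 T : grassmannian m T ->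
  differentiable Phi T /\ {for T, continuous (mx_grad Phi)}.
Proof. by case: chosen_extensionP => U [_ GU C1 _] /GU /C1. Qed.

Lemma chosen_extensionE T : grassmannian m T -> Phi T = Psi T.
Proof. by case: chosen_extensionP => U [_ _ _]; exact. Qed.

(** The point of [K_F] above X. Expressing it by [graph_grad] makes its continuity in X visible. *)
Definition graph_point X : 'M[R]_(n + n + m, m) :=
  col_mx (col_mx X (dsubmx (graph_grad Phi X))) (- usubmx (graph_grad Phi X)).

(** Psi is arbitrary off the Grassmannian, but graph projections stay on it, so the C^1 extension
    may be differentiated instead. *)
Lemma F_PsiE : F_Psi Psi = (fun X => Phi (graph_proj X) * area X).
Proof.
apply/funext => X; rewrite /F_Psi chosen_extensionE//.
exact: graph_proj_grassmannian.
Qed.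

Lemma K_F_graph_point : K_F Psi = range graph_point.
Proof.
have E X : col_mx (col_mx X (mx_grad (F_Psi Psi) X))
    (X^T *m mx_grad (F_Psi Psi) X - (F_Psi Psi X)%:M) = graph_point X.
  rewrite F_PsiE mx_grad_graph; last first.
    by have [] := chosen_extension_C1 (graph_proj_grassmannian X).
  by rewrite /graph_point usubmx_graph_grad opprB.
by apply/seteqP; split => _ [X _ <-]; exists X.
Qed.

Lemma continuous_graph_point : continuous graph_point.
Proof.
move=> X; have [dPhi cgrad] := chosen_extension_C1 (graph_proj_grassmannian X).
have cG := @cvg_graph_grad _ _ _ _ _ (nbhs X) id X (nbhs_filter X)
  (differentiable_continuous dPhi) cgrad (@cvg_id _ (nbhs X)).
apply: (@cvg_mx _ _ (nbhs X) _) => i j; rewrite /graph_point.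
have [{}i ->|k ->] := split_ordP i.
  rewrite col_mxEu; under eq_fun do rewrite col_mxEu.
  have [l ->|l ->] := split_ordP i.
    rewrite col_mxEu; under eq_fun do rewrite col_mxEu.
    exact: coord_continuous.
  rewrite col_mxEd; under eq_fun do rewrite col_mxEd.
  rewrite mxE; under eq_fun do rewrite mxE.
  exact: (@cvg_coord _ _ (nbhs X) _ _ _ _ _ _ cG).
rewrite col_mxEd; under eq_fun do rewrite col_mxEd.
rewrite mxE [usubmx _ _ _]mxE; under eq_fun do rewrite mxE [usubmx _ _ _]mxE.
exact: (cvgN (@cvg_coord _ _ (nbhs X) _ _ _ _ _ _ cG)).
Qed.

(** A graph of a continuous map is closed: if Z is close to [graph_point X'], its top block is close
    to X', and by continuity Z is close to the point above its own top block. *)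
Lemma mx_dist_K_F_eq0 Z : mx_dist (K_F Psi) Z = 0 ->
  Z = graph_point (usubmx (usubmx Z)).
Proof.
set X := usubmx _ => Z0.
have K0 : K_F Psi !=set0 by rewrite K_F_graph_point; exists (graph_point 0), 0.
apply/eqP; rewrite -subr_eq0 -normr_le0; apply/ler_addgt0Pl => e e0.
rewrite addr0; have e20 : 0 < e / 2 by rewrite divr_gt0.
have := @continuous_graph_point X.
move=> /(@cvgrPdist_lt _ _ _ (nbhs X)) /(_ _ e20) /nbhs_ballP[d /= d0 dX].
have [|Y] := @mx_dist_lt _ _ _ _ K0 Z (Num.min (e / 2) d).
  by rewrite Z0 lt_min e20 d0.
rewrite K_F_graph_point => -[X' _ <-]; rewrite lt_min => /andP[Ze Zd].
rewrite (splitr e) -(subrKA (graph_point X')).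
apply: le_trans (ler_normD _ _) _; apply: lerD; first exact: ltW.
rewrite distrC; apply/ltW; apply: dX.
rewrite -ball_normE /ball_ /=; apply: le_lt_trans Zd.
apply: mx_norm_le => // i j.
have -> : (X - X') i j = (Z - graph_point X') (lshift m (lshift n i)) j.
  rewrite [LHS]mxE [RHS]mxE; congr (_ + _); first by rewrite /X !mxE.
  by rewrite [LHS]mxE [RHS]mxE /graph_point !col_mxEu.
exact: coord_le_norm.
Qed.

End graph_support.

Section bounds.
Context {R : realType}.

Lemma norm_det_le p (A : 'M[R]_p) c : (forall i j, `|A i j| <= c) ->
  `|\det A| <= \sum_(s : 'S_p) \prod_(i < p) c.
Proof.
move=> Ac; apply: le_trans (ler_norm_sum _ _ _) _; apply: ler_sum => s _.
rewrite normrM normr_sign mul1r normr_prod.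
by apply: ler_prod => i _; rewrite normr_ge0 Ac.
Qed.

Lemma area_bounded m n (C : R) : exists D, forall X : 'M[R]_(n, m),
  `|X| <= C -> area X <= D.
Proof.
exists (Num.sqrt (\sum_(s : 'S_m) \prod_(i < m) (1 + \sum_(k < n) C * C))).
move=> X XC; apply: ler_wsqrtr; apply: le_trans (ler_norm _) (norm_det_le _) => i j.
rewrite gramE mxE [(X^T *m X) i j]mxE mxE.
apply: le_trans (ler_normD _ _) _; apply: lerD.
  by case: (i == j); rewrite ?normr1 ?normr0.
apply: le_trans (ler_norm_sum _ _ _) _; apply: ler_sum => k _.
by rewrite normrM mxE ler_pM// (le_trans (coord_le_norm _ _ _) XC).
Qed.

End bounds.

Section almost_everywhere_bounded.
Context d (T : measurableType d) {R : realType}.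

Lemma ae_bounded_rintegrable (P : {finite_measure set T -> \bar R}) (f : T -> R) C :
  measurable_fun setT f -> {ae P, forall x, `|f x| <= C} -> rintegrable P f.
Proof.
move=> mf fC; apply/integrableP; split; first exact/measurable_EFinP.
apply: (@le_lt_trans _ _ (\int[P]_x (`|C|)%:E)%E).
  apply: ae_ge0_le_integral => //.
  - by apply/measurable_EFinP; exact: measurableT_comp.
  - by apply: filterS fC => x fx _; rewrite lee_fin (le_trans fx)// ler_norm.
by rewrite integral_cst//= ltey_eq fin_numM// fin_num_measure.
Qed.

Lemma ae_eq_Rintegral_nonmeasurable (P : {measure set T -> \bar R}) (f g : T -> R) :
  {ae P, forall x, f x = g x} -> \int[P]_x f x = \int[P]_x g x.
Proof.
move=> fg; congr fine; apply: ae_eq_integral_nonmeasurable.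
by apply: filterS fg => x ->.
Qed.

End almost_everywhere_bounded.

Lemma integral_gt0_eq0 d (T : measurableType d) {R : realType}
    (P : {measure set T -> \bar R}) (D : set T) (f : T -> R) : measurable D ->
  measurable_fun setT f -> (forall x, 0 < f x) ->
  (\int[P]_(x in D) (f x)%:E = 0)%E -> P D = 0%E.
Proof.
move=> mD mf f0 If.
have mf' : measurable_fun D (EFin \o f) by apply/measurable_EFinP; exact: measurable_funTS.
have [+ _] := ae_eq_integral_abs P mD mf'.
have -> : (\int[P]_(x in D) `|(EFin \o f) x| = 0)%E.
  by rewrite -If; apply: eq_integral => x _ /=; rewrite ger0_norm// ltW.
move=> /(_ erefl)[N [mN N0 DN]]; apply: subset_measure0 N0 => // x Dx.
by apply: DN => /= /(_ Dx) [fx]; have := f0 x; rewrite fx ltxx.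
Qed.

Lemma ae_eq_rintegrable d (T : measurableType d) {R : realType}
    (P : {measure set T -> \bar R}) (f g : T -> R) : measurable_fun setT f ->
  rintegrable P g -> {ae P, forall x, f x = g x} -> rintegrable P f.
Proof.
move=> mf /integrableP[_ intg] fg; apply/integrableP; split.
  exact/measurable_EFinP.
rewrite (_ : integral _ _ _ = \int[P]_x `|(EFin \o g) x|)%E//.
apply: ae_eq_integral_nonmeasurable.
by apply: filterS fg => x fgx _ /=; rewrite fgx.
Qed.

(** * From the moment identities to a Dirac mass *)

Section atomic.
Context {R : realType} {m n : nat}.
Variable Psi : 'M[R]_(m + n) -> R.
Hypothesis Psi_C1 : C1_grassmannian m Psi.
Hypothesis Psi_AC : atomic_condition m n Psi.
Local Notation Phi := (chosen_extension m Psi).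
Local Notation W := 'M[R]_(n + n + m, m).
Variables (mu : probability W R) (C : R).

Let X (Z : W) : 'M[R]_(n, m) := usubmx (usubmx Z).
(** Linear in Z, so that it commutes with taking means, and equal to [graph_grad] on [K_F]. *)
Let G (Z : W) : 'M[R]_(m + n, m) := col_mx (- dsubmx Z) (dsubmx (usubmx Z)).
Let xrow (l : 'I_n) : 'I_(n + n + m) := lshift m (lshift n l).
Let arow (l : 'I_n) : 'I_(n + n + m) := lshift m (rshift n l).
Let brow (i : 'I_m) : 'I_(n + n + m) := rshift (n + n) i.

Hypothesis mu_C : {ae mu, forall Z, `|Z| <= C}.
Hypothesis mu_K : {ae mu, forall Z, Z = graph_point Psi (X Z)}.
Hypothesis mu_A : forall i l,
  \int[mu]_Z (\sum_k Z (arow i) k * Z (xrow l) k) =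
  \sum_k \int[mu]_Z Z (arow i) k * \int[mu]_Z Z (xrow l) k.
Hypothesis mu_B : forall i l,
  \int[mu]_Z (\sum_k Z (brow i) k * Z (xrow l) k) =
  \sum_k \int[mu]_Z Z (brow i) k * \int[mu]_Z Z (xrow l) k.

Let XE Z l k : X Z l k = Z (xrow l) k.
Proof. by rewrite /X !mxE. Qed.

Let GEu Z i k : G Z (lshift n i) k = - Z (brow i) k.
Proof. by rewrite /G col_mxEu !mxE. Qed.

Let GEd Z i k : G Z (rshift m i) k = Z (arow i) k.
Proof. by rewrite /G col_mxEd !mxE. Qed.

Let GM Z : G Z *m (graph_mx (X Z))^T = row_mx (G Z) (G Z *m (X Z)^T).
Proof. by rewrite /graph_mx tr_col_mx trmx1 mul_mx_row mulmx1. Qed.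

Let GX Z i l : (G Z *m (X Z)^T) i l = \sum_k G Z i k * Z (xrow l) k.
Proof. by rewrite mxE; apply: eq_bigr => k _; rewrite [_^T _ _]mxE XE. Qed.

Let mean : W := \matrix_(i, k) \int[mu]_Z Z i k.

Let coord_int i k : rintegrable mu (fun Z : W => Z i k).
Proof.
apply: (@ae_bounded_rintegrable _ _ _ mu _ C); first exact: measurable_coord.
by apply: filterS mu_C => Z; apply: le_trans; exact: coord_le_norm.
Qed.

Let coord2_int a b : rintegrable mu (fun Z : W => \sum_k Z a k * Z b k).
Proof.
apply: rintegrable_sum => k.
apply: (@ae_bounded_rintegrable _ _ _ mu _ (C * C)).
  by apply: measurable_funM; exact: measurable_coord.
by apply: filterS mu_C => Z ZC; rewrite normrM ler_pM// (le_trans (coord_le_norm _ _ _)).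
Qed.

Let RintegralN (f : W -> R) : rintegrable mu f ->
  \int[mu]_Z (- f Z) = - \int[mu]_Z f Z.
Proof.
move=> intf; rewrite -mulN1r -RintegralZl//.
by congr Rintegral; apply/funext => Z; rewrite mulN1r.
Qed.

(* Each entry of G M^t is a coordinate or, up to sign, the inner product of a row
   of A or B with a row of X. *)
Let mean_GM i j : \int[mu]_Z (G Z *m (graph_mx (X Z))^T) i j =
  (G mean *m (graph_mx (X mean))^T) i j.
Proof.
have mE a k : mean a k = \int[mu]_Z Z a k by rewrite mxE.
rewrite GM; under eq_Rintegral do rewrite GM.
have [l ->|l ->] := split_ordP j.
  rewrite row_mxEl; under eq_Rintegral do rewrite row_mxEl.
  have [k ->|k ->] := split_ordP i.
    by rewrite GEu mE; under eq_Rintegral do rewrite GEu; exact: RintegralN.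
  by rewrite GEd mE; under eq_Rintegral do rewrite GEd.
rewrite row_mxEr GX; under eq_Rintegral do rewrite row_mxEr GX.
have [k ->|k ->] := split_ordP i.
  transitivity (- \int[mu]_Z (\sum_j Z (brow k) j * Z (xrow l) j)).
    rewrite -RintegralN//; congr Rintegral; apply/funext => Z.
    by rewrite -sumrN; apply: eq_bigr => h _; rewrite GEu mulNr.
  rewrite mu_B -sumrN; apply: eq_bigr => h _.
  by rewrite GEu mulNr !mE.
transitivity (\int[mu]_Z (\sum_j Z (arow k) j * Z (xrow l) j)).
  congr Rintegral; apply/funext => Z.
  by apply: eq_bigr => h _; rewrite GEd.
rewrite mu_A; apply: eq_bigr => h _.
by rewrite GEd !mE.
Qed.

Let rintegrableN (f : W -> R) : rintegrable mu f -> rintegrable mu (fun Z => - f Z).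
Proof.
move=> intf; have := rintegrableZ (-1) intf.
by under eq_fun do rewrite mulN1r.
Qed.

Let GM_int i j : rintegrable mu (fun Z => (G Z *m (graph_mx (X Z))^T) i j).
Proof.
under eq_fun do rewrite GM.
have [l ->|l ->] := split_ordP j.
  under eq_fun do rewrite row_mxEl.
  have [k ->|k ->] := split_ordP i.
    by under eq_fun do rewrite GEu; exact: rintegrableN.
  by under eq_fun do rewrite GEd.
under eq_fun do rewrite row_mxEr GX.
have [k ->|k ->] := split_ordP i.
  rewrite (_ : (fun _ => _) = fun Z : W => - \sum_j Z (brow k) j * Z (xrow l) j).
    exact: rintegrableN.
  apply/funext => Z; rewrite -sumrN; apply: eq_bigr => h _.
  by rewrite GEu mulNr.
rewrite (_ : (fun _ => _) = fun Z : W => \sum_j Z (arow k) j * Z (xrow l) j) //.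
by apply/funext => Z; apply: eq_bigr => h _; rewrite GEd.
Qed.

Let cvgX Z : X Z' @[Z' --> nbhs Z] --> X Z.
Proof.
apply: (@cvg_mx _ _ (nbhs Z) _) => i j; rewrite XE.
by under eq_fun do rewrite XE; exact: coord_continuous.
Qed.

Let H (Z : W) : 'M[R]_(m + n) := graph_proj (X Z).

Let mH : measurable_fun setT H.
Proof.
apply: measurable_mx => i j; apply: continuous_measurable_mx => Z.
by apply: (@cvg_coord _ _ (nbhs Z)); exact: (cvg_graph_proj _ (@cvgX Z)).
Qed.

Let m_area : measurable_fun setT (fun Z => area (X Z)).
Proof. by apply: continuous_measurable_mx => Z; exact: (cvg_area _ (@cvgX Z)). Qed.

Let area_int : rintegrable mu (fun Z => area (X Z)).
Proof.
have [D DP] := @area_bounded R m n C.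
apply: (@ae_bounded_rintegrable _ _ _ mu _ D) => //.
apply: filterS mu_C => Z ZC; rewrite ger0_norm ?sqrtr_ge0//; apply: DP.
apply: mx_norm_le => [|i j]; first exact: le_trans ZC.
by rewrite XE (le_trans (coord_le_norm _ _ _)).
Qed.

Let c := \int[mu]_Z area (X Z).

Let c_gt0 : 0 < c.
Proof.
rewrite lt_neqAle Rintegral_ge0 ?andbT; last by move=> Z _; exact: sqrtr_ge0.
rewrite eq_sym; apply/eqP => c0.
have := @integral_gt0_eq0 _ _ _ mu setT _ measurableT m_area (fun Z => area_gt0 _).
rewrite -EFin_Rintegral// -/c c0 => /(_ erefl) E0.
by have /eqP := etrans (esym (probability_setT mu)) E0; rewrite eqe oner_eq0.
Qed.

Let w (Z : W) : R := area (X Z) / c.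

Let mw : measurable_fun setT w.
Proof. by apply: measurable_funM => //; exact: measurable_cst. Qed.

Let w_gt0 Z : 0 < w Z.
Proof. by rewrite divr_gt0// area_gt0. Qed.

Let w0 Z : 0 <= w Z. Proof. exact/ltW. Qed.

Let wE : w = fun Z => c^-1 * area (X Z).
Proof. by apply/funext => Z; rewrite mulrC. Qed.

Let w_int : rintegrable mu w.
Proof. by rewrite wE; exact: rintegrableZ. Qed.

Let w1 : (\int[mu]_Z (w Z)%:E = 1)%E.
Proof.
by rewrite -EFin_Rintegral// wE RintegralZl// mulVf// gt_eqF.
Qed.

Let nu : probability 'M[R]_(m + n) R := weighted_image mH mw w0 w1.

Let nu_grassmannian : nu (grassmannian m) = 1%E.
Proof.
rewrite /nu /= /weighted_image -[RHS]w1; congr integral.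
by apply/seteqP; split => // Z _; exact: graph_proj_grassmannian.
Qed.

Let B (T : 'M[R]_(m + n)) := Phi T *: T +
  (1%:M - T) *m (mx_grad Phi T + (mx_grad Phi T)^T) *m T.

Let mB i j : measurable_fun (grassmannian m) (fun T => B T i j).
Proof.
have [U [oU GU C1 _]] := chosen_extensionP Psi_C1.
apply: measurable_funS GU _; first exact: open_measurable_mx.
apply: open_continuous_measurable_mx => // T UT; have [dPhi cg] := C1 T UT.
have cPhi := differentiable_continuous dPhi.
have cT : T' @[T' --> nbhs T] --> T by exact: cvg_id.
have cI : (1%:M - T') @[T' --> nbhs T] --> 1%:M - T.
  by apply: (@cvgB _ _ _ (nbhs T)) => //; exact: cvg_cst.
have cS : (mx_grad Phi T' + (mx_grad Phi T')^T) @[T' --> nbhs T] -->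
    mx_grad Phi T + (mx_grad Phi T)^T.
  by apply: (@cvgD _ _ _ (nbhs T)) => //; exact: (cvg_trmx cg).
apply: (@cvg_coord _ _ (nbhs T)); apply: (@cvgD _ _ _ (nbhs T)).
  exact: (@cvgZ _ _ _ (nbhs T)).
exact: (cvg_mulmx (cvg_mulmx cI cS) cT).
Qed.

Let A_averageE : A_average m Psi nu = c^-1 *: (G mean *m (graph_mx (X mean))^T).
Proof.
apply/matrixP => i j; rewrite mxE [RHS]mxE -mean_GM.
(* The integrand is extended by 0, since it is known to be measurable on the Grassmannian only. *)
rewrite Rintegral_mkcond.
have -> : (fun T => B_integrand m Psi T i j) \_ (grassmannian m) =
    (fun T => B T i j) \_ (grassmannian m).
  apply/funext => T; rewrite !patchE; case: ifPn => // /set_mem TG.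
  by rewrite /B_integrand /B (chosen_extensionE Psi_C1 TG).
have BH Z : ((fun T => B T i j) \_ (grassmannian m)) (H Z) * w Z =
    c^-1 * (graph_grad Phi (X Z) *m (graph_mx (X Z))^T) i j.
  rewrite patchE mem_set; last exact: graph_proj_grassmannian.
  by rewrite graph_grad_mul -/(B (graph_proj _)) [in RHS]mxE /w /H; ring.
have BG : {ae mu, forall Z, ((fun T => B T i j) \_ (grassmannian m)) (H Z) * w Z =
    c^-1 * (G Z *m (graph_mx (X Z))^T) i j}.
  apply: filterS mu_K => Z ZK; rewrite BH; congr (_ * (_ *m _) _ _).
  rewrite -[LHS]vsubmxK /G [in RHS]ZK /graph_point.
  by rewrite col_mxKd opprK col_mxKu col_mxKd.
have mBG := (measurable_restrictT _ (@measurable_grassmannian R (m + n) m)).1 (mB i j).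
rewrite Rintegral_weighted_image//; last first.
  apply: ae_eq_rintegrable (rintegrableZ c^-1 (GM_int i j)) BG.
  by apply: measurable_funM => //; exact: measurableT_comp.
rewrite (ae_eq_Rintegral_nonmeasurable BG) RintegralZl//.
exact: GM_int.
Qed.

(** The averaged matrix factors through R^m, so its kernel has dimension at least (m + n) - m; the
    first half of the atomic condition gives equality, and the second half applies. *)
Let nu_dirac : exists2 T0, grassmannian m T0 & forall E, measurable E -> nu E = \d_T0 E.
Proof.
have [ker_le ker_eq] := Psi_AC nu_grassmannian; apply: ker_eq.
apply/eqP; rewrite eqn_leq ker_le /dim_ker mxrank_ker mxrank_tr A_averageE/=.
have rk : (\rank (c^-1 *: (G mean *m (graph_mx (X mean))^T)) <= m)%N.
  rewrite scalemxAl; apply: leq_trans (mulmx_max_rank _ _) _; exact: leqnn.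
by rewrite leq_subRL ?rank_leq_row// leq_add2r.
Qed.

Lemma moments_dirac : exists Z0, forall E, measurable E -> mu E = \d_Z0 E.
Proof.
have [T0 _ nuT0] := nu_dirac.
pose D : set 'M[R]_(m + n) := ~` [set T0].
have mD : measurable D.
  apply: measurableC.
  rewrite (_ : [set T0] = (fun T => `|T - T0|) @^-1` [set 0]).
    rewrite -[X in measurable X]setTI; apply: continuous_measurable_mx => // T.
    apply: (@cvg_norm _ _ _ (nbhs T)); apply: (@cvgB _ _ _ (nbhs T)) => //.
    exact: cvg_cst.
  apply/seteqP; split => T /=; first by move=> ->; rewrite subrr normr0.
  by move=> /eqP; rewrite normr_eq0 subr_eq0 => /eqP.
have mHD : measurable (H @^-1` D) by rewrite -[X in measurable X]setTI; exact: mH.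
have HT0 : {ae mu, forall Z, H Z = T0}.
  exists (H @^-1` D); split => //.
  (* The weight is strictly positive, so null sets of nu pull back to null sets of mu. *)
  apply: (integral_gt0_eq0 mHD mw w_gt0).
  have := nuT0 _ mD; rewrite /nu /= /weighted_image => ->.
  by rewrite diracE memNset//; apply.
have muX : {ae mu, forall Z, H Z = T0 /\ Z = graph_point Psi (X Z)}.
  exact: filterI HT0 mu_K.
have [Z1 [HZ1 Z1K]] : exists Z1, H Z1 = T0 /\ Z1 = graph_point Psi (X Z1).
  apply: contrapT => /forallNP nZ; have [N [mN N0 sN]] := muX.
  have NT : N = setT by apply/seteqP; split => // Z _; apply: sN; exact: nZ.
  rewrite NT in N0.
  by have /eqP := etrans (esym (probability_setT mu)) N0; rewrite eqe oner_eq0.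
(* mu E is the integral of the indicator of E, which almost everywhere takes its value at Z1: equal
   projections force equal X, hence equal points of [K_F]. *)
exists Z1 => E mE; rewrite -[E]setIT -integral_indic//.
rewrite (ae_eq_integral_nonmeasurable (g := fun=> (\1_E Z1)%:E)); last first.
  apply: filterS muX => Z [HZ ZK] _; congr (\1_E _)%:E.
  rewrite Z1K {1}ZK; congr graph_point; apply: graph_proj_inj.
  exact: etrans HZ (esym HZ1).
by rewrite integral_cst// [X in (_ * X)%E]probability_setT mule1 setIT.
Qed.

End atomic.

(** * Representatives of the data *)

(** Each squared entry is a term of the sum under the Frobenius root. *)
Lemma mx_dist_le_frobenius {R : realType} p q (K : set 'M[R]_(p, q)) Z : K !=set0 ->
  mx_dist K Z <= frobenius_dist Z K.
Proof.
move=> K0; apply: lb_le_inf; first by have [Y KY] := K0; exists (frobenius_norm (Z - Y)), Y.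
move=> _ [Y KY <-]; apply: le_trans (mx_dist_le K0 Z KY) _.
apply: mx_norm_le => [|i j]; first exact: sqrtr_ge0.
rewrite -sqrtr_sqr; apply: ler_wsqrtr; rewrite (bigD1 i)//= (bigD1 j)//= -addrA lerDl.
by rewrite addr_ge0// sumr_ge0// => k _; rewrite ?sumr_ge0// => *; exact: sqr_ge0.
Qed.

Section sequences.
Context {R : realType} {m : nat}.
Local Notation V := 'cV[R]_m.
Variables (Omega : set V) (mO : measurable Omega).
Hypothesis Ooo : (lebesgue_cV m Omega < +oo)%E.
Local Notation P := (mfrestr mO Ooo).

Lemma Linfty_bounded_representative p q (f : nat -> V -> 'M[R]_(p, q)) :
  Linfty_bounded Omega f -> exists C (f' : nat -> V -> 'M[R]_(p, q)),
    forall j, [/\ measurable_fun setT (f' j), forall x, `|f' j x| <= C &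
      {ae P, forall x, f' j x = f j x}].
Proof.
move=> [mf [C fC]]; exists `|C|.
have /choice[f' f'P] j : exists g : V -> 'M[R]_(p, q), [/\ measurable_fun setT g,
    forall x, `|g x| <= `|C| & {ae P, forall x, g x = f j x}]; last by exists f'.
apply: Linfty_representative => //.
by apply: filterS (fC j) => x + Ox => /(_ Ox) fx; rewrite (le_trans fx)// ler_norm.
Qed.

Lemma L1_bounded_representative p (f : nat -> V -> 'cV[R]_p) :
  L1_bounded Omega f -> exists C (g : nat -> 'I_p -> V -> R),
    forall j i, [/\ rintegrable P (g j i), \int[P]_x `|g j i x| <= C &
      {ae P, forall x, g j i x = f j x i ord0}].
Proof.
move=> [mf [C fC]]; exists C.
have /choice[g gP] (ji : nat * 'I_p) : exists g : V -> R, [/\ rintegrable P g,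
    \int[P]_x `|g x| <= C & {ae P, forall x, g x = f ji.1 x ji.2 ord0}].
  exact: L1_representative.
by exists (fun j i => g (j, i)) => j i; exact: (gP (j, i)).
Qed.

Lemma weak_jacobian_representative n (u u' : V -> 'cV[R]_n)
    (Du Du' : V -> 'M[R]_(n, m)) phi l k : weak_jacobian Omega u Du ->
  measurable_fun setT u' -> measurable_fun setT Du' ->
  {ae P, forall x, u' x = u x} -> {ae P, forall x, Du' x = Du x} ->
  test_function Omega phi ->
  \int[P]_x (u' x l ord0 * partial k phi x) = - \int[P]_x (Du' x l k * phi x).
Proof.
move=> DuP mu mDu uu DuDu tphi; have [sphi _ _] := tphi.
have mphi := @measurable_smooth _ _ _ [::] sphi.
have mdphi := @measurable_smooth _ _ _ [:: k] sphi.
rewrite -(@Rintegral_representative _ _ _ mO Ooo (fun x => u x l ord0 * partial k phi x)).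
- rewrite -(@Rintegral_representative _ _ _ mO Ooo (fun x => Du x l k * phi x)).
  + exact: DuP.
  + by apply: measurable_funM => //; exact: (measurableT_comp (measurable_coord l k)).
  + by apply: filterS DuDu => x ->.
- by apply: measurable_funM => //; exact: (measurableT_comp (measurable_coord l ord0)).
- by apply: filterS uu => x ->.
Qed.

Lemma weak_row_div_representative p (A A' : V -> 'M[R]_(p, m))
    (f : V -> 'cV[R]_p) (g : V -> R) phi i : weak_row_div Omega A f ->
  measurable_fun setT A' -> measurable_fun setT g ->
  {ae P, forall x, A' x = A x} -> {ae P, forall x, g x = f x i ord0} ->
  test_function Omega phi ->
  \int[P]_x (\sum_k A' x i k * partial k phi x) = - \int[P]_x (g x * phi x).
Proof.
move=> AP mA mg AA gf tphi; have [sphi _ _] := tphi.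
have mphi := @measurable_smooth _ _ _ [::] sphi.
rewrite -(@Rintegral_representative _ _ _ mO Ooo
  (fun x => \sum_(k < m) A x i k * partial k phi x)).
- rewrite -(@Rintegral_representative _ _ _ mO Ooo (fun x => f x i ord0 * phi x)).
  + exact: AP.
  + exact: measurable_funM.
  + by apply: filterS gf => x ->.
- apply: measurable_sum => k; apply: measurable_funM.
    exact: (measurableT_comp (measurable_coord i k)).
  exact: (@measurable_smooth _ _ _ [:: k]).
- by apply: filterS AA => x ->.
Qed.

Lemma generates_young_measure_representative p q (W W' : nat -> V -> 'M[R]_(p, q))
    (mu : V -> probability 'M[R]_(p, q) R) (f : 'M[R]_(p, q) -> R) eta :
  generates_young_measure Omega W mu ->
  (forall j, measurable_fun setT (W' j)) ->
  (forall j, {ae P, forall x, W' j x = W j x}) ->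
  continuous f -> test_function Omega eta ->
  (fun j => \int[P]_x (f (W' j x) * eta x)) @ \oo -->
  \int[lebesgue_cV m]_(x in Omega) ((\int[mu x]_Z f Z) * eta x).
Proof.
move=> [_ W_mu] mW WW cf teta; have [seta _ _] := teta.
have := W_mu f eta cf teta; rewrite (_ : (fun j => \int[lebesgue_cV m]_(_ in _) _) =
  (fun j => \int[P]_x (f (W' j x) * eta x)))//.
apply/funext => j; apply: Rintegral_representative.
  apply: measurable_funM; last exact: (@measurable_smooth _ _ _ [::]).
  exact: (measurableT_comp (continuous_measurable_mx cf)).
by apply: filterS (WW j) => x ->.
Qed.

End sequences.

Theorem theorem4 (R : realType) (m n : nat) (m_gt0 : (0 < m)%N)
    (n_gt0 : (0 < n)%N)
    (Psi : 'M[R]_(m + n) -> R)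
    (Psi_C1 : C1_grassmannian m Psi)
    (Psi_gt0 : forall T, grassmannian m T -> 0 < Psi T)
    (Psi_AC : atomic_condition m n Psi)
    (Omega : set 'cV[R]_m) (oOmega : open Omega) (bOmega : bounded_set Omega)
    (u : nat -> 'cV[R]_m -> 'cV[R]_n)
    (Du : nat -> 'cV[R]_m -> 'M[R]_(n, m))
    (A : nat -> 'cV[R]_m -> 'M[R]_(n, m))
    (B : nat -> 'cV[R]_m -> 'M[R]_(m, m))
    (divA : nat -> 'cV[R]_m -> 'cV[R]_n)
    (divB : nat -> 'cV[R]_m -> 'cV[R]_m)
    (DuP : forall j, weak_jacobian Omega (u j) (Du j))
    (u_bounded : Linfty_bounded Omega u)
    (Du_bounded : Linfty_bounded Omega Du)
    (A_bounded : Linfty_bounded Omega A)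
    (B_bounded : Linfty_bounded Omega B)
    (divAP : forall j, weak_row_div Omega (A j) (divA j))
    (divBP : forall j, weak_row_div Omega (B j) (divB j))
    (divA_bounded : L1_bounded Omega divA)
    (divB_bounded : L1_bounded Omega divB)
    (W : nat -> 'cV[R]_m -> 'M[R]_(n + n + m, m))
    (WE : forall j x, W j x = col_mx (col_mx (Du j x) (A j x)) (B j x))
    (W_to_K : {ae lebesgue_cV m, forall x, Omega x ->
      (fun j => frobenius_dist (W j x) (K_F Psi)) @ \oo --> (0 : R)})
    (mu : 'cV[R]_m -> probability 'M[R]_(n + n + m, m) R)
    (W_mu : generates_young_measure Omega W mu) :
  {ae lebesgue_cV m, forall x, Omega x ->
    exists Z : 'M[R]_(n + n + m, m),
      forall E, measurable E -> mu x E = \d_Z E}.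
Proof.
have mO : measurable Omega := open_measurable_mx oOmega.
have Ooo := lebesgue_cV_bounded mO bOmega.
pose P := mfrestr mO Ooo.
have PE (f : 'cV[R]_m -> \bar R) : measurable_fun setT f ->
    (\int[P]_x f x = \int[lebesgue_cV m]_(x in Omega) f x)%E.
  exact: integral_mfrestr.
have Pae (Q : 'cV[R]_m -> Prop) : {ae P, forall x, Q x} ->
    {ae lebesgue_cV m, forall x, Omega x -> Q x}.
  exact: ae_mfrestr.
have PO : {ae P, forall x, Omega x} by apply: (mfrestr_ae mO Ooo); exact: aeW.
have [Cu [u' u'P]] := Linfty_bounded_representative mO Ooo u_bounded.
have [CDu [Du' Du'P]] := Linfty_bounded_representative mO Ooo Du_bounded.
have [CA [A' A'P]] := Linfty_bounded_representative mO Ooo A_bounded.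
have [CB [B' B'P]] := Linfty_bounded_representative mO Ooo B_bounded.
have [CdA [gA gAP]] := L1_bounded_representative mO Ooo divA_bounded.
have [CdB [gB gBP]] := L1_bounded_representative mO Ooo divB_bounded.
(* Assembled from the representatives of the blocks, so that its rows satisfy the weak equations of
   u, A and B. *)
pose W' j x : 'M[R]_(n + n + m, m) := col_mx (col_mx (Du' j x) (A' j x)) (B' j x).
pose C := Num.max 0 (Num.max CDu (Num.max CA CB)).
pose C' := Num.max Cu (Num.max CdA CdB).
have C0 : 0 <= C by rewrite le_max lexx.
have W'x j x l k : W' j x (lshift m (lshift n l)) k = Du' j x l k.
  by rewrite /W' !col_mxEu.
have W'a j x l k : W' j x (lshift m (rshift n l)) k = A' j x l k.
  by rewrite /W' col_mxEu col_mxEd.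
have W'b j x i k : W' j x (rshift (n + n) i) k = B' j x i k.
  by rewrite /W' col_mxEd.
have mW j : measurable_fun setT (W' j).
  apply: measurable_mx => i k.
  have [{}i ->|{}i ->] := split_ordP i; last first.
    under eq_fun do rewrite W'b.
    by apply: (measurableT_comp (measurable_coord i k)); case: (B'P j).
  have [{}i ->|{}i ->] := split_ordP i.
    under eq_fun do rewrite W'x.
    by apply: (measurableT_comp (measurable_coord i k)); case: (Du'P j).
  under eq_fun do rewrite W'a.
  by apply: (measurableT_comp (measurable_coord i k)); case: (A'P j).
have W_C j x : `|W' j x| <= C.
  apply: mx_norm_le => // i k.
  have [{}i ->|{}i ->] := split_ordP i; last first.
    have [_ /(_ x) BC _] := B'P j.
    by rewrite W'b (le_trans (coord_le_norm _ _ _))// (le_trans BC)// !le_max lexx !orbT.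
  have [{}i ->|{}i ->] := split_ordP i.
    have [_ /(_ x) DuC _] := Du'P j.
    by rewrite W'x (le_trans (coord_le_norm _ _ _))// (le_trans DuC)// !le_max lexx !orbT.
  have [_ /(_ x) AC _] := A'P j.
  by rewrite W'a (le_trans (coord_le_norm _ _ _))// (le_trans AC)// !le_max lexx !orbT.
have W'W j : {ae P, forall x, W' j x = W j x}.
  have [_ _ Du'E] := Du'P j; have [_ _ A'E] := A'P j; have [_ _ B'E] := B'P j.
  apply: filterS2 (filterI Du'E A'E) B'E => x [DE AE] BE.
  by rewrite WE /W' DE AE BE.
have mmu E : measurable E -> ae_rep P (fun x => mu x E).
  by move=> mE; apply: ae_measurable_ereal; exact: W_mu.1.
have W'_mu (f : 'M[R]_(n + n + m, m) -> R) eta : continuous f ->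
    test_function Omega eta ->
    (fun j => \int[P]_x (f (W' j x) * eta x)) @ \oo -->
    \int[lebesgue_cV m]_(x in Omega) ((\int[mu x]_Z f Z) * eta x).
  exact: generates_young_measure_representative W_mu mW W'W.
have K0 : K_F Psi !=set0 by eexists; exists 0.
have W'_K : {ae P, forall x, (fun j => mx_dist (K_F Psi) (W' j x)) @ \oo --> (0 : R)}.
  have W'W' : {ae P, forall x, forall j, W' j x = W j x} by exact: ae_forall_countable.
  apply: filterS2 (mfrestr_ae mO Ooo W_to_K) W'W' => x Wx WWx.
  apply: (squeeze_cvgr _ (cvg_cst 0) Wx); apply: nearW => j /=.
  by rewrite mx_dist_ge0// WWx mx_dist_le_frobenius.
have u'_C' j x l : `|u' j x l ord0| <= C'.
  have [_ /(_ x) uC _] := u'P j.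
  by rewrite (le_trans (coord_le_norm _ _ _))// (le_trans uC)// le_max lexx.
have u_weak l j phi : test_function Omega phi -> forall k,
    \int[P]_x (u' j x l ord0 * partial k phi x) =
    - \int[P]_x (W' j x (lshift m (lshift n l)) k * phi x).
  move=> tphi k; have [mu' _ u'E] := u'P j; have [mDu' _ Du'E] := Du'P j.
  under [in RHS]eq_Rintegral do rewrite W'x.
  exact: (weak_jacobian_representative l k (DuP j) mu' mDu' u'E Du'E tphi).
have mu' l j : measurable_fun setT (fun x => u' j x l ord0).
  by apply: (measurableT_comp (measurable_coord l ord0)); case: (u'P j).
(* There are finitely many pairs of rows, so one null set serves them all. *)
have momA : {ae P, forall x, forall il : 'I_n * 'I_n,
    \int[mu x]_Z (\sum_k Z (lshift m (rshift n il.1)) k * Z (lshift m (lshift n il.2)) k) =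
    \sum_k \int[mu x]_Z Z (lshift m (rshift n il.1)) k *
      \int[mu x]_Z Z (lshift m (lshift n il.2)) k}.
  apply: ae_forall_countable => -[i l] /=.
  apply: (young_div_curl oOmega PE Pae PO mW W_C C0 mmu W'_mu (mu' l)
    (fun j x => u'_C' j x l) (g := fun j => gA j i)).
  - by move=> j; case: (gAP j i).
  - by move=> j; case: (gAP j i) => _ gC _; rewrite (le_trans gC)// !le_max lexx orbT.
  - exact: u_weak.
  - move=> j phi tphi; have [mA' _ A'E] := A'P j; have [ig _ gE] := gAP j i.
    under [in LHS]eq_Rintegral do under eq_bigr do rewrite W'a.
    exact: (weak_row_div_representative (divAP j) mA' (rintegrable_measurable ig) A'E gE tphi).
have momB : {ae P, forall x, forall il : 'I_m * 'I_n,
    \int[mu x]_Z (\sum_k Z (rshift (n + n) il.1) k * Z (lshift m (lshift n il.2)) k) =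
    \sum_k \int[mu x]_Z Z (rshift (n + n) il.1) k *
      \int[mu x]_Z Z (lshift m (lshift n il.2)) k}.
  apply: ae_forall_countable => -[i l] /=.
  apply: (young_div_curl oOmega PE Pae PO mW W_C C0 mmu W'_mu (mu' l)
    (fun j x => u'_C' j x l) (g := fun j => gB j i)).
  - by move=> j; case: (gBP j i).
  - by move=> j; case: (gBP j i) => _ gC _; rewrite (le_trans gC)// !le_max lexx !orbT.
  - exact: u_weak.
  - move=> j phi tphi; have [mB' _ B'E] := B'P j; have [ig _ gE] := gBP j i.
    under [in LHS]eq_Rintegral do under eq_bigr do rewrite W'b.
    exact: (weak_row_div_representative (divBP j) mB' (rintegrable_measurable ig) B'E gE tphi).
have mu_K := young_dist oOmega PE Pae mW mmu W'_mu K0 W'_K.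
have mu_C := young_bounded oOmega PE Pae mW W_C mmu W'_mu C0.
suff : {ae P, forall x, Omega x ->
    exists Z : 'M[R]_(n + n + m, m), forall E, measurable E -> mu x E = \d_Z E}.
  by move=> /Pae; apply: filterS => x xP Ox; exact: xP.
apply: filterS2 (filterI mu_K mu_C) (filterI momA momB).
move=> x [xK xC] [xA xB] Ox.
apply: (moments_dirac Psi_C1 Psi_AC (xC Ox)).
- apply: filterS (xK Ox) => Z; exact: mx_dist_K_F_eq0.
- by move=> i l; exact: (xA (i, l)).
- by move=> i l; exact: (xB (i, l)).
Qed.
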